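(* In the setting of the context (random unimodal map with heteroscedastic dynamical noise; observed process $Z_n$ with constant modulation $s\equiv1$ and non-atomic observational noise law $\psi$; observable $\phi$ and thresholds $u_n$ such that the sets $B_n=\{\phi>u_n\}$ have diameter tending to $0$), fix $\tau>0$ and let $n'=\lfloor\tau/\Delta_n\rfloor$ with $\Delta_n=\int\psi(B_n-x)\,d\mu(x)>0$. Then $l(\lambda)=1$ for every real $\lambda$ with $e^{i\lambda}\ne1$, and the random variables $$S_{n'}=\sum_{i=0}^{n'}\mathbf 1_{B_n}(Z_i)$$ on the probability space with probability $\mathfrak P$ converge in distribution, as $n\to\infty$, to a random variable $W$ with the standard Poisson distribution of parameter $\tau$: $$\mathrm{Prob}(W=k)=\frac{\tau^ke^{-\tau}}{k!},\qquad k=0,1,2,\dots$$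
   Context: Map and dynamical noise (Assumption TM). $T$ is a continuous unimodal map on $[0,1]$ with a unique maximum at a point $\mathfrak c$, and $\Upsilon:=T(\mathfrak c)<1$; there is a closed interval $[d_1,d_2]\subset[0,1]$, forward invariant under $T$, on which all powers $T^n$, $n\ge1$, are topologically transitive; $T$ preserves a unique absolutely continuous Borel probability measure. Put $\Gamma=1-\Upsilon$, $q=T(0)$ and $I=[-\Gamma,1]$. $T$ is extended to $I$ so that on $[-\Gamma,0]$ it is $C^4$ and decreasing with $T(-\Gamma)<\Upsilon$. $\sigma:\mathbb R\to[0,\infty)$ is differentiable, $\sigma_{\max}=\max_{x\in I}\sigma(x)$, and $a>0$ satisfies $a\le\frac1{\sigma_{\max}}\min\{\frac\Gamma2,\frac q2,\frac12T(1-\frac\Gamma2)\}$. The noises $\eta_0,\eta_1,\dots$ are i.i.d. real random variables with density $g(x)=c_a\chi_a(x)e^{-x^2/2}$, where $\chi_a$ is a $C^\infty$ bump function supported in $[-a,a]$ and $c_a$ is the normalizing constant. Set $T_\eta(x)=T(x)+\sigma(x)\eta$ and, for $\underline\eta=(\eta_0,\eta_1,\dots)$, $T^n_{\underline\eta}=T_{\eta_{n-1}}\circ\cdots\circ T_{\eta_0}$, $T^0_{\underline\eta}=\mathrm{id}$. The Markov kernel is $p(x,z)=\frac1{\sigma(x)}g\big(\frac{z-T(x)}{\sigma(x)}\big)$ and the Markov operator is $\mathcal Lf(z)=\int f(x)p(x,z)\,dx$. $\mathcal B$ is the space of (complex-valued) functions of bounded variation on $I$ with norm $\|f\|_{\mathcal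 B}=\mathrm{Var}(f)+\|f\|_{L^1}$. Standing facts of the setting: random orbits stay in $[-\Gamma/2,1-\Gamma/2]$; there is a unique absolutely continuous stationary probability measure $\mu$, with density $h$ ($\mathcal Lh=h$) supported in $I_\Gamma=[\frac12T(1-\frac\Gamma2),1-\frac\Gamma2]$; $p$ is uniformly bounded and $\operatorname{ess\,sup}_x\mathrm{Var}(p(x,\cdot))<\infty$, so $\mathcal L$ is compact on $\mathcal B$; $1$ is a simple eigenvalue of $\mathcal L$ and $\mathcal L$ has a spectral gap. Observational noise (Assumption EI). The modulation is $s\equiv1$; $(\epsilon_k)_{k\ge0}$ are i.i.d. with non-atomic law $\psi$, independent of the $\eta_k$ and of the initial point, and bounded by a constant smaller than $\Gamma/2$ in absolute value. $\mathfrak P$ is the product of $\mu$ (law of the initial point $x$), the law of $\underline\eta$ and the law of $(\epsilon_k)$. The observed process is $Z_n=T^n_{\underline\eta}(x)+\epsilon_n\in I$. Notation: $\psi(B-x)=\psi(\{\epsilon: x+\epsilon\in B\})$. Target sets. $\phi:I\to\mathbb R\cup\{\pm\infty\}$ is measurable, $(u_n)$ is a real sequence, $B_n=\{\phi>u_n\}$ and the diameter of $B_n$ tends to $0$ as $n\to\infty$ (Assumption B). It is also required that $h$ is bounded below by a positive constant (independent of $n$) on the set $\{x:x+\epsilon\in B_n\text{ for some }\epsilon\in\mathrm{supp}\,\psi\}$. Definition of $l(\lambda)$. For $\lambda\in\mathbb R$ let $$\tilde{\mathcal L}_nf=\mathcal L\Big(f(\cdot)\int e^{i\lambda\mathbf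 1_{B_n}(\cdot+\epsilon)}\,d\psi(\epsilon)\Big),\qquad \Delta_n'=\int(\mathcal L-\tilde{\mathcal L}_n)h\,dx=(1-e^{i\lambda})\Delta_n,$$ $$q'_k(\lambda)=\lim_{n\to\infty}\frac{\int(\mathcal L-\tilde{\mathcal L}_n)\tilde{\mathcal L}_n^k(\mathcal L-\tilde{\mathcal L}_n)(h)\,dx}{\Delta_n'},\qquad l(\lambda)=1-\sum_{k=0}^\infty q'_k(\lambda).$$ *)

(* Defs.v *)
From HB Require Import structures.
From mathcomp Require Import all_boot all_order all_algebra.
From mathcomp Require Import all_classical all_reals all_analysis.
From mathcomp Require Import measurable_realfun ess_sup_inf.
From mathcomp Require Import complex.

Set Implicit Arguments.
Unset Strict Implicit.
Unset Printing Implicit Defensive.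

Import Order.TTheory GRing.Theory Num.Theory.
Import numFieldNormedType.Exports.

Local Open Scope classical_set_scope.
Local Open Scope ring_scope.
Local Open Scope complex_scope.

(* The topology of R[i] is the one of its norm, as for any numFieldType. *)
HB.instance Definition _ (R : realType) := NormedModule.copy R[i] R[i]^o.

Section complex_functions.
Context (R : realType).
Implicit Types (f : R -> R[i]) (z : R[i]).

(* The norm of R[i] takes its values in R[i], on the real axis. *)
Definition modulus z : R := complex.Re `|z|.

Definition expi (x : R) : R[i] := cos x +i* sin x.

Definition cintegral (mu : {measure set (measurableTypeR R) -> \bar R}) (D : set R) f : R[i] :=
  (\int[mu]_(x in D) complex.Re (f x)) +i* (\int[mu]_(x in D) complex.Im (f x)).

(* [variation] and [total_variation] of the library are for real functions. *)
Definition cvariation (a b : R) f (s : seq R) : R :=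
  let F := f \o nth b (a :: s) in
  \sum_(0 <= n < size s) modulus (F n.+1 - F n).

Definition ctotal_variation (a b : R) f : \bar R :=
  ereal_sup [set (cvariation a b f s)%:E | s in itv_partition a b].

End complex_functions.

Section real_dynamics.
Context (R : realType).
Implicit Types (f : R -> R) (D : set R) (nu psi : probability (measurableTypeR R) R).

Definition Ck (n : nat) f : Prop :=
  (forall k x, (k < n)%N -> derivable (derive1n k f) x 1) /\
  continuous (derive1n n f).

(* One-sided derivatives at the end points: C^n on a closed interval means
   being the restriction of a C^n function on the line. *)
Definition Ck_on (n : nat) (a b : R) f : Prop :=
  exists2 F, Ck n F & {in `[a, b], f =1 F}.

Definition unimodal f (c : R) : Prop :=
  [/\ {in `[0, 1], forall x, f x \in `[0, 1]},
      {within `[0, 1], continuous f},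
      0 < c < 1,
      {in `[0, c] &, {homo f : x y / x < y}} &
      {in `[c, 1] &, {homo f : x y / x < y >-> y < x}}].

Definition topologically_transitive D f : Prop :=
  forall U V : set R, open U -> open V ->
    U `&` D !=set0 -> V `&` D !=set0 ->
    exists2 k, (0 < k)%N & exists2 x, (U `&` D) x & V (iter k f x).

Definition absolutely_continuous_invariant f nu : Prop :=
  [/\ nu `[0, 1]%classic = 1%E, nu `<< lebesgue_measure &
      forall A, measurable A -> nu (`[0, 1]%classic `&` f @^-1` A) = nu A].

Definition diameter D : R := sup [set `|x.1 - x.2| | x in D `*` D].

Definition measure_support nu : set R :=
  [set x | forall r, 0 < r -> (0 < nu (ball x r))%E].

(* For Borel probabilities on the line, atoms reduce to points of positive
   mass. *)
Definition non_atomic nu : Prop := forall x, nu [set x] = 0%E.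

End real_dynamics.

(* nm_T is the extended map on [- Gamma, 1]; its values elsewhere play no role.
   nm_crit is the maximum point of nm_T on [0, 1], and the bump function
   nm_chi is supported in [- nm_a, nm_a]. *)
Record noisy_map (R : realType) := NoisyMap {
  nm_T : R -> R;
  nm_crit : R;
  nm_sigma : R -> R;
  nm_a : R;
  nm_chi : R -> R }.

Section noisy_map.
Context (R : realType) (M : noisy_map R).

Local Notation leb := (@lebesgue_measure R).
Local Notation T := (nm_T M).
Local Notation sigma := (nm_sigma M).
Local Notation a := (nm_a M).
Local Notation chi := (nm_chi M).

Definition Upsilon : R := T (nm_crit M).
Definition Gamma : R := 1 - Upsilon.
Definition dom : set R := `[- Gamma, 1]%classic.
Definition dom_Gamma : set R :=
  `[2^-1 * T (1 - Gamma / 2), 1 - Gamma / 2]%classic.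

Definition sigma_max : R := sup [set sigma x | x in dom].

Definition gauss_bump (x : R) : R := chi x * expR (- (x ^+ 2 / 2)).
Definition noise_density (x : R) : R :=
  (\int[leb]_y gauss_bump y)^-1 * gauss_bump x.
Definition noise_law (A : set R) : \bar R :=
  (\int[leb]_(y in A) (noise_density y)%:E)%E.

Definition noisy_step (y x : R) : R := T x + sigma x * y.

Fixpoint noisy_iter (y : nat -> R) (n : nat) (x : R) : R :=
  if n is k.+1 then noisy_step (y k) (noisy_iter y k x) else x.

Definition kernel (x z : R) : R :=
  (sigma x)^-1 * noise_density ((z - T x) / sigma x).

Definition markov (f : R -> R[i]) (z : R) : R[i] :=
  cintegral leb dom (fun x => f x * (kernel x z)%:C).

Record assumption_TM : Prop := AssumptionTM {
  (* constrains nothing but the irrelevant values of T outside of [dom] *)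
  tm_measurable : measurable_fun setT T;
  tm_unimodal : unimodal T (nm_crit M);
  tm_Upsilon : Upsilon < 1;
  tm_transitive : exists d1 d2 : R,
    [/\ 0 <= d1, d1 < d2, d2 <= 1,
        {in `[d1, d2], forall x, T x \in `[d1, d2]} &
        forall n, (0 < n)%N ->
          topologically_transitive `[d1, d2]%classic (iter n T)];
  tm_acip : exists nu : probability (measurableTypeR R) R,
    absolutely_continuous_invariant T nu /\
    forall nu' : probability (measurableTypeR R) R, absolutely_continuous_invariant T nu' ->
      forall A, measurable A -> nu' A = nu A;
  tm_C4 : Ck_on 4 (- Gamma) 0 T;
  tm_decreasing : {in `[- Gamma, 0] &, {homo T : x y / x < y >-> y < x}};
  tm_endpoint : T (- Gamma) < Upsilon;
  tm_sigma_ge0 : forall x, 0 <= sigma x;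
  tm_sigma_derivable : forall x, derivable sigma x 1;
  tm_a_gt0 : 0 < a;
  tm_a_le : a <= sigma_max^-1 *
    Num.min (Gamma / 2) (Num.min (T 0 / 2) (2^-1 * T (1 - Gamma / 2)));
  tm_chi_smooth : forall n, Ck n chi;
  tm_chi_ge0 : forall x, 0 <= chi x;
  tm_chi_supp : forall x, a < `|x| -> chi x = 0;
  tm_chi_neq0 : exists x, chi x != 0 }.

(** The Banach space of functions of bounded variation on [dom]: functions on
    the line, considered through their restriction to [dom] only. *)

Definition eq_dom (f g : R -> R[i]) : Prop := forall x, dom x -> f x = g x.

Definition bv_norm (f : R -> R[i]) : \bar R :=
  (ctotal_variation (- Gamma) 1 f +
   \int[leb]_(x in dom) (modulus (f x))%:E)%E.

Definition in_bv (f : R -> R[i]) : Prop := (bv_norm f < +oo)%E.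

Definition nonzero (f : R -> R[i]) : Prop := ~ eq_dom f (cst 0).

Implicit Type K : (R -> R[i]) -> (R -> R[i]).

Definition bv_operator K : Prop :=
  (forall (k : R[i]) f g, in_bv f -> in_bv g ->
     eq_dom (K (fun x => k * f x + g x)) (fun x => k * K f x + K g x)) /\
  (exists2 C : R, 0 <= C &
     forall f, in_bv f -> (bv_norm (K f) <= C%:E * bv_norm f)%E).

Definition compact_operator K : Prop :=
  bv_operator K /\
  forall f : nat -> R -> R[i],
    (exists C : R, forall k, (bv_norm (f k) <= C%:E)%E) ->
    exists (j : nat -> nat) (g : R -> R[i]),
      [/\ {homo j : m n / (m < n)%N}, in_bv g &
          bv_norm (fun x => K (f (j k)) x - g x) @[k --> \oo] --> 0%E].

(* Algebraic simplicity: the generalized eigenspace is a line. *)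
Definition simple_eigenvalue K (z : R[i]) : Prop :=
  exists v, [/\ in_bv v, nonzero v, eq_dom (K v) (fun x => z * v x) &
    forall m f, in_bv f ->
      eq_dom (iter m (fun g x => K g x - z * g x) f) (cst 0) ->
      exists k : R[i], eq_dom f (fun x => k * v x)].

(* K = z P + N with P a projection of rank one, P N = N P = 0, and N of spectral
   radius lim ||N^n||^(1/n) smaller than |z|. *)
Definition spectral_gap K (z : R[i]) : Prop :=
  exists P N : (R -> R[i]) -> (R -> R[i]),
    [/\ bv_operator P /\ bv_operator N,
        forall f, in_bv f -> eq_dom (K f) (fun x => z * P f x + N f x),
        exists v, [/\ in_bv v, nonzero v, eq_dom (P v) v &
          forall f, in_bv f -> exists k : R[i], eq_dom (P f) (fun x => k * v x)],
        forall f, in_bv f ->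
          eq_dom (P (N f)) (cst 0) /\ eq_dom (N (P f)) (cst 0) &
        exists2 r : R, 0 <= r < modulus z &
          \forall n \near \oo, forall f, in_bv f ->
            (bv_norm (iter n N f) <= (r ^+ n)%:E * bv_norm f)%E].

Definition stationary (nu : probability (measurableTypeR R) R) : Prop :=
  nu dom = 1%E /\
  forall A, measurable A ->
    nu A = (\int[nu]_(x in dom) noise_law [set y | A (noisy_step y x)])%E.

Record stationary_setting (mu : probability (measurableTypeR R) R) (h : R -> R) : Prop :=
  StationarySetting {
  st_orbits : forall x y, x \in `[- (Gamma / 2), 1 - Gamma / 2] ->
    `|y| <= a -> noisy_step y x \in `[- (Gamma / 2), 1 - Gamma / 2];
  st_stationary : stationary mu;
  st_unique : forall nu : probability (measurableTypeR R) R,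
    stationary nu -> nu `<< leb -> forall A, measurable A -> nu A = mu A;
  st_h_measurable : measurable_fun setT h;
  st_h_ge0 : forall x, 0 <= h x;
  st_density : forall A, measurable A ->
    mu A = (\int[leb]_(x in A) (h x)%:E)%E;
  st_h_fixed : eq_dom (markov (fun x => (h x)%:C)) (fun x => (h x)%:C);
  st_h_support : forall x, ~ dom_Gamma x -> h x = 0;
  st_kernel_bounded : exists C : R, forall x z, dom x -> kernel x z <= C;
  st_kernel_variation :
    (ess_sup leb ((fun x => total_variation (- Gamma) 1 (kernel x)) \_ dom)
       < +oo)%E;
  st_compact : compact_operator markov;
  st_simple : simple_eigenvalue markov 1;
  st_gap : spectral_gap markov 1 }.

Record assumption_EI (psi : probability (measurableTypeR R) R) : Prop := AssumptionEI {
  ei_non_atomic : non_atomic psi;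
  ei_bounded : exists2 b : R, b < Gamma / 2 & psi `[- b, b]%classic = 1%E }.

Definition target (phi : R -> \bar R) (u : nat -> R) (n : nat) : set R :=
  [set x | dom x /\ ((u n)%:E < phi x)%E].

Record assumption_B (psi : probability (measurableTypeR R) R) (h : R -> R) (phi : R -> \bar R)
    (u : nat -> R) : Prop := AssumptionB {
  b_measurable : measurable_fun dom phi;
  b_diameter : diameter (target phi u n) @[n --> \oo] --> 0;
  b_density : exists2 m : R, 0 < m & forall n x, dom x ->
    (exists2 e, measure_support psi e & target phi u n (x + e)) -> m <= h x }.

Section perturbed.
Context (mu psi : probability (measurableTypeR R) R) (h : R -> R) (B : nat -> set R).

Definition Delta (n : nat) : R :=
  \int[mu]_x fine (psi [set e | B n (x + e)]).

Definition perturbed (lam : R) (n : nat) (f : R -> R[i]) : R -> R[i] :=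
  markov (fun x =>
    f x * cintegral psi setT (fun e => expi (lam * \1_(B n) (x + e)))).

Definition defect (lam : R) (n : nat) (f : R -> R[i]) (x : R) : R[i] :=
  markov f x - perturbed lam n f x.

Local Notation hC := (fun x => (h x)%:C).

Definition Delta' (lam : R) (n : nat) : R[i] :=
  cintegral leb dom (defect lam n hC).

Definition return_ratio (lam : R) (k n : nat) : R[i] :=
  cintegral leb dom
    (defect lam n (iter k (perturbed lam n) (defect lam n hC))) / Delta' lam n.

Definition q' (lam : R) (k : nat) : R[i] := limn (return_ratio lam k).

Definition ell (lam : R) : R[i] := 1 - limn (series (q' lam)).

End perturbed.

End noisy_map.

Section random_variables.
Context d (Omega : measurableType d) (R : realType) (P : probability Omega R).

Definition mutually_independent (I : choiceType) (X : I -> {RV P >-> R}) : Prop :=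
  forall (s : seq I) (A : I -> set R), uniq s ->
    (forall i, measurable (A i)) ->
    P [set w | forall i, i \in s -> A i (X i w)] =
    (\prod_(i <- s) P (X i @^-1` A i))%E.

Definition driving_family (x0 : {RV P >-> R}) (eta eps : nat -> {RV P >-> R})
    (i : option (nat + nat)) : {RV P >-> R} :=
  match i with
  | None => x0
  | Some (inl k) => eta k
  | Some (inr k) => eps k
  end.

(* P is, on the sigma-algebra generated by the coordinates x0, eta, eps, the
   product of the three laws. *)
Record driving_variables (M : noisy_map R) (mu psi : probability (measurableTypeR R) R)
    (x0 : {RV P >-> R}) (eta eps : nat -> {RV P >-> R}) : Prop :=
  DrivingVariables {
  dv_independent : mutually_independent (driving_family x0 eta eps);
  dv_x0 : forall A, measurable A -> distribution P x0 A = mu A;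
  dv_eta : forall k A, measurable A ->
    distribution P (eta k) A = noise_law M A;
  dv_eps : forall k A, measurable A -> distribution P (eps k) A = psi A }.

Definition observed (M : noisy_map R) (x0 : {RV P >-> R})
    (eta eps : nat -> {RV P >-> R}) (n : nat) (w : Omega) : R :=
  noisy_iter M (fun k => eta k w) n (x0 w) + eps n w.

Definition cvg_in_distribution (X : nat -> {RV P >-> R}) d'
    (Omega' : measurableType d') (Q : probability Omega' R)
    (W : {RV Q >-> R}) : Prop :=
  forall t : R, {for t, continuous (cdf W)} ->
    cdf (X n) t @[n --> \oo] --> cdf W t.

End random_variables.

(* Main.v *)
Require Import Defs.
From HB Require Import structures.
From mathcomp Require Import all_boot all_order all_algebra.
From mathcomp Require Import all_classical all_reals all_analysis.
From mathcomp Require Import measurable_realfun ess_sup_inf.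
From mathcomp Require Import complex.
From mathcomp Require Import ring lra.

Set Implicit Arguments.
Unset Strict Implicit.
Unset Printing Implicit Defensive.

Import Order.TTheory GRing.Theory Num.Theory.
Import numFieldNormedType.Exports.

Local Open Scope classical_set_scope.
Local Open Scope ring_scope.

(** The proof rests on two features of the random map. First, the kernel is
bounded by a constant [C], so that after any past the next position has density
at most [C]. Let [w x = psi (B_n - x)] be the probability that the observation
of the position [x] falls in [B_n], let [ell] be the Lebesgue integral of [w],
and [Delta = \int w h]. Tonelli gives [ell <= leb B_n], which tends to [0] with
the diameter of [B_n]; since [h <= C], and [h >= m > 0] at the points of the
domain where [w] does not vanish, [m * ell <= Delta <= C * ell] ([Delta_le],
[Delta_ge]). Second, the spectral gap gives
[|L^p f - (\int f) h| <= r^p * ||f||_BV] at every point, with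
[r < 1] ([mixing]), where [L] is the transfer operator.

Return ratios. Integrating the noise out turns [e^(i lam 1_B)] into
[1 - (1 - e^(i lam)) w]. The numerator of the [k]-th return ratio contains the
defect of the operator twice. The inner one produces a function bounded by a
constant times [Delta], [k] applications of the perturbed operator multiply this
bound by a constant, and the outer one integrates it against [w], which costs
a factor [ell]. Divided by [(1 - e^(i lam)) Delta], this is of order [ell]
([modulus_return_ratio]), hence tends to [0]: every [q'_k] vanishes, and nothing
is subtracted from [1].

Poisson limit. Let [f m j] be the density of the position at time [m] on the
event of exactly [j] visits before time [m]. Reading the coordinates in the
order initial point, [eps_0], [eta_0], [eps_1], and so on, one finds
[f (m + 1) j = L ((1 - w) f m j + w f m (j - 1))] ([visits_law],
[visits_mass]), so that the mass [pi m j] of [f m j] satisfies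
[pi (m + 1) j = pi m j - hit m j + hit m (j - 1)] with
[hit m j = \int w f m j]. If [hit m j] were equal to [Delta * pi m j], this would
be the recursion of a binomial law with success probability [Delta], which the
Poisson masses satisfy up to [O(Delta^2)] ([poisson_mass_step]). It is almost so
([hit_estimate]). Ignoring the last [p] possible hits changes the density by at
most [C p Delta] at each point and by [p Delta] in mass. Without them the orbit
makes [p] free steps, which bring its density within [O(r^p)] of a multiple of
[h]; integrated against [w], the latter gives exactly [Delta] times the mass.
The bounded-variation norm needed for mixing is controlled uniformly in the
target, although [w] is only measurable, because each density is the image
under [L] of a function of mass at most [1].

The error of one step is therefore [O(Delta * (p * ell + p * Delta + r^p))],
where [m * ell <= Delta] has been used for the last term. The errors add up over
the [tau / Delta] steps ([poisson_comparison]), so that letting [n] and then [p]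
tend to infinity gives the limit ([poisson_limit]). The distribution function of
an integer-valued variable is a finite sum of point probabilities, whence the
convergence in distribution ([cvg_cdf_integer]). *)

(** * Bounded functions on a set of finite measure *)
Section bounded_measurable.
Context d (T : measurableType d) (R : realType).
Variables (mu : {sigma_finite_measure set T -> \bar R}) (D : set T).
Hypotheses (mD : measurable D) (muD : (mu D < +oo)%E).
Implicit Types f g : T -> R.

(** Measurability is required everywhere and boundedness on [D] only: this
is stable under products and integration over [D] in a parameter, and makes all
integrability side conditions disappear. *)
Definition bmeas f :=
  measurable_fun setT f /\ exists b, forall x, D x -> `|f x| <= b.

Local Notation I f := (\int[mu]_(x in D) f x).

Lemma bmeas_measurable f : bmeas f -> measurable_fun setT f.
Proof. by case. Qed.

Lemma bmeas_ge0 f : bmeas f -> exists2 b, 0 <= b & forall x, D x -> `|f x| <= b.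
Proof.
move=> [_ [b fb]]; exists (Num.max b 0); first by rewrite le_max lexx orbT.
by move=> x Dx; rewrite le_max fb.
Qed.

Lemma bmeas_integrable f : bmeas f -> mu.-integrable D (EFin \o f).
Proof.
move=> [mf [b fb]]; apply: (@le_integrable _ _ _ mu D mD _ (cst b%:E)).
- exact/measurable_EFinP/measurable_funTS.
- by move=> x Dx /=; rewrite lee_fin (le_trans (fb x Dx))// ler_norm.
- apply/integrableP; split; first exact/measurable_EFinP.
  rewrite (eq_integral (cst `|b|%:E))// integral_cst//.
  by rewrite lte_mul_pinfty.
Qed.

Lemma bmeas_cst r : bmeas (cst r).
Proof. by split=> //; exists `|r|. Qed.

Lemma bmeas_indic A : measurable A -> bmeas (\1_A).
Proof.
move=> mA; split; first exact: measurable_indic.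
by exists 1 => x _; rewrite ger0_norm// indicE ler_nat leq_b1.
Qed.

Lemma bmeasD f g : bmeas f -> bmeas g -> bmeas (fun x => f x + g x).
Proof.
move=> [mf [b fb]] [mg [c gc]]; split; first exact: measurable_funD.
by exists (b + c) => x Dx; rewrite (le_trans (ler_normD _ _))// lerD// ?fb ?gc.
Qed.

Lemma bmeasM f g : bmeas f -> bmeas g -> bmeas (fun x => f x * g x).
Proof.
move=> [mf [b fb]] [mg [c gc]]; split; first exact: measurable_funM.
by exists (b * c) => x Dx; rewrite normrM ler_pM// ?fb ?gc.
Qed.

Lemma bmeasZ r f : bmeas f -> bmeas (fun x => r * f x).
Proof. by move=> bf; apply: (bmeasM (bmeas_cst r)). Qed.

Lemma bmeasN f : bmeas f -> bmeas (fun x => - f x).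
Proof.
move=> [mf [b fb]]; split; first exact: measurable_funN.
by exists b => x Dx; rewrite normrN fb.
Qed.

Lemma bmeasB f g : bmeas f -> bmeas g -> bmeas (fun x => f x - g x).
Proof. by move=> bf bg; apply: bmeasD => //; exact: bmeasN. Qed.

Lemma bmeas_norm f : bmeas f -> bmeas (fun x => `|f x|).
Proof.
move=> [mf [b fb]]; split; first exact: measurableT_comp.
by exists b => x Dx; rewrite normr_id fb.
Qed.

Lemma RintD f g : bmeas f -> bmeas g -> I (fun x => f x + g x) = I f + I g.
Proof. by move=> bf bg; rewrite RintegralD//; exact: bmeas_integrable. Qed.

Lemma RintB f g : bmeas f -> bmeas g -> I (fun x => f x - g x) = I f - I g.
Proof. by move=> bf bg; rewrite RintegralB//; exact: bmeas_integrable. Qed.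

Lemma RintZ r f : bmeas f -> I (fun x => r * f x) = r * I f.
Proof. by move=> bf; rewrite RintegralZl//; exact: bmeas_integrable. Qed.

Lemma le_Rint f g : bmeas f -> bmeas g -> (forall x, D x -> f x <= g x) ->
  I f <= I g.
Proof. by move=> bf bg fg; apply: le_Rintegral => //; exact: bmeas_integrable. Qed.

Lemma Rint_norm f : bmeas f -> `|I f| <= I (fun x => `|f x|).
Proof. by move=> bf; apply: le_normr_Rintegral => //; exact: bmeas_integrable. Qed.

Lemma EFin_Rint f : bmeas f -> (I f)%:E = (\int[mu]_(x in D) (f x)%:E)%E.
Proof.
move=> bf; rewrite /Rintegral fineK//.
by apply: integrable_fin_num => //; exact: bmeas_integrable.
Qed.

Lemma le_Rint_cst f b : bmeas f -> (forall x, D x -> f x <= b) ->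
  I f <= b * fine (mu D).
Proof.
move=> bf fb; rewrite -(Rintegral_cst mu mD b); apply: le_Rint => //.
exact: bmeas_cst.
Qed.

Lemma integral_indicr (F : T -> R) :
  (\int[mu]_(y in D) (F y)%:E = \int[mu]_y (F y * \1_D y)%:E)%E.
Proof.
rewrite integral_mkcond; apply: eq_integral => y _; rewrite patchE indicE.
by case: ifPn; rewrite ?mulr1 ?mulr0.
Qed.

Lemma bmeas_sum (F : nat -> T -> R) n : (forall i, bmeas (F i)) ->
  bmeas (fun x => \sum_(0 <= i < n) F i x).
Proof.
move=> bF; elim: n => [|n IH].
  by under eq_fun do rewrite big_nil; exact: bmeas_cst.
by under eq_fun do rewrite big_nat_recr//=; exact: bmeasD.
Qed.

Lemma Rint_sum (F : nat -> T -> R) n : (forall i, bmeas (F i)) ->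
  I (fun x => \sum_(0 <= i < n) F i x) = \sum_(0 <= i < n) I (F i).
Proof.
move=> bF; elim: n => [|n IH].
  by under eq_Rintegral do rewrite big_nil; rewrite Rintegral_cst// mul0r big_nil.
under eq_Rintegral do rewrite big_nat_recr//=.
by rewrite RintD// ?IH ?big_nat_recr//; exact: bmeas_sum.
Qed.

Section fubini.
Variable F : T -> T -> R.
Hypothesis mF : measurable_fun setT (fun p : T * T => F p.1 p.2).

Let mFD : measurable_fun setT (fun p : T * T => ((F p.1 p.2) * \1_D p.2)%:E).
Proof.
apply/measurable_EFinP; apply: measurable_funM => //.
by apply: measurableT_comp => //; exact: measurable_indic.
Qed.

Let FDE x : (\int[mu]_(y in D) (F x y)%:E)%E =
  (\int[mu]_y ((F x y) * \1_D y)%:E)%E.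
Proof. exact: integral_indicr. Qed.

Lemma measurable_Rint : measurable_fun setT (fun x => I (F x)).
Proof.
rewrite /Rintegral; apply: measurableT_comp; first exact: fine_measurable.
under eq_fun do rewrite FDE integralE.
pose G : T * T -> \bar R := fun p => (F p.1 p.2 * \1_D p.2)%:E.
have mGp : measurable_fun setT (fubini_F mu (G^\+)%E).
  by apply: measurable_fun_fubini_tonelli_F => //; exact: measurable_funepos.
have mGn : measurable_fun setT (fubini_F mu (G^\-)%E).
  by apply: measurable_fun_fubini_tonelli_F => //; exact: measurable_funeneg.
have := emeasurable_funB mGp mGn; congr (measurable_fun _ _); apply/funext => x.
by rewrite /fubini_F; congr (_ - _)%E; apply: eq_integral => y _; rewrite ?funeposE ?funenegE.
Qed.

End fubini.

Section fubini2.
Variables (F : T -> T -> R) (b : R).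
Hypothesis mF : measurable_fun setT (fun p : T * T => F p.1 p.2).
Hypothesis Fb : forall x y, D x -> D y -> `|F x y| <= b.

Let mFl x : measurable_fun setT (F x).
Proof. exact: (measurableT_comp mF (pair1_measurable x)). Qed.
Let mFr y : measurable_fun setT (F ^~ y).
Proof. exact: (measurableT_comp mF (pair2_measurable y)). Qed.

Lemma bmeas_l x : D x -> bmeas (F x).
Proof. by move=> Dx; split=> //; exists b => y Dy; exact: Fb. Qed.
Lemma bmeas_r y : D y -> bmeas (F ^~ y).
Proof. by move=> Dy; split=> //; exists b => x Dx; exact: Fb. Qed.

Lemma bmeas_Rint : bmeas (fun x => I (F x)).
Proof.
split; first exact: measurable_Rint.
exists (b * fine (mu D)) => x Dx.
rewrite (le_trans (Rint_norm (bmeas_l Dx)))//.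
by apply: le_Rint_cst; [exact/bmeas_norm/bmeas_l|move=> y Dy; exact: Fb].
Qed.

End fubini2.

(** The integrand is cut off to [D * D], where it is bounded, to become
integrable for the product measure. *)
Lemma Rint_fubini (F : T -> T -> R) (b : R) :
  measurable_fun setT (fun p : T * T => F p.1 p.2) ->
  (forall x y, D x -> D y -> `|F x y| <= b) ->
  I (fun x => I (F x)) = I (fun y => I (F ^~ y)).
Proof.
move=> mF Fb.
have mF' : measurable_fun setT (fun p : T * T => F p.2 p.1).
  by rewrite (_ : (fun _ => _) = (fun p : T * T => F p.1 p.2) \o (fun p => (p.2, p.1)))//;
    apply: measurableT_comp => //; exact: measurable_swap.
pose G := fun p : T * T => (F p.1 p.2 * \1_D p.1 * \1_D p.2)%:E.
have mG : measurable_fun setT G.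
  apply/measurable_EFinP; apply: measurable_funM; first apply: measurable_funM => //.
    by apply: measurableT_comp => //; exact: measurable_indic.
  by apply: measurableT_comp => //; exact: measurable_indic.
have GE : forall x, D x -> (\int[mu]_y G (x, y) = \int[mu]_(y in D) (F x y)%:E)%E.
  move=> x Dx; rewrite integral_indicr.
  by apply: eq_integral => y _; rewrite /G/= indicE mem_set// mulr1.
have GE' : forall y, D y -> (\int[mu]_x G (x, y) = \int[mu]_(x in D) (F x y)%:E)%E.
  move=> x Dx; rewrite integral_indicr.
  by apply: eq_integral => y _; rewrite /G/= (indicE _ D x) mem_set// mulr1.
have iG : (mu \x mu)%E.-integrable setT G.
  apply/integrable12ltyP => //.
  apply: (@le_lt_trans _ _ (\int[mu]_(x in D) (b * fine (mu D))%:E)%E); last first.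
    by rewrite integral_cst// ltey_eq fin_numM// ge0_fin_numE.
  rewrite [leRHS]integral_mkcond; apply: ge0_le_integral => //.
  - by move=> x _; exact: integral_ge0.
  - apply: (@measurable_fun_fubini_tonelli_F _ _ _ _ _ mu (abse \o G)) => //;
    first exact: measurableT_comp.
    by move=> p; exact: abse_ge0.
  - by apply/(measurable_restrictT _ mD).1.
  move=> x _; rewrite patchE; case: ifPn => [/set_mem Dx|xD]; last first.
    under eq_integral => y _ do rewrite /G/= (indicE _ D x) (negbTE xD) mulr0 mul0r normr0.
    by rewrite integral0.
  have bx := bmeas_l mF Fb Dx.
  apply: (@le_trans _ _ (I (fun y => `|F x y|))%:E); last first.
    rewrite lee_fin; apply: le_Rint_cst; first exact: bmeas_norm.
    by move=> y Dy; exact: Fb.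
  rewrite EFin_Rint; last exact: bmeas_norm.
  rewrite integral_indicr.
  apply: ge0_le_integral => //.
  - apply: measurableT_comp => //; apply: (measurableT_comp mG); exact: pair1_measurable.
  - apply/measurable_EFinP/measurable_funM; last exact: measurable_indic.
    by apply: (bmeas_measurable (bmeas_norm bx)).
  move=> y _; rewrite /G/= (indicE _ D x) mem_set// mulr1 lee_fin normrM.
  by rewrite (@ger0_norm _ (\1_D y)).
have := Fubini iG.
rewrite -/(fubini_F mu G) => FG.
apply: EFin_inj; rewrite !EFin_Rint; last 2 first.
- exact: (bmeas_Rint mF' (fun y x Dy Dx => Fb x y Dx Dy)).
- exact: (bmeas_Rint mF Fb).
transitivity (\int[mu]_x \int[mu]_y G (x, y))%E.
  rewrite integral_mkcond; apply: eq_integral => x _; rewrite patchE.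
  case: ifPn => [/set_mem Dx|xD]; first by rewrite (GE _ Dx) (EFin_Rint (bmeas_l mF Fb Dx)).
  rewrite integral0_eq => [//|y _].
  by rewrite /G/= (indicE _ D x) (negbTE xD) mulr0 mul0r.
rewrite FG [RHS]integral_mkcond; apply: eq_integral => x _; rewrite patchE.
case: ifPn => [/set_mem Dx|xD]; first by rewrite (GE' _ Dx) (EFin_Rint (bmeas_r mF Fb Dx)).
rewrite integral0_eq => [//|y _].
by rewrite /G/= (indicE _ D x) (negbTE xD) mulr0.
Qed.

End bounded_measurable.

(** * Affine change of variables *)
Section affine_change_of_variables.
Context (R : realType).
Local Notation leb := (@lebesgue_measure R).
Variables (s t : R).
Hypothesis s0 : 0 < s.

Let phi : measurableTypeR R -> measurableTypeR R := fun y => t + s * y.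

Let mphi : measurable_fun setT phi.
Proof. by apply: measurable_funD => //; exact: measurable_funM. Qed.

Lemma lebesgue_measure_affine A : measurable A ->
  leb A = (s%:E * leb (phi @^-1` A))%E.
Proof.
have si0 : 0 <= s by exact: ltW.
pose nu : {measure set (measurableTypeR R) -> \bar R} := mscale (NngNum si0) (pushforward leb phi).
move=> mA; rewrite (lebesgue_measure_unique (mu := nu mphi))//=.
move=> _ [[a b] _ <-]; rewrite /nu/= /mscale/= /pushforward/=.
have -> : phi @^-1` `]a, b]%classic = `](a - t) / s, (b - t) / s]%classic.
  apply/seteqP; split => y /=; rewrite !in_itv/= /phi ltr_pdivrMr// ler_pdivlMr//; lra.
rewrite !lebesgue_measure_itv/= !lte_fin ltr_pM2r ?invr_gt0// ltrD2r.
case: ifP => _; last by rewrite mule0.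
rewrite -!EFinD -EFinM; congr EFin; field; by rewrite gt_eqF.
Qed.

Lemma ge0_integral_affine (f : R -> R) A : measurable A -> measurable_fun setT f ->
  (forall x, 0 <= f x) ->
  (\int[leb]_(y in [set y | A (t + s * y)%R]) (f y)%:E =
   \int[leb]_(z in A) (s^-1 * f ((z - t) / s))%:E)%E.
Proof.
move=> mA mf f0.
have si0 : 0 <= s by exact: ltW.
pose nu : {measure set (measurableTypeR R) -> \bar R} := mscale (NngNum si0) (pushforward leb phi).
have mg : measurable_fun setT (fun z : R => (f ((z - t) / s))%:E).
  apply/measurable_EFinP; apply: measurableT_comp => //.
  by apply: measurable_funM => //; exact: measurable_funB.
under [RHS]eq_integral do rewrite EFinM.
rewrite ge0_integralZl//; last 3 first.
- exact: measurable_funTS.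
- by move=> z _; rewrite lee_fin.
- by rewrite lee_fin invr_ge0.
rewrite [in RHS](eq_measure_integral (nu mphi)); last first.
  by move=> B mB _; exact: lebesgue_measure_affine.
rewrite ge0_integral_mscale//; last 2 first.
- exact: measurable_funTS.
- by move=> z _; rewrite lee_fin.
rewrite muleA -EFinM mulVf ?gt_eqF// mul1e.
rewrite (ge0_integral_pushforward (phi := phi))//; last 2 first.
- exact: measurable_funTS.
- by move=> z _; rewrite lee_fin.
by apply: eq_integral => y _ /=; rewrite /phi addrAC subrr add0r [s * y]mulrC mulfK// gt_eqF.
Qed.

End affine_change_of_variables.

(** * One step of the noisy map *)
Section kernel_facts.
Context (R : realType) (M : noisy_map R).
Local Notation leb := (@lebesgue_measure R).
Local Notation T := (nm_T M).
Local Notation sigma := (nm_sigma M).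
Local Notation a := (nm_a M).
Local Notation g := (noise_density M).
Local Notation D := (dom M).
Local Notation G := (Gamma M).
Hypothesis TM : assumption_TM M.
Hypothesis mass1 : noise_law M setT = 1%E.

Lemma gauss_bump_ge0 x : 0 <= gauss_bump M x.
Proof. by rewrite mulr_ge0 ?expR_ge0// (tm_chi_ge0 TM). Qed.

Lemma noise_density_ge0 x : 0 <= g x.
Proof. by rewrite mulr_ge0 ?gauss_bump_ge0// invr_ge0 Rintegral_ge0// => y _;
  exact: gauss_bump_ge0. Qed.

Lemma noise_density_out x : a < `|x| -> g x = 0.
Proof. by move=> /(tm_chi_supp TM) e; rewrite /noise_density /gauss_bump e mul0r mulr0. Qed.

Lemma measurable_noise_density : measurable_fun setT g.
Proof.
apply: measurable_funM => //; apply: measurable_funM.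
  by apply: continuous_measurable_fun; have [_] := tm_chi_smooth TM 0%N.
apply: measurableT_comp => //; apply: measurable_funN.
by apply: measurable_funM => //; exact: measurable_funX.
Qed.

Lemma Gamma_gt0 : 0 < G.
Proof. by rewrite subr_gt0 (tm_Upsilon TM). Qed.

(** The inverse of [0] is [0], so a vanishing [sigma_max] would force [a <= 0]. *)
Lemma sigma_max_neq0 : sigma_max M != 0.
Proof.
apply/eqP => s0; have := tm_a_le TM; rewrite s0 invr0 mul0r => a0.
by have := tm_a_gt0 TM; rewrite ltNge a0.
Qed.

(** The supremum of an unbounded set is [0] by convention, which is excluded. *)
Lemma has_sup_sigma : has_sup [set sigma x | x in D].
Proof. by apply: contrapT => /sup_out s0; move/eqP: sigma_max_neq0. Qed.

Lemma sigma_le_max x : D x -> sigma x <= sigma_max M.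
Proof. by move=> Dx; apply: ub_le_sup; [exact: (has_sup_sigma).2|exists x]. Qed.

Lemma dom1 : D 1.
Proof. by rewrite /dom/= in_itv/= lexx andbT; have := Gamma_gt0; lra. Qed.

Lemma sigma_max_gt0 : 0 < sigma_max M.
Proof.
rewrite lt_neqAle eq_sym sigma_max_neq0/= (le_trans _ (sigma_le_max dom1))//.
exact: (tm_sigma_ge0 TM).
Qed.

Lemma noise_amplitude : a * sigma_max M <= G / 2.
Proof.
have := tm_a_le TM; rewrite ler_pdivlMl ?sigma_max_gt0// => H.
by rewrite mulrC (le_trans H)// ge_min lexx.
Qed.

Lemma T_dom x : D x -> 0 <= T x <= Upsilon M.
Proof.
have [T01 _ c01 Ti Td] := tm_unimodal TM.
rewrite /dom/= in_itv/= => /andP[x1 x2].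
have [x0|x0] := leP 0 x; last first.
  have G0 := Gamma_gt0.
  have zx : T 0 < T x by apply: (tm_decreasing TM); rewrite ?in_itv/=; lra.
  have T0 : 0 <= T 0.
    have /T01 : (0:R) \in `[0, 1] by rewrite in_itv/= lexx ler01.
    by rewrite in_itv/= => /andP[].
  rewrite (le_trans T0 (ltW zx))/=.
  move: x1; rewrite le_eqVlt => /predU1P[<-|x1]; first exact/ltW/(tm_endpoint TM).
  apply/ltW/(lt_trans _ (tm_endpoint TM)).
  by apply: (tm_decreasing TM); rewrite ?in_itv/=; lra.
have /T01 : x \in `[0, 1] by rewrite in_itv/= x0.
rewrite in_itv/= => /andP[->/= _].
have [xc|xc|->] := ltgtP x (nm_crit M); last by [].
  by apply/ltW/Ti; rewrite ?in_itv/=; lra.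
by apply/ltW/Td; rewrite ?in_itv/=; lra.
Qed.

Lemma noisy_step_dom x y : D x -> `|y| <= a -> D (noisy_step M y x).
Proof.
move=> Dx ya; have /andP[T0 TU] := T_dom Dx.
have : `|sigma x * y| <= G / 2.
  rewrite (le_trans _ noise_amplitude)// normrM mulrC ler_pM//.
  by rewrite ger0_norm ?(tm_sigma_ge0 TM)// sigma_le_max.
have G0 := Gamma_gt0; have : Upsilon M = 1 - G by rewrite /Gamma; lra.
rewrite /noisy_step /dom/= in_itv/= ler_norml; lra.
Qed.

Section bounded_kernel.
Variable C : R.
Hypothesis kernelC : forall x z, D x -> Defs.kernel M x z <= C.

Lemma noise_density_pos : exists y, 0 < g y.
Proof.
apply: contrapT => /forallNP g0; have := mass1.
rewrite /noise_law integral0_eq; first by move/eqP; rewrite eqe eq_sym oner_eq0.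
move=> y _; congr EFin; apply/eqP; rewrite eq_le noise_density_ge0 andbT leNgt.
exact/negP.
Qed.

(** If [sigma] vanished somewhere on the domain, it would take arbitrarily
small positive values there by the intermediate value theorem, and the kernel
would be unbounded, being the noise density rescaled by [sigma]. *)
Lemma sigma_gt0 x : D x -> 0 < sigma x.
Proof.
move=> Dx; rewrite lt_neqAle (tm_sigma_ge0 TM) andbT; apply/eqP => sx.
have [y0 gy0] := noise_density_pos.
have [x2 Dx2 sx2] : exists2 x2, D x2 & 0 < sigma x2.
  apply: contrapT => /forall2NP s0.
  have := sigma_max_gt0; rewrite ltNge => /negP; apply.
  apply: ge_sup; first by exists (sigma 1), 1 => //; exact: dom1.
  by move=> _ [z Dz <-]; have [//|/negP] := s0 z; rewrite -leNgt.
(* At a point where [sigma] takes the value [v], the kernel reaches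
   [g y0 / v], which exceeds [C]. *)
set v := Num.min (sigma x2) (g y0 / (`|C| + 1)) / 2.
have C1 : 0 < `|C| + 1 by rewrite ltr_wpDl.
have v0 : 0 < v by rewrite divr_gt0// lt_min sx2 divr_gt0.
have vx2 : v <= sigma x2.
  by rewrite /v ler_pdivrMr// (le_trans (_ : _ <= sigma x2)) ?ge_min ?lexx//; lra.
have vg : v * (`|C| + 1) < g y0.
  rewrite -ltr_pdivlMr// /v ltr_pdivrMr//.
  rewrite (le_lt_trans (_ : _ <= g y0 / (`|C| + 1))) ?ge_min ?lexx ?orbT//.
  have : 0 < g y0 / (`|C| + 1) by rewrite divr_gt0.
  lra.
have cs : continuous sigma.
  by move=> z; apply: differentiable_continuous; apply/derivable1_diffP;
    exact: (tm_sigma_derivable TM).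
have [c Dc sc] : exists2 c, D c & sigma c = v.
  move: Dx Dx2; rewrite /dom/= !in_itv/= => /andP[x1 x1'] /andP[x21 x22].
  have [xx|xx] := leP x x2.
    have [||c] := @IVT _ sigma x x2 v xx; first exact: continuous_subspaceT.
      rewrite -sx ge_min le_max vx2 (ltW v0) orbT//.
    by rewrite in_itv/= => cc <-; exists c => //=; rewrite in_itv/=; lra.
  have [||c] := @IVT _ sigma x2 x v (ltW xx); first exact: continuous_subspaceT.
    rewrite -sx ge_min le_max vx2 (ltW v0) orbT//.
  by rewrite in_itv/= => cc <-; exists c => //=; rewrite in_itv/=; lra.
have := kernelC (T c + sigma c * y0) Dc.
rewrite /Defs.kernel addrAC subrr add0r sc [v * _]mulrC mulfK ?gt_eqF//.
rewrite ler_pdivrMl//; apply/negP; rewrite -ltNge (le_lt_trans _ vg)//.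
rewrite ler_pM2l//; have := ler_norm C; lra.
Qed.

Lemma kernel_ge0 x z : 0 <= Defs.kernel M x z.
Proof. by rewrite mulr_ge0 ?noise_density_ge0// invr_ge0 (tm_sigma_ge0 TM). Qed.

Lemma measurable_noise_kernel : measurable_fun setT (fun p : R * R => Defs.kernel M p.1 p.2).
Proof.
have ms : measurable_fun setT (fun x => (sigma x)^-1).
  (* The inverse is measurable as a power, [sigma] being nonnegative. *)
  have -> : (fun x => (sigma x)^-1) = (@powR R ^~ (-1)) \o sigma.
    by apply/funext => x /=; rewrite powR_inv1 ?(tm_sigma_ge0 TM).
  apply: measurableT_comp; first exact: measurable_powR.
  apply: continuous_measurable_fun => z; apply: differentiable_continuous.
  by apply/derivable1_diffP; exact: (tm_sigma_derivable TM).
apply: measurable_funM; first exact: (measurableT_comp ms measurable_fst).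
apply: (measurableT_comp measurable_noise_density).
apply: measurable_funM; last exact: (measurableT_comp ms measurable_fst).
apply: measurable_funB; first exact: measurable_snd.
exact: (measurableT_comp (tm_measurable TM) measurable_fst).
Qed.

Lemma noise_lawE x A : D x -> measurable A ->
  noise_law M [set y | A (noisy_step M y x)] = (\int[leb]_(z in A) (Defs.kernel M x z)%:E)%E.
Proof.
move=> Dx mA; rewrite /noise_law /noisy_step.
apply: ge0_integral_affine => //; first exact: sigma_gt0.
- exact: measurable_noise_density.
- exact: noise_density_ge0.
Qed.

Lemma measurable_dom : measurable D. Proof. exact: measurable_itv. Qed.

(** The noise never exceeds [a] and thus never leads out of the domain. *)
Lemma noise_law_dom x A : D x -> measurable A ->
  noise_law M [set y | A (noisy_step M y x)] =
  noise_law M [set y | (A `&` D) (noisy_step M y x)].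
Proof.
move=> Dx mA; rewrite /noise_law.
rewrite [LHS]integral_mkcond [RHS]integral_mkcond; apply: eq_integral => y _.
rewrite !patchE; have [ya|ya] := leP `|y| a; last first.
  by rewrite noise_density_out// !if_same.
congr (if _ then _ else _); apply/idP/idP; rewrite !inE/=; last by case.
by move=> ?; split => //; exact: noisy_step_dom.
Qed.

Lemma kernel_mass x : D x -> (\int[leb]_(z in D) (Defs.kernel M x z)%:E)%E = 1%E.
Proof.
move=> Dx; rewrite -noise_lawE//; last exact: measurable_dom.
have := noise_law_dom Dx measurableT; rewrite setTI => <-.
by rewrite -mass1; congr (noise_law M _); apply/seteqP.
Qed.

End bounded_kernel.
End kernel_facts.

(** * Functions of bounded variation *)
Section complex_parts.
Local Open Scope complex_scope.
Context (R : realType).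
Implicit Types z w : R[i].

Lemma modulusE z : modulus z = Num.sqrt (complex.Re z ^+ 2 + complex.Im z ^+ 2).
Proof. by rewrite /modulus normc_def. Qed.

Lemma modulus_ge0 z : 0 <= modulus z.
Proof. by rewrite modulusE sqrtr_ge0. Qed.

Lemma modulus_real (x : R) : modulus x%:C = `|x|.
Proof. by rewrite modulusE/= expr0n addr0 sqrtr_sqr. Qed.

Lemma norm_Re_le z : `|complex.Re z| <= modulus z.
Proof. by rewrite modulusE -sqrtr_sqr ler_wsqrtr// lerDl sqr_ge0. Qed.

Lemma norm_Im_le z : `|complex.Im z| <= modulus z.
Proof. by rewrite modulusE -sqrtr_sqr ler_wsqrtr// lerDr sqr_ge0. Qed.

Lemma ReB z w : complex.Re (z - w) = complex.Re z - complex.Re w.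
Proof. by case: z; case: w. Qed.

Lemma ImB z w : complex.Im (z - w) = complex.Im z - complex.Im w.
Proof. by case: z; case: w. Qed.

End complex_parts.

(** A nonnegative integral is the supremum of the integrals of the simple
functions below it, so monotonicity holds for arbitrary functions; this is
applied to the modulus of a function of bounded variation. *)
Lemma ge0_le_integral_nonmeasurable d (T : measurableType d) (R : realType)
    (mu : {measure set T -> \bar R}) (A : set T) (f g : T -> \bar R) :
  (forall x, A x -> 0 <= f x)%E -> (forall x, A x -> f x <= g x)%E ->
  (\int[mu]_(x in A) f x <= \int[mu]_(x in A) g x)%E.
Proof.
move=> f0 fg; rewrite !(integral_mkcond A).
have f0' x : (0 <= (f \_ A) x)%E by exact: erestrict_ge0.
have fg' x : ((f \_ A) x <= (g \_ A) x)%E by exact: lee_restrict.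
rewrite !ge0_integralTE//; last by move=> x; exact: le_trans (fg' x).
apply: ge_ereal_sup => _ [k kf <-]; apply: ereal_sup_ubound; exists k => // x.
exact: le_trans (fg' x).
Qed.

Section bv.
Context (R : realType) (M : noisy_map R).
Local Notation leb := (@lebesgue_measure R).
Local Notation D := (dom M).
Local Notation G := (Gamma M).
Hypothesis G0 : 0 < G.
Implicit Types F H : R -> R[i].

Lemma lebesgue_dom : leb D = (1 + G)%:E.
Proof.
rewrite /dom lebesgue_measure_itv/= lte_fin ifT; first by rewrite -EFinD opprK.
by have := G0; lra.
Qed.

Lemma partition_dom s m : (m < (size s).+1)%N -> itv_partition (- G) 1 s ->
  D (nth 1 (- G :: s) m).
Proof.
by move=> ms ps; rewrite /dom/= in_itv/= (itv_partition_nth_ge ms ps) (itv_partition_nth_le ms ps).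
Qed.

Lemma cvariation_eq_dom F H s : eq_dom M F H -> itv_partition (- G) 1 s ->
  cvariation (- G) 1 F s = cvariation (- G) 1 H s.
Proof.
move=> FH ps; apply: eq_big_nat => n /= ns.
have d1 := @partition_dom s n (ltnW ns) ps.
have d2 := @partition_dom s n.+1 ns ps.
by rewrite !FH.
Qed.

Lemma bv_norm_eq_dom F H : eq_dom M F H -> bv_norm M F = bv_norm M H.
Proof.
move=> FH; congr (_ + _)%E; last first.
  by apply: eq_integral => x /set_mem Dx; rewrite FH.
congr ereal_sup; apply/seteqP; split => _ [s ps <-]; exists s => //;
  by rewrite (@cvariation_eq_dom F H).
Qed.

Lemma bv_norm0 : bv_norm M (cst 0) = 0%E.
Proof.
rewrite /bv_norm integral0_eq ?adde0; last first.
  by move=> x _; rewrite modulus_real normr0.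
apply/eqP; rewrite eq_le; apply/andP; split.
  apply: ge_ereal_sup => _ [s ps <-]; rewrite lee_fin /cvariation big1// => n _ /=.
  by rewrite subrr modulus_real normr0.
apply: ereal_sup_ubound; exists [:: 1].
  by rewrite /itv_partition/= andbT eqxx; split=> //; have := G0; lra.
by rewrite /cvariation big_nat1/= subrr modulus_real normr0.
Qed.

Section part.
(* The real or the imaginary part. *)
Variable pr : R[i] -> R.
Hypothesis prB : forall z w, pr (z - w) = pr z - pr w.
Hypothesis pr_le : forall z, `|pr z| <= modulus z.

Lemma total_variation_part F :
  (total_variation (- G) 1 (pr \o F) <= ctotal_variation (- G) 1 F)%E.
Proof.
apply: ge_ereal_sup => _ [_ [s ps <-] <-].
apply: (@le_trans _ _ (cvariation (- G) 1 F s)%:E); last first.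
  by apply: ereal_sup_ubound; exists s.
by rewrite lee_fin; apply: ler_sum => n _ /=; rewrite -prB pr_le.
Qed.

Lemma osc_part F x y : D x -> D y ->
  (`|pr (F x) - pr (F y)|%:E <= ctotal_variation (- G) 1 F)%E.
Proof.
wlog yx : x y / y <= x => [H|] Dx Dy.
  have [|/ltW] := leP y x; first by move=> yx; exact: H.
  by rewrite distrC => xy; exact: H.
apply: le_trans (total_variation_part F).
move: Dx Dy; rewrite /dom/= !in_itv/= => /andP[x1 x2] /andP[y1 y2].
rewrite (total_variationD _ y1 y2) (total_variationD _ yx x2).
apply: (le_trans (total_variation_ge (pr \o F) yx)).
rewrite -[leLHS]add0e leeD// ?total_variation_ge0// -[leLHS]adde0 leeD//.
by rewrite ?total_variation_ge0.
Qed.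

(** The value at a point is at most the oscillation, which the variation
bounds, plus the mean; the mean is at most the integral because the domain has
length [1 + Gamma], which is at least [1]. *)
Lemma sup_le_bv F x : D x -> (`|pr (F x)|%:E <= bv_norm M F)%E.
Proof.
move=> Dx; rewrite /bv_norm; set V := ctotal_variation _ _ _.
have V0 : (0 <= V)%E by apply: le_trans (osc_part F Dx Dx); rewrite lee_fin.
set J := (\int[leb]_(x in D) _)%E.
have J0 : (0 <= J)%E by apply: integral_ge0 => y _; rewrite lee_fin modulus_ge0.
have [Vfin|] := boolP (V \is a fin_num); last first.
  rewrite ge0_fin_numE// -leNgt leye_eq => /eqP ->.
  by rewrite addye ?leey// gt_eqF// (lt_le_trans _ J0)// ltNye.
rewrite -(fineK Vfin) -leeBlDl// -EFinB.
set m := `|pr (F x)| - fine V.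
have [m0|m0] := leP m 0; first by apply: le_trans J0; rewrite lee_fin.
apply: (@le_trans _ _ (\int[leb]_(y in D) m%:E)%E).
  rewrite integral_cst/=; last exact: measurable_itv.
  rewrite lebesgue_dom -EFinM lee_fin ler_peMr ?(ltW m0)//; have := G0; lra.
apply: ge0_le_integral_nonmeasurable => y Dy; rewrite lee_fin; first exact: ltW.
have := osc_part F Dx Dy; rewrite -/V -(fineK Vfin) lee_fin => xy.
have := ler_normD (pr (F x) - pr (F y)) (pr (F y)); rewrite subrK.
by rewrite /m lerBlDr => /le_trans; apply; rewrite addrC lerD// pr_le.
Qed.

End part.

Lemma bv_norm_eq0 F : (bv_norm M F <= 0)%E -> eq_dom M F (cst 0).
Proof.
move=> F0 x Dx.
have := le_trans (sup_le_bv (@ReB R) (@norm_Re_le R) F Dx) F0.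
have := le_trans (sup_le_bv (@ImB R) (@norm_Im_le R) F Dx) F0.
rewrite !lee_fin !normr_le0 => /eqP i0 /eqP r0.
by case: (F x) i0 r0 => /= ? ? -> ->.
Qed.

Lemma bv_norm_ge0 F : (0 <= bv_norm M F)%E.
Proof.
have D1 : D 1 by rewrite /dom/= in_itv/= lexx andbT; have := G0; lra.
by apply: le_trans (sup_le_bv (@ReB R) (@norm_Re_le R) F D1); rewrite lee_fin.
Qed.

End bv.

(** * The transfer operator *)
Section transfer.
Local Open Scope complex_scope.
Context (R : realType) (M : noisy_map R).
Local Notation leb := (@lebesgue_measure R).
Local Notation D := (dom M).
Local Notation G := (Gamma M).
Local Notation k := (Defs.kernel M).
Local Notation I f := (\int[leb]_(x in D) f x).
Local Notation bm := (bmeas D).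
Hypothesis TM : assumption_TM M.
Hypothesis mass1 : noise_law M setT = 1%E.
Variable C : R.
Hypothesis kernelC : forall x z, D x -> k x z <= C.
Implicit Types f : R -> R.

Let mD : measurable (D : set (measurableTypeR R)) := measurable_dom M.
Let G0 : 0 < G := Gamma_gt0 TM.

Lemma leb_dom_fin : (leb D < +oo)%E.
Proof. by rewrite lebesgue_dom// ltry. Qed.
Let muD : ((leb : {sigma_finite_measure set (measurableTypeR R) -> \bar R}) D < +oo)%E
  := leb_dom_fin.

Lemma fine_leb_dom : fine (leb D) = 1 + G.
Proof. by rewrite lebesgue_dom. Qed.

Lemma kernel_bound_ge0 : 0 <= C.
Proof. exact: le_trans (kernel_ge0 TM 1 0) (kernelC 0 (dom1 TM)). Qed.
Let C0 := kernel_bound_ge0.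

(** The Markov operator on real functions: all densities below are real. *)
Definition transfer f z := I (fun x => f x * k x z).
Local Notation L := transfer.

Lemma bmeas_kernel z : bm (k ^~ z).
Proof.
split; first exact: (measurableT_comp (measurable_noise_kernel TM) (pair2_measurable z)).
by exists C => x Dx; rewrite ger0_norm ?kernelC// kernel_ge0.
Qed.

Lemma bmeas_kernel_r x : D x -> bm (k x).
Proof.
move=> Dx; split; first exact: (measurableT_comp (measurable_noise_kernel TM) (pair1_measurable x)).
by exists C => z Dz; rewrite ger0_norm ?kernelC// kernel_ge0.
Qed.

Let bmk f z : bm f -> bm (fun x => f x * k x z).
Proof. by move=> bf; apply: bmeasM => //; exact: bmeas_kernel. Qed.

Let mfk f : bm f -> measurable_fun setT (fun p : R * R => f p.2 * k p.2 p.1).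
Proof.
move=> bf; apply: measurable_funM.
  exact: (measurableT_comp (bmeas_measurable bf) measurable_snd).
exact: (measurableT_comp (measurable_noise_kernel TM) (@measurable_swap _ _ _ _)).
Qed.

Lemma bmeas_transfer f : bm f -> bm (L f).
Proof.
move=> bf; have [b b0 fb] := bmeas_ge0 bf.
apply: (@bmeas_Rint _ _ _ leb D mD muD (fun z x => f x * k x z) (b * C)).
  exact: mfk.
move=> z x Dz Dx; rewrite normrM ler_pM ?fb//.
by rewrite ger0_norm ?kernel_ge0// kernelC.
Qed.

Lemma transferD f f' z : bm f -> bm f' ->
  L (fun x => f x + f' x) z = L f z + L f' z.
Proof.
move=> bf bf'; rewrite /L -(RintD mD muD (bmk z bf) (bmk z bf')).
by apply: eq_Rintegral => x _; rewrite mulrDl.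
Qed.

Lemma transferB f f' z : bm f -> bm f' ->
  L (fun x => f x - f' x) z = L f z - L f' z.
Proof.
move=> bf bf'; rewrite /L -(RintB mD muD (bmk z bf) (bmk z bf')).
by apply: eq_Rintegral => x _; rewrite mulrBl.
Qed.

Lemma le_transfer f f' z : bm f -> bm f' -> (forall x, D x -> f x <= f' x) ->
  L f z <= L f' z.
Proof.
move=> bf bf' ff'; apply: le_Rint => //; [exact: bmk|exact: bmk|].
by move=> x Dx; rewrite ler_wpM2r ?kernel_ge0// ff'.
Qed.

Lemma eq_transfer f f' : {in D, f =1 f'} -> L f = L f'.
Proof.
by move=> ff'; apply/funext => z; apply: eq_Rintegral => x Dx; rewrite ff'.
Qed.

Lemma transfer_ge0 f z : (forall x, D x -> 0 <= f x) -> 0 <= L f z.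
Proof.
by move=> f0; apply: Rintegral_ge0 => x Dx; rewrite mulr_ge0 ?f0// kernel_ge0.
Qed.

Lemma norm_transfer f z : bm f -> `|L f z| <= L (fun x => `|f x|) z.
Proof.
move=> bf; rewrite (le_trans (Rint_norm mD muD (bmk z bf)))//.
apply: le_Rint => //; [exact/bmeas_norm/bmk|exact/bmk/bmeas_norm|].
by move=> x Dx; rewrite normrM (ger0_norm (kernel_ge0 TM _ _)).
Qed.

(** One step regularizes: an integrable density becomes a bounded one. *)
Lemma transfer_le f z : bm f -> (forall x, D x -> 0 <= f x) -> L f z <= C * I f.
Proof.
move=> bf f0; rewrite -(RintZ mD muD)//; apply: le_Rint => //; [exact: bmk|exact: bmeasZ|].
by move=> x Dx; rewrite mulrC ler_wpM2r ?f0// kernelC.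
Qed.

Lemma kernel_Rmass x : D x -> I (k x) = 1.
Proof. by move=> Dx; rewrite /Rintegral (kernel_mass TM mass1 kernelC). Qed.

(** Duality with the action on test functions. With [u = 1] it gives the
conservation of mass, with [u] an indicator the law of the next position. *)
Lemma Rint_transferM f u : bm f -> bm u ->
  I (fun z => u z * L f z) = I (fun x => f x * I (fun z => u z * k x z)).
Proof.
move=> bf bu; have [b b0 fb] := bmeas_ge0 bf; have [c c0 uc] := bmeas_ge0 bu.
pose F z x := u z * (f x * k x z).
have mF : measurable_fun setT (fun p : R * R => F p.1 p.2).
  apply: measurable_funM; last exact: mfk.
  exact: (measurableT_comp (bmeas_measurable bu) measurable_fst).
have Fb z x : D z -> D x -> `|F z x| <= c * (b * C).
  move=> Dz Dx; rewrite /F normrM (normrM (f x)) (ger0_norm (kernel_ge0 TM x z)).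
  apply: ler_pM => //; first by rewrite mulr_ge0// kernel_ge0.
    exact: uc.
  by apply: ler_pM => //; [exact: kernel_ge0|exact: fb|exact: kernelC].
transitivity (I (fun z => I (F z))).
  apply: eq_Rintegral => z _; rewrite /F -(RintZ mD muD)//; exact: bmk.
rewrite (Rint_fubini mD muD mF Fb); apply: eq_Rintegral => x Dx.
rewrite -(RintZ mD muD); last by apply: bmeasM => //; apply/bmeas_kernel_r/set_mem.
by apply: eq_Rintegral => z _; rewrite /F mulrCA.
Qed.

Lemma Rint_transfer f : bm f -> I (L f) = I f.
Proof.
move=> bf; have := Rint_transferM bf (bmeas_cst D 1).
under eq_Rintegral do rewrite mul1r.
move=> ->; apply: eq_Rintegral => x Dx.
under eq_Rintegral do rewrite mul1r.
by rewrite kernel_Rmass ?mulr1//; exact/set_mem.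
Qed.

Lemma markov_real f : Defs.markov M (fun x => (f x)%:C) = (fun z => (L f z)%:C).
Proof.
apply/funext => z; rewrite /Defs.markov /cintegral; congr (_ +i* _).
  by apply: eq_Rintegral => x _ /=; rewrite mul0r subr0.
rewrite /Rintegral integral0_eq// => x _.
by rewrite /= mulr0 mul0r addr0.
Qed.

Lemma markov_eq_dom (f f' : R -> R[i]) : eq_dom M f f' ->
  Defs.markov M f = Defs.markov M f'.
Proof.
move=> ff'; apply/funext => z; rewrite /Defs.markov /cintegral.
by congr (_ +i* _); apply: eq_Rintegral => x /set_mem Dx; rewrite ff'.
Qed.

Lemma iter_markov_real n f :
  iter n (Defs.markov M) (fun x => (f x)%:C) = (fun z => (iter n L f z)%:C).
Proof. by elim: n => [//|n IH]; rewrite /= IH markov_real. Qed.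

Lemma bmeas_iter n f : bm f -> bm (iter n L f).
Proof. by move=> bf; elim: n => [//|n IH]; exact: bmeas_transfer. Qed.

Lemma Rint_iter n f : bm f -> I (iter n L f) = I f.
Proof. by move=> bf; elim: n => [//|n IH]; rewrite /= Rint_transfer//; exact: bmeas_iter. Qed.

Section variation.
Variable V : R.
Hypothesis V0 : 0 <= V.
Hypothesis kernelV : {ae leb, forall x, D x -> (total_variation (- G) 1 (k x) <= V%:E)%E}.

(** The image of [f] is an average of the functions [k x], weighted by [f],
and almost all of these have variation at most [V]. *)
Lemma cvariation_transfer f s : bm f -> (forall x, D x -> 0 <= f x) ->
  itv_partition (- G) 1 s ->
  cvariation (- G) 1 (fun z => (L f z)%:C) s <= V * I f.
Proof.
move=> bf f0 ps.
pose P i := nth 1 (- G :: s) i.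
pose Q i x := `|k x (P i.+1) - k x (P i)|.
have bQ i : bm (Q i) by apply/bmeas_norm/bmeasB; exact: bmeas_kernel.
have bfQ i : bm (fun x => f x * Q i x) by exact: bmeasM.
apply: (@le_trans _ _ (\sum_(0 <= i < size s) I (fun x => f x * Q i x))).
  apply: ler_sum => i _; rewrite /comp -rmorphB modulus_real.
  rewrite -(RintB mD muD (bmk _ bf) (bmk _ bf)).
  apply: (le_trans (Rint_norm mD muD _)); first by apply: bmeasB; exact: bmk.
  apply: le_Rint => //; [by apply/bmeas_norm/bmeasB; exact: bmk|exact: bfQ|].
  by move=> x Dx; rewrite -mulrBr normrM (ger0_norm (f0 x Dx)).
apply: (@le_trans _ _ (I (fun x => \sum_(0 <= i < size s) f x * Q i x))).
  by rewrite le_eqVlt; apply/orP; left; apply/eqP/esym; exact: (Rint_sum mD muD (size s) bfQ).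
rewrite -(RintZ mD muD V bf).
have bS := bmeas_sum (size s) bfQ.
rewrite -lee_fin (EFin_Rint mD muD bS) (EFin_Rint mD muD (bmeasZ V bf)).
apply: ae_ge0_le_integral => //.
- by move=> x Dx; rewrite lee_fin sumr_ge0// => i _; rewrite mulr_ge0 ?f0 ?normr_ge0.
- apply/measurable_EFinP; apply: measurable_funTS; exact: (bmeas_measurable bS).
- by move=> x Dx; rewrite lee_fin mulr_ge0 ?f0.
- apply/measurable_EFinP; apply: measurable_funTS; exact: (bmeas_measurable (bmeasZ V bf)).
case: kernelV => N [mN N0 subN]; exists N; split=> // x xP; apply: subN => xV; apply: xP => Dx.
rewrite lee_fin -mulr_sumr mulrC ler_wpM2r ?f0//.
rewrite -lee_fin; apply: le_trans (xV Dx); apply: ereal_sup_ubound.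
by exists (variation (- G) 1 (k x) s) => //; exact: variations_variation.
Qed.

Lemma bv_norm_transfer f : bm f -> (forall x, D x -> 0 <= f x) ->
  (bv_norm M (fun z => (L f z)%:C) <= ((V + 1) * I f)%:E)%E.
Proof.
move=> bf f0; rewrite mulrDl mul1r EFinD leeD//.
  by apply: ge_ereal_sup => _ [s ps <-]; rewrite lee_fin cvariation_transfer.
rewrite -(Rint_transfer bf) (EFin_Rint mD muD); last exact: bmeas_transfer.
rewrite le_eqVlt; apply/orP; left; apply/eqP; apply: eq_integral => z _.
by rewrite modulus_real ger0_norm// transfer_ge0.
Qed.

End variation.
End transfer.

(** * Mixing from the spectral gap *)
Lemma ReMr (R : realType) (c : R[i]) (x : R) :
  complex.Re (c * x%:C)%C = complex.Re c * x.
Proof. by case: c => a b /=; rewrite mulr0 subr0. Qed.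

Section mixing.
Local Open Scope complex_scope.
Context (R : realType) (M : noisy_map R).
Local Notation leb := (@lebesgue_measure R).
Local Notation D := (dom M).
Local Notation G := (Gamma M).
Local Notation k := (Defs.kernel M).
Local Notation I f := (\int[leb]_(x in D) f x).
Local Notation bm := (bmeas D).
Local Notation L := (transfer M).
Local Notation K := (Defs.markov M).
Hypothesis TM : assumption_TM M.
Hypothesis mass1 : noise_law M setT = 1%E.
Variable C : R.
Hypothesis kernelC : forall x z, D x -> k x z <= C.
Let mD : measurable (D : set (measurableTypeR R)) := measurable_dom M.
Let G0 : 0 < G := Gamma_gt0 TM.
Let muD : ((leb : {sigma_finite_measure set (measurableTypeR R) -> \bar R}) D < +oo)%E
  := leb_dom_fin TM.
Variable h : R -> R.
Hypotheses (bh : bm h) (h1 : I h = 1) (Lh : {in D, L h =1 h}).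
Hypothesis hbv : in_bv M (fun x => (h x)%:C).
Hypothesis Kop : bv_operator M K.
Implicit Types F H : R -> R[i].

Let hC : R -> R[i] := fun x => (h x)%:C.

(** The value of an operator on bounded-variation functions is meaningful only
up to equality on the domain, and nothing but linearity and boundedness says
that it is compatible with this equality. *)
Lemma bv_operatorE (N : (R -> R[i]) -> R -> R[i]) F H : bv_operator M N ->
  in_bv M F -> eq_dom M F H -> eq_dom M (N F) (N H).
Proof.
move=> [Nlin [c c0 Nb]] Fbv FH.
pose E : R -> R[i] := fun x => H x - F x.
have E0 : bv_norm M E = 0%E.
  rewrite -(bv_norm0 G0); apply: bv_norm_eq_dom => // x Dx.
  by rewrite /E FH// subrr.
have NE : eq_dom M (N E) (cst 0).
  apply: (bv_norm_eq0 G0); apply: (le_trans (Nb _ _)); first by rewrite /in_bv E0 ltry.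
  by rewrite E0 mule0.
have HE : (fun x => 1 * F x + E x) = H.
  by apply/funext => x; rewrite /E mul1r addrC subrK.
move=> x Dx; have Ebv : in_bv M E by rewrite /in_bv E0 ltry.
have := Nlin 1 F E Fbv Ebv x Dx.
by rewrite HE => ->; rewrite NE// addr0 mul1r.
Qed.

Lemma bv_operator_in_bv (N : (R -> R[i]) -> R -> R[i]) F : bv_operator M N ->
  in_bv M F -> in_bv M (N F).
Proof.
move=> [_ [c c0 Nb]] Fbv; apply: (le_lt_trans (Nb _ Fbv)).
rewrite lte_mul_pinfty// ?lee_fin//.
Qed.

Lemma le0_geometric (r B x : R) p0 : 0 <= r < 1 ->
  (forall p, (p0 <= p)%N -> x <= r ^+ p * B) -> x <= 0.
Proof.
move=> /andP[r0 r1] xB.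
have cr : r ^+ p * B @[p --> \oo] --> (0 * B : R).
  apply: cvgMl; apply: cvg_expr; rewrite ger0_norm//.
rewrite mul0r in cr.
rewrite -(cvg_lim _ cr)//; apply: limr_ge; first by apply/cvg_ex; exists 0.
by exists p0 => // p /= /xB.
Qed.

Lemma iter_transfer_fixed p z : D z -> iter p L h z = h z.
Proof.
elim: p z => [//|p IH] z Dz; rewrite /= -[RHS]Lh ?inE//.
by congr (_ z); apply: eq_transfer => x /set_mem Dx; exact: IH.
Qed.

Section gap.
Variables P N : (R -> R[i]) -> R -> R[i].
Hypotheses (Pop : bv_operator M P) (Nop : bv_operator M N).
Hypothesis KPN : forall F, in_bv M F -> eq_dom M (K F) (fun x => 1 * P F x + N F x).
Variable v : R -> R[i].
Hypotheses (vbv : in_bv M v) (Pv : eq_dom M (P v) v).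
Hypothesis Pline : forall F, in_bv M F -> exists c : R[i], eq_dom M (P F) (fun x => c * v x).
Hypothesis PN0 : forall F, in_bv M F -> eq_dom M (P (N F)) (cst 0) /\ eq_dom M (N (P F)) (cst 0).
Variables (r : R) (p0 : nat).
Hypothesis r01 : 0 <= r < 1.
Hypothesis Nr : forall p, (p0 <= p)%N -> forall F, in_bv M F ->
  (bv_norm M (iter p N F) <= (r ^+ p)%:E * bv_norm M F)%E.

Lemma P_idem F : in_bv M F -> eq_dom M (P (P F)) (P F).
Proof.
move=> Fbv; have [c PF] := Pline Fbv.
have PFbv := bv_operator_in_bv Pop Fbv.
pose z : R -> R[i] := cst 0.
have zbv : in_bv M z by rewrite /in_bv bv_norm0// ltry.
have E1 := Pop.1 c v z vbv zbv.
have E2 : eq_dom M (P F) (fun x => c * v x + z x) by move=> x Dx; rewrite PF// addr0.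
move=> x Dx; rewrite (bv_operatorE Pop PFbv E2)// E1// Pv// PF//.
have Pz : eq_dom M (P z) (cst 0).
  apply: (bv_norm_eq0 G0); have [_ [b b0 Pb]] := Pop.
  by apply: (le_trans (Pb _ zbv)); rewrite bv_norm0// mule0.
by rewrite Pz// addr0.
Qed.

Lemma iter_N_in_bv p F : in_bv M F -> in_bv M (iter p N F).
Proof. by move=> Fbv; elim: p => [//|p IH]; apply: (bv_operator_in_bv Nop IH). Qed.

(** The mixed terms vanish since [P N = N P = 0]. The zeroth power is excluded:
the identity is not [P] plus the identity. *)
Lemma iter_K_decomposition p F : in_bv M F ->
  eq_dom M (iter p.+1 K F) (fun x => P F x + iter p.+1 N F x).
Proof.
move=> Fbv; elim: p => [|p IH] x Dx; first by rewrite /= KPN// mul1r.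
rewrite iterS (markov_eq_dom IH).
have PFbv := bv_operator_in_bv Pop Fbv.
have NFbv := iter_N_in_bv p.+1 Fbv.
have := Kop.1 1 (P F) (iter p.+1 N F) PFbv NFbv x Dx.
under [X in K X]eq_fun do rewrite mul1r.
move=> ->; rewrite (KPN PFbv Dx) (KPN NFbv Dx) !mul1r (P_idem Fbv Dx).
rewrite ((PN0 Fbv).2 x Dx) addr0; congr (_ + _).
by rewrite [X in P X]iterS ((PN0 (iter_N_in_bv p Fbv)).1 x Dx) add0r.
Qed.

Lemma iter_L_decomposition p f z : in_bv M (fun x => (f x)%:C) -> D z ->
  (iter p.+1 L f z)%:C = P (fun x => (f x)%:C) z + iter p.+1 N (fun x => (f x)%:C) z.
Proof.
by move=> fbv Dz; rewrite -(iter_K_decomposition p fbv)// iter_markov_real.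
Qed.

Lemma part_iter_N (pr : R[i] -> R) p F (B : R) z :
  (forall z w, pr (z - w) = pr z - pr w) -> (forall z, `|pr z| <= modulus z) ->
  (bv_norm M F <= B%:E)%E -> (p0 <= p)%N -> D z ->
  `|pr (iter p N F z)| <= r ^+ p * B.
Proof.
move=> prB pr_le FB pp Dz; rewrite -lee_fin.
apply: (le_trans (sup_le_bv G0 prB pr_le _ Dz)).
have Fbv : in_bv M F by exact: le_lt_trans FB (ltry _).
apply: (le_trans (Nr pp Fbv)); rewrite EFinM lee_wpmul2l// lee_fin exprn_ge0//.
by case/andP: r01.
Qed.

(** As [h] is fixed by every power of [K], the difference [h - P h] equals
[N^p h] for all positive [p], which tends to [0]. *)
Lemma P_h : eq_dom M (P hC) hC.
Proof.
have dec p z : D z -> hC z - P hC z = iter p.+1 N hC z.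
  move=> Dz; have := iter_L_decomposition p hbv Dz.
  by rewrite iter_transfer_fixed// /hC => ->; rewrite addrAC subrr add0r.
have part (pr : R[i] -> R) : (forall z w, pr (z - w) = pr z - pr w) ->
    (forall z, `|pr z| <= modulus z) -> forall z, D z -> pr (hC z) = pr (P hC z).
  move=> prB pr_le z Dz; apply/eqP; rewrite -subr_eq0 -normr_le0 -prB.
  have hfin : bv_norm M hC \is a fin_num by rewrite ge0_fin_numE// bv_norm_ge0.
  apply: (@le0_geometric r (fine (bv_norm M hC)) _ p0.+1) => // -[//|p] pp.
  rewrite (dec p)//; apply: part_iter_N => //; first by rewrite fineK.
  exact: ltnW.
move=> z Dz; have := part _ (@ReB R) (@norm_Re_le R) z Dz.
have := part _ (@ImB R) (@norm_Im_le R) z Dz.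
by case: (hC z) (P hC z) => [? ?] [? ?] /= -> ->.
Qed.

Lemma P_projection f : bm f -> in_bv M (fun x => (f x)%:C) ->
  exists c : R[i], eq_dom M (P (fun x => (f x)%:C)) (fun x => c * hC x).
Proof.
move=> bf fbv; have [c Pf] := Pline fbv; have [b Ph] := Pline hbv.
have hb : eq_dom M hC (fun x => b * v x) by move=> x Dx; rewrite -P_h// Ph.
have b0 : b != 0.
  apply/eqP => b0; have : I h = I (cst 0).
    apply: eq_Rintegral => x /set_mem Dx; have := hb x Dx.
    by rewrite b0 mul0r => -[].
  by rewrite h1 (Rintegral_cst _ mD) mul0r => /eqP; rewrite oner_eq0.
by exists (c / b) => x Dx; rewrite Pf// hb// mulrA divfK.
Qed.

(** The limit of [L^p f] is a multiple of [h] because [P] has rank one; the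
conservation of mass identifies the factor as the integral of [f]. *)
Lemma gap_mixing f (B : R) p z : bm f ->
  (bv_norm M (fun x => (f x)%:C) <= B%:E)%E -> (p0 < p)%N -> D z ->
  `|iter p L f z - I f * h z| <= r ^+ p * B.
Proof.
move=> bf fB pp Dz.
have fbv : in_bv M (fun x => (f x)%:C) by exact: le_lt_trans fB (ltry _).
have [c Pf] := P_projection bf fbv.
have est q y : (p0 < q)%N -> D y -> `|iter q L f y - complex.Re c * h y| <= r ^+ q * B.
  case: q => [//|q] qq Dy.
  have := part_iter_N (@ReB R) (@norm_Re_le R) fB (ltnW qq) Dy.
  have := iter_L_decomposition q fbv Dy; rewrite Pf// => /eqP.
  rewrite addrC -subr_eq => /eqP <-.
  by rewrite ReB /hC ReMr.
suff -> : I f = complex.Re c by exact: est.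
apply/eqP; rewrite -subr_eq0 -normr_le0.
apply: (@le0_geometric r (B * (1 + G)) _ p0.+1) => // q qq.
have bq := bmeas_iter TM kernelC q bf.
have bch : bm (fun x => complex.Re c * h x) by exact: bmeasZ.
have -> : I f - complex.Re c = I (fun x => iter q L f x - complex.Re c * h x).
  rewrite (RintB mD muD bq bch) (RintZ mD muD _ bh) h1 mulr1.
  by rewrite (Rint_iter TM mass1 kernelC).
apply: (le_trans (Rint_norm mD muD (bmeasB bq bch))).
rewrite mulrA -fine_leb_dom//; apply: (le_Rint_cst mD muD) => [|y Dy].
  by apply: bmeas_norm; exact: bmeasB.
exact: est.
Qed.

End gap.

Lemma mixing : spectral_gap M K 1 ->
  exists r p0, 0 <= r < 1 /\ forall f (B : R) p z, bm f ->
  (bv_norm M (fun x => (f x)%:C) <= B%:E)%E -> (p0 <= p)%N -> D z ->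
  `|iter p L f z - I f * h z| <= r ^+ p * B.
Proof.
move=> [P [N [[Pop Nop] KPN [v [vbv _ Pv Pline]] PN0 [r r01 [p0 _ Nr]]]]].
have r1 : 0 <= r < 1.
  have -> : (1 : R) = modulus (1 : R[i]) by rewrite modulusE/= expr0n addr0 expr1n sqrtr1.
  exact: r01.
exists r, p0.+1; split => // f B p z bf fB pp Dz.
exact: (gap_mixing Pop Nop KPN vbv Pv Pline PN0 r1 Nr bf fB pp Dz).
Qed.

End mixing.

(** * The density of the orbit given the number of visits *)
Section visit_densities.
Local Open Scope complex_scope.
Context (R : realType) (M : noisy_map R).
Local Notation leb := (@lebesgue_measure R).
Local Notation D := (dom M).
Local Notation G := (Gamma M).
Local Notation k := (Defs.kernel M).
Local Notation I f := (\int[leb]_(x in D) f x).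
Local Notation bm := (bmeas D).
Local Notation L := (transfer M).

Definition one_less (F : nat -> R -> R) (j : nat) : R -> R :=
  if j is j'.+1 then F j' else cst 0.

Section def.
Variables (h w : R -> R).
Definition visit_update (F : nat -> R -> R) (j : nat) (x : R) : R :=
  (1 - w x) * F j x + w x * one_less F j x.

(** The density of the orbit at time [m] on the event that exactly [j] of the
observations before time [m] fell in the target, when [h] is the density of the
initial point and [w x] the probability that the observation of [x] does. *)
Fixpoint visit_density (m j : nat) : R -> R :=
  if m is m'.+1 then L (visit_update (visit_density m') j)
  else if j is 0 then h else cst 0.
End def.

Hypothesis TM : assumption_TM M.
Hypothesis mass1 : noise_law M setT = 1%E.
Variable C : R.
Hypothesis kernelC : forall x z, D x -> k x z <= C.
Let mD : measurable (D : set (measurableTypeR R)) := measurable_dom M.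
Let G0 : 0 < G := Gamma_gt0 TM.
Let muD : ((leb : {sigma_finite_measure set (measurableTypeR R) -> \bar R}) D < +oo)%E
  := leb_dom_fin TM.
Let C0 : 0 <= C := kernel_bound_ge0 TM kernelC.
Variables (h w : R -> R).
Hypotheses (bh : bm h) (h0 : forall x, 0 <= h x) (h1 : I h = 1)
  (Lh : {in D, L h =1 h}).
Hypotheses (bw : bm w) (w01 : forall x, 0 <= w x <= 1).

Local Notation f := (visit_density h w).
Local Notation pi m j := (I (f m j)).
Let wh x := w x * h x.
Let ell := I w.
Let Dl := I wh.

Let bwh : bm wh. Proof. exact: bmeasM. Qed.
Let w0 x : 0 <= w x. Proof. by have /andP[] := w01 x. Qed.
Let wh0 x : 0 <= wh x. Proof. by rewrite mulr_ge0. Qed.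

Lemma bmeas_one_less (F : nat -> R -> R) j : (forall j, bm (F j)) -> bm (one_less F j).
Proof. by move=> bF; case: j => [|j] //=; exact: bmeas_cst. Qed.

Lemma bmeas_visit_update F j : (forall j, bm (F j)) -> bm (visit_update w F j).
Proof.
move=> bF; apply: bmeasD; apply: bmeasM => //.
  by apply: bmeasB => //; exact: (bmeas_cst D 1).
exact: bmeas_one_less.
Qed.

Lemma bmeas_visit_density m j : bm (f m j).
Proof.
elim: m j => [|m IH] j /=; first by case: j => [|j] //; exact: (bmeas_cst D 0).
by apply: (bmeas_transfer TM kernelC); exact: bmeas_visit_update.
Qed.

(** The densities for all [j] add up to [L^m h = h]. *)
Lemma visit_density_bounds m j x : D x -> 0 <= f m j x <= h x.
Proof.
elim: m j x => [|m IH] j x Dx /=.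
  by case: j => [|j]; rewrite ?h0 ?lexx.
have tb y : D y -> 0 <= visit_update w (f m) j y <= h y.
  move=> Dy; rewrite /visit_update; have /andP[a0 ah] := IH j y Dy.
  have /andP[b0 bh'] : 0 <= one_less (f m) j y <= h y.
    by case: (j) => [|i] /=; rewrite ?lexx ?h0//; exact: IH.
  have /andP[? ?] := w01 y; apply/andP; split.
    by rewrite addr_ge0// mulr_ge0// subr_ge0.
  have -> : h y = (1 - w y) * h y + w y * h y by ring.
  by rewrite lerD// ler_wpM2l// subr_ge0.
apply/andP; split; first by apply: (transfer_ge0 TM) => y /tb /andP[].
rewrite -[leRHS]Lh ?inE//; apply: (le_transfer TM kernelC) => //.
  by apply: bmeas_visit_update => i; exact: bmeas_visit_density.
by move=> y /tb /andP[].
Qed.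

Lemma one_less_bounds m j x : D x -> 0 <= one_less (f m) j x <= h x.
Proof. by move=> Dx; case: j => [|j] /=; rewrite ?lexx ?h0//; exact: visit_density_bounds. Qed.

Lemma visit_update_ge0 m j x : D x -> 0 <= visit_update w (f m) j x.
Proof.
move=> Dx; have /andP[a0 _] := visit_density_bounds m j Dx.
have /andP[b0 _] := one_less_bounds m j Dx.
by have /andP[? ?] := w01 x; rewrite addr_ge0// mulr_ge0// subr_ge0.
Qed.

Lemma visit_update_le m j x : D x -> visit_update w (f m) j x <= h x.
Proof.
move=> Dx; have /andP[_ a0] := visit_density_bounds m j Dx.
have /andP[_ b0] := one_less_bounds m j Dx.
have -> : h x = (1 - w x) * h x + w x * h x by ring.
by have /andP[? ?] := w01 x; rewrite lerD// ler_wpM2l// subr_ge0.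
Qed.

Let bm_density m : forall j, bm (f m j). Proof. exact: bmeas_visit_density. Qed.

Lemma visit_mass_step m j :
  pi m.+1 j = pi m j - I (fun x => w x * f m j x) + I (fun x => w x * one_less (f m) j x).
Proof.
have bp := bmeas_one_less j (bm_density m).
rewrite /= (Rint_transfer TM mass1 kernelC); last exact: bmeas_visit_update.
rewrite -(RintB mD muD (bm_density m j) (bmeasM bw (bm_density m j))).
rewrite -(RintD mD muD (bmeasB (bm_density m j) (bmeasM bw (bm_density m j))) (bmeasM bw bp)).
by apply: eq_Rintegral => x _; rewrite /visit_update mulrBl mul1r.
Qed.

Lemma hit_bounds m j : 0 <= I (fun x => w x * f m j x) <= Dl.
Proof.
apply/andP; split.
  apply: Rintegral_ge0 => x Dx; rewrite mulr_ge0//.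
  by have /andP[] := visit_density_bounds m j Dx.
apply: (le_Rint mD muD) => //; first exact: (bmeasM bw (bm_density m j)).
by move=> x Dx; rewrite ler_wpM2l//; have /andP[] := visit_density_bounds m j Dx.
Qed.

Lemma visit_mass_bounds m j : 0 <= pi m j <= 1.
Proof.
apply/andP; split.
  by apply: Rintegral_ge0 => x Dx; have /andP[] := visit_density_bounds m j Dx.
rewrite -h1; apply: (le_Rint mD muD) => //; first exact: bm_density.
by move=> x Dx; have /andP[] := visit_density_bounds m j Dx.
Qed.

Lemma hit_rate_ge0 : 0 <= Dl.
Proof. by apply: Rintegral_ge0 => x _. Qed.

Lemma hit_rate_le1 : Dl <= 1.
Proof.
rewrite -h1; apply: (le_Rint mD muD) => // x Dx.
by rewrite ler_piMl//; have /andP[] := w01 x.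
Qed.

(** A step with and a step without counting differ only on the mass that hits
the target, which is dominated by [w * h]. *)
Lemma visit_density_step m j z : `|f m.+1 j z - L (f m j) z| <= L wh z.
Proof.
have bp := bmeas_one_less j (bm_density m).
rewrite /= -(transferB TM kernelC) //; last exact: bmeas_visit_update.
have bd : bm (fun x => visit_update w (f m) j x - f m j x) by apply: bmeasB => //;
  exact: bmeas_visit_update.
apply: (le_trans (norm_transfer TM kernelC z bd)).
apply: (le_transfer TM kernelC) => //; first exact: bmeas_norm.
move=> x Dx.
have -> : visit_update w (f m) j x - f m j x = w x * (one_less (f m) j x - f m j x).
  by rewrite /visit_update; ring.
rewrite normrM ger0_norm// ler_wpM2l//.
have := one_less_bounds m j Dx; have := visit_density_bounds m j Dx.
rewrite ler_norml; lra.
Qed.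

(** Forgetting the last [p] hits. The bound in mass feeds the bound at each
point: the error of the next step is the image under [L] of a function of mass at
most [(p + 1) * Delta], hence is at most [C] times this mass. *)
Lemma visit_density_iter m p j :
  (forall z, D z -> `|f (m + p) j z - iter p L (f m j) z| <= C * (p%:R * Dl)) /\
  I (fun z => `|f (m + p) j z - iter p L (f m j) z|) <= p%:R * Dl.
Proof.
elim: p => [|p [_ IH]].
  split=> [z Dz|]; first by rewrite addn0 subrr normr0 mul0r mulr0.
  under eq_Rintegral do rewrite addn0 subrr normr0.
  by rewrite (Rintegral_cst _ mD) !mul0r.
have bi q := bmeas_iter TM kernelC q (bm_density m j).
pose e x := `|f (m + p) j x - iter p L (f m j) x|.
have be : bm e by apply: bmeas_norm; apply: bmeasB.
have ineq z : `|f (m + p.+1) j z - iter p.+1 L (f m j) z| <= L (fun x => wh x + e x) z.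
  rewrite (transferD TM kernelC)//.
  have -> : f (m + p.+1) j z - iter p.+1 L (f m j) z =
    (f (m + p).+1 j z - L (f (m + p) j) z) + (L (f (m + p) j) z - L (iter p L (f m j)) z).
    by rewrite addnS iterS; ring.
  rewrite (le_trans (ler_normD _ _))// lerD//; first exact: visit_density_step.
  rewrite -(transferB TM kernelC)//; apply: (norm_transfer TM kernelC).
  exact: bmeasB.
have bs : bm (fun x => wh x + e x) by exact: bmeasD.
have Is : I (fun x => wh x + e x) <= p.+1%:R * Dl.
  by rewrite (RintD mD muD bwh be) -natr1 mulrDl mul1r addrC lerD.
split=> [z Dz|].
  apply: (le_trans (ineq z)); apply: (le_trans (transfer_le TM kernelC z bs _)).
    by move=> x _; rewrite addr_ge0 ?wh0 ?normr_ge0.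
  exact: ler_wpM2l.
apply: le_trans Is; rewrite -(Rint_transfer TM mass1 kernelC bs).
apply: (le_Rint mD muD) => //.
  exact: (bmeas_norm (bmeasB (bm_density (m + p.+1) j) (bi p.+1))).
exact: (bmeas_transfer TM kernelC).
Qed.

Section estimate.
Variable V : R.
Hypothesis V0 : 0 <= V.
Hypothesis kernelV : {ae leb, forall x, D x -> (total_variation (- G) 1 (k x) <= V%:E)%E}.

Lemma bv_norm_h : (bv_norm M (fun x => (h x)%:C) <= (V + 1)%:E)%E.
Proof.
rewrite (@bv_norm_eq_dom _ M _ (fun x => (L h x)%:C))//; last first.
  by move=> x Dx; rewrite Lh// inE.
have := bv_norm_transfer TM mass1 kernelC V0 kernelV bh (fun x _ => h0 x).
by rewrite h1 mulr1.
Qed.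

(** Since [w] is only measurable, [visit_update] need not have bounded
variation; the transfer operator applied after it restores it, with a bound that
does not depend on [m], [j] or the target. *)
Lemma bv_norm_visit_density m j : (bv_norm M (fun x => (f m j x)%:C) <= (V + 1)%:E)%E.
Proof.
case: m => [|m].
  case: j => [|j] /=; first exact: bv_norm_h.
  by rewrite (bv_norm0 G0) lee_fin addr_ge0.
have bt := bmeas_visit_update j (bm_density m).
apply: (le_trans (bv_norm_transfer TM mass1 kernelC V0 kernelV bt _)).
  by move=> x Dx; exact: visit_update_ge0.
rewrite lee_fin -[leRHS]mulr1 ler_wpM2l ?addr_ge0// -h1.
by apply: (le_Rint mD muD) => // x Dx; exact: visit_update_le.
Qed.

Variables (r : R) (p0 : nat).
Hypothesis mix : forall (g : R -> R) (B : R) p z, bm g ->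
  (bv_norm M (fun x => (g x)%:C) <= B%:E)%E -> (p0 <= p)%N -> D z ->
  `|iter p L g z - I g * h z| <= r ^+ p * B.

(** The three terms on the right come from the last [p] hits in the density,
from the mixing error after [p] free steps, and from the last [p] hits in the
mass. The mixing term is multiplied by the integral of [w] and not merely
bounded: this factor makes it negligible compared with [\int w h]. *)
Lemma hit_estimate m p j : (p0 <= p)%N ->
  `|I (fun x => w x * f (m + p) j x) - Dl * pi (m + p) j| <=
  ell * (C * (p%:R * Dl)) + ell * (r ^+ p * (V + 1)) + Dl * (p%:R * Dl).
Proof.
move=> pp; have [e1 e2] := visit_density_iter m p j.
have bi := bmeas_iter TM kernelC p (bm_density m j).
have bfp := bm_density (m + p) j.
have -> : I (fun x => w x * f (m + p) j x) - Dl * pi (m + p) j =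
   I (fun x => w x * (f (m + p) j x - iter p L (f m j) x)) +
   I (fun x => w x * (iter p L (f m j) x - pi m j * h x)) +
   Dl * (pi m j - pi (m + p) j).
  under [X in X + _ + _]eq_Rintegral do rewrite mulrBr.
  rewrite (RintB mD muD (bmeasM bw bfp) (bmeasM bw bi)).
  have -> : I (fun x => w x * (iter p L (f m j) x - pi m j * h x)) =
     I (fun x => w x * iter p L (f m j) x) - pi m j * Dl.
    rewrite -(RintZ mD muD _ bwh) -(RintB mD muD (bmeasM bw bi) (bmeasZ _ bwh)).
    by apply: eq_Rintegral => x _; rewrite /wh; ring.
  by ring.
have bd : bm (fun x => f (m + p) j x - iter p L (f m j) x) by exact: bmeasB.
have bd2 : bm (fun x => iter p L (f m j) x - pi m j * h x).
  by apply: bmeasB => //; exact: bmeasZ.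
have wb (g : R -> R) (b : R) : bm g -> (forall x, D x -> `|g x| <= b) ->
    `|I (fun x => w x * g x)| <= ell * b.
  move=> bg gb; apply: (le_trans (Rint_norm mD muD (bmeasM bw bg))).
  rewrite [leRHS]mulrC -(RintZ mD muD _ bw).
  apply: (le_Rint mD muD); [exact/bmeas_norm/bmeasM|exact: bmeasZ|].
  by move=> x Dx; rewrite normrM (ger0_norm (w0 x)) mulrC ler_wpM2r// gb.
rewrite (le_trans (ler_normD _ _))// lerD//.
  rewrite (le_trans (ler_normD _ _))// lerD//; first exact: wb.
  by apply: wb => // x Dx; apply: mix => //; exact: bv_norm_visit_density.
rewrite normrM (ger0_norm hit_rate_ge0) ler_wpM2l ?hit_rate_ge0//.
apply: le_trans e2; rewrite distrC -(Rint_iter TM mass1 kernelC p (bm_density m j)).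
rewrite -(RintB mD muD bfp bi); exact: (Rint_norm mD muD).
Qed.

End estimate.
End visit_densities.

(** * The Poisson recursion *)
Section poisson.
Context (R : realType).
Implicit Types (s t : R) (j : nat).

Definition poisson_mass t j : R := t ^+ j * expR (- t) / j`!%:R.
Local Notation q := poisson_mass.

Lemma poisson_mass_ge0 t j : 0 <= t -> 0 <= q t j.
Proof. by move=> t0; rewrite divr_ge0 ?ler0n// mulr_ge0 ?expR_ge0// exprn_ge0. Qed.

Lemma poisson_mass_le1 t j : 0 <= t -> q t j <= 1.
Proof.
move=> t0; rewrite /q mulrAC expRN ler_pdivrMr ?expR_gt0// mul1r.
case: j => [|j]; first by rewrite expr0 fact0 divr1 -expR0 ler_expR.
by have := expR_ge1Dxn j t0; lra.
Qed.

(** The sum of independent Poisson variables is a Poisson variable. *)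
Lemma poisson_mass_add s t j :
  q (t + s) j = \sum_(i < j.+1) q t (j - i) * q s i.
Proof.
rewrite /q exprDn opprD expRD -mulrA mulr_suml; apply: eq_bigr => i _.
have ij : (i <= j)%N by rewrite -ltnS.
have fE : j`!%:R = 'C(j, i)%:R * (i`!%:R * (j - i)`!%:R) :> R.
  by rewrite -!natrM bin_fact.
have C0 : 'C(j, i)%:R != 0 :> R by rewrite pnatr_eq0 -lt0n bin_gt0.
have i0 : i`!%:R != 0 :> R by rewrite pnatr_eq0 -lt0n fact_gt0.
have ji0 : (j - i)`!%:R != 0 :> R by rewrite pnatr_eq0 -lt0n fact_gt0.
rewrite -mulr_natr fE; field; by rewrite C0 i0 ji0.
Qed.

Definition mass_one_less (F : nat -> R) j : R := if j is j'.+1 then F j' else 0.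

Lemma expRN_bounds s : 0 <= s -> 1 - s <= expR (- s) <= 1 - s + s ^+ 2.
Proof.
move=> s0; have e1 := expR_ge1Dx (- s); have e2 := expR_ge1Dx s.
rewrite e1/= expRN.
have s1 : 0 < 1 + s by rewrite ltr_pwDl.
apply: (@le_trans _ _ (1 + s)^-1); first by rewrite lef_pV2// posrE expR_gt0.
rewrite -div1r ler_pdivrMr//.
have -> : (1 - s + s ^+ 2) * (1 + s) = 1 + s ^+ 3 by ring.
by rewrite lerDl exprn_ge0.
Qed.

Lemma poisson_mass_small s i : 0 <= s <= 1 -> 0 <= q s i.+2 <= s ^+ 2.
Proof.
move=> /andP[s0 s1]; rewrite poisson_mass_ge0//= /q.
rewrite ler_pdivrMr ?ltr0n ?fact_gt0//.
apply: (@le_trans _ _ (s ^+ 2 * 1)).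
  apply: ler_pM; rewrite ?exprn_ge0 ?expR_ge0//.
    exact: ler_wiXn2l.
  by rewrite -expR0 ler_expR oppr_le0.
by rewrite ler_wpM2l ?exprn_ge0// ler1n fact_gt0.
Qed.

(** A Poisson variable of small parameter [s] is a Bernoulli variable up to
[s^2], and adding it to one of parameter [t] gives one of parameter [t + s]. *)
Lemma poisson_mass_step s t j : 0 <= s <= 1 -> 0 <= t ->
  `|q (t + s) j - ((1 - s) * q t j + s * mass_one_less (q t) j)| <= j.+2%:R * s ^+ 2.
Proof.
move=> s01 t0; have /andP[s0 s1] := s01; have /andP[e1 e2] := expRN_bounds s0.
have qq i : 0 <= q t i <= 1 by rewrite poisson_mass_ge0// poisson_mass_le1.
have q0 : q s 0 = expR (- s) by rewrite /q expr0 mul1r fact0 divr1.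
have ss : 0 <= s ^+ 2 by rewrite exprn_ge0.
rewrite poisson_mass_add big_ord_recl/= subn0 q0.
have T0 : `|q t j * (expR (- s) - 1 + s)| <= s ^+ 2.
  rewrite normrM; have /andP[a0 a1] := qq j.
  rewrite -[leRHS]mul1r ler_pM//; first by rewrite ger0_norm.
  by rewrite ger0_norm; lra.
case: j T0 => [|j] T0 /=.
  rewrite big_ord0 addr0 mulr0 addr0.
  have -> : q t 0 * expR (- s) - (1 - s) * q t 0 = q t 0 * (expR (- s) - 1 + s) by ring.
  by apply: (le_trans T0); rewrite ler_peMl// ler1n.
rewrite big_ord_recl/= /bump/= addn0 subSS subn0.
have q1 : q s 1 = s * expR (- s) by rewrite /q expr1 (_ : 1`! = 1)%N// divr1.
set S := \sum_(i < _) _.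
have S0 : `|S| <= j%:R * s ^+ 2.
  apply: (le_trans (ler_norm_sum _ _ _)).
  apply: (@le_trans _ _ (\sum_(i < j) s ^+ 2)); last by rewrite sumr_const card_ord mulr_natl.
  apply: ler_sum => i _; rewrite /bump/= !add1n.
  have /andP[a0 a1] := qq (j.+1 - i.+2)%N; have /andP[b0 b1] := poisson_mass_small i s01.
  rewrite ger0_norm; last exact: mulr_ge0.
  by rewrite -[leRHS]mul1r; apply: ler_pM.
have T1 : `|q t j * (s * expR (- s) - s)| <= s ^+ 2.
  rewrite normrM; have /andP[a0 a1] := qq j.
  rewrite -[leRHS]mul1r ler_pM//; first by rewrite ger0_norm.
  rewrite -[X in _ - X]mulr1 -mulrBr normrM (ger0_norm s0) expr2 ler_wpM2l//.
  by rewrite ler_norml; nra.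
have -> : q t j.+1 * expR (- s) + (q t j * q s 1 + S) -
    ((1 - s) * q t j.+1 + s * q t j) =
    q t j.+1 * (expR (- s) - 1 + s) + q t j * (s * expR (- s) - s) + S.
  by rewrite q1; ring.
have -> : j.+3%:R * s ^+ 2 = s ^+ 2 + s ^+ 2 + j%:R * s ^+ 2 + s ^+ 2.
  by rewrite -addn3 natrD; ring.
apply: (le_trans (ler_normD _ _)); rewrite -[leLHS]addr0 lerD// lerD//.
by apply: (le_trans (ler_normD _ _)); rewrite lerD.
Qed.

(** In the first [p] steps nothing is known of [hit] but [0 <= hit <= D], so
each of them costs at most [2 * D]. A later step costs [2 * e], once for the visit
that leaves the level [j] and once for the visit that enters it, and the defect of
the Poisson masses in their own recursion. *)
Lemma poisson_comparison (pi hit : nat -> nat -> R) (D e : R) (p K : nat) :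
  0 <= D <= 1 -> 0 <= e ->
  (forall j, pi 0%N j = (j == 0%N)%:R) ->
  (forall m j, pi m.+1 j = pi m j - hit m j + mass_one_less (hit m) j) ->
  (forall m j, 0 <= pi m j <= 1) ->
  (forall m j, 0 <= hit m j <= D) ->
  (forall m j, (p <= m)%N -> `|hit m j - D * pi m j| <= e) ->
  forall m j, (j <= K)%N ->
  `|pi m j - q (m%:R * D) j| <= 2 * p%:R * D + m%:R * (2 * e + K.+2%:R * D ^+ 2).
Proof.
move=> /andP[D0 D1] e0 pi0 piS pi01 hitD hite m.
(* The first [p] steps are charged as they come, so that the induction starts
   with no error. *)
pose er (m : nat) := 2 * (minn m p)%:R * D + m%:R * (2 * e + K.+2%:R * D ^+ 2).
suff H : forall j, (j <= K)%N -> `|pi m j - q (m%:R * D) j| <= er m.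
  move=> j jK; apply: (le_trans (H j jK)); rewrite /er lerD2r ler_wpM2r//.
  by rewrite ler_wpM2l// ler_nat geq_minr.
have K0 : 0 <= K.+2%:R * D ^+ 2 by rewrite mulr_ge0 ?exprn_ge0.
have er0 i : 0 <= er i.
  by rewrite addr_ge0// mulr_ge0 ?mulr_ge0// addr_ge0 ?mulr_ge0.
elim: m => [|m IH] j jK.
  rewrite mul0r pi0 /q expr0n oppr0 expR0 mulr1.
  by case: j jK => [|j] _ /=; rewrite ?fact0 ?divr1 ?mul0r subrr normr0.
pose c := if (m < p)%N then D else e.
have hc i : `|hit m i - D * pi m i| <= c.
  rewrite /c; case: ltnP => mp; last exact: hite.
  have /andP[a0 a1] := hitD m i; have /andP[b0 b1] := pi01 m i.
  by rewrite ler_norml; nra.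
have c0 : 0 <= c by rewrite /c; case: ifP.
have hcp i : `|mass_one_less (hit m) i - D * mass_one_less (pi m) i| <= c.
  by case: i => [|i] /=; rewrite ?mulr0 ?subrr ?normr0.
have IHp : `|mass_one_less (pi m) j - mass_one_less (q (m%:R * D)) j| <= er m.
  case: j jK => [|i] jK /=; first by rewrite subrr normr0.
  by apply: IH; exact: ltnW.
have tD : 0 <= m%:R * D by rewrite mulr_ge0.
have D01 : 0 <= D <= 1 by rewrite D0.
have st := poisson_mass_step j D01 tD.
have erS : er m + 2 * c + K.+2%:R * D ^+ 2 <= er m.+1.
  rewrite /er /c -[m.+1%:R]natr1; case: ltnP => mp.
    rewrite (minn_idPl mp) -natr1; nra.
  by rewrite (minn_idPr (leqW mp)); nra.
apply: le_trans erS.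
have -> : m.+1%:R * D = m%:R * D + D by rewrite -natr1; ring.
rewrite piS.
have hj := hc j; have hpj := hcp j; have IHj := IH j jK.
have jK2 : j.+2%:R * D ^+ 2 <= K.+2%:R * D ^+ 2 by rewrite ler_wpM2r ?exprn_ge0// ler_nat.
have st' := le_trans st jK2.
set A := pi m j in IHj hj *; set A' := mass_one_less (pi m) j in hpj IHp *.
set B := q _ j in IHj st' *; set B' := mass_one_less (q _) j in IHp st' *.
set N := q _ j in st' *.
have -> : A - hit m j + mass_one_less (hit m) j - N =
  (1 - D) * (A - B) + D * (A' - B') - (hit m j - D * A) +
  (mass_one_less (hit m) j - D * A') - (N - ((1 - D) * B + D * B')) by ring.
apply: (le_trans (ler_normB _ _)); apply: lerD => //.
have -> : er m + 2 * c = (1 - D) * er m + D * er m + c + c by ring.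
apply: (le_trans (ler_normD _ _)); apply: lerD => //.
apply: (le_trans (ler_normB _ _)); apply: lerD => //.
apply: (le_trans (ler_normD _ _)); apply: lerD; rewrite normrM ger0_norm ?subr_ge0//.
  by rewrite ler_wpM2l ?subr_ge0.
by rewrite ler_wpM2l.
Qed.

Lemma poisson_mass_continuous j : continuous (q ^~ j).
Proof.
move=> t; rewrite /q; apply: cvgMl; apply: cvgM; first exact: exprn_continuous.
by apply: (continuous_comp _ _); [exact: opp_continuous|exact: continuous_expR].
Qed.

End poisson.

(** * Past and future of a sequence of independent variables *)
Section density.
Local Open Scope ereal_scope.
Context d (T : measurableType d) (R : realType).
Variables (nu : {finite_measure set T -> \bar R}) (mu : {sigma_finite_measure set T -> \bar R}).

(** A density is almost everywhere the Radon-Nikodym derivative. *)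
Lemma integral_density (f g : T -> \bar R) :
  mu.-integrable setT f -> (forall E, measurable E -> nu E = \int[mu]_(x in E) f x) ->
  nu.-integrable setT g -> \int[nu]_x g x = \int[mu]_x (g x * f x).
Proof.
move=> fi nuf gi.
have numu : nu `<< mu.
  apply/null_content_dominatesP => A mA muA0; rewrite nuf//.
  apply: null_set_integral => //.
  exact: measurable_funTS (measurable_int mu fi).
rewrite -(Radon_Nikodym_change_of_variables numu)//=.
apply: ae_eq_integral => //.
- apply: emeasurable_funM; first exact: (measurable_int nu gi).
  by apply: (measurable_int mu); exact: Radon_Nikodym_integrable.
- apply: emeasurable_funM; first exact: (measurable_int nu gi).
  exact: (measurable_int mu fi).
apply: ae_eqe_mul2l => /=.
rewrite Radon_NikodymE//=.
case: cid => /= k [k1 k2 k3].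
apply: integral_ae_eq => //=.
- exact: (measurable_int mu fi).
- by move=> E _ mE; rewrite -k3 //; exact: nuf.
Qed.

End density.

Section cut_law.
Context d d' (Om : measurableType d) (T : measurableType d') (R : realType).
Variables (P : probability Om R) (A : set Om) (mA : measurable A).
Variables (U : Om -> T) (mU : measurable_fun setT U).

(** The law of [U] on the event [A], a finite measure. The two proofs are
arguments of the definition so that the measure structure can be attached to it. *)
Definition cut_law of measurable A & measurable_fun setT U :=
  fun D : set T => P (A `&` U @^-1` D).
Local Notation law := (cut_law mA mU).

Let mpre D : measurable D -> measurable (A `&` U @^-1` D).
Proof. by move=> mD; apply: measurableI => //; rewrite -[X in measurable X]setTI; exact: mU. Qed.

Let cut_law0 : law set0 = 0%E.
Proof. by rewrite /cut_law preimage_set0 setI0 measure0. Qed.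

Let cut_law_ge0 D : (0 <= law D)%E.
Proof. exact: measure_ge0. Qed.

Let cut_law_sigma_additive : semi_sigma_additive law.
Proof.
move=> F mF tF mUF; rewrite /cut_law preimage_bigcup setI_bigcupr.
apply: measure_semi_sigma_additive.
- by move=> n; exact: mpre.
- apply: trivIset_setIl; apply/trivIsetP => /= i j _ _ ij; rewrite -preimage_setI.
  by move/trivIsetP : tF => /(_ _ _ _ _ ij) ->//; rewrite preimage_set0.
- by rewrite -setI_bigcupr -preimage_bigcup; exact: mpre.
Qed.

HB.instance Definition _ := isMeasure.Build _ _ _ law
  cut_law0 cut_law_ge0 cut_law_sigma_additive.

Let cut_law_fin : fin_num_fun law.
Proof. by move=> D mD; rewrite /cut_law fin_num_measure//; exact: mpre. Qed.

HB.instance Definition _ := Measure_isFinite.Build _ _ _ law cut_law_fin.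

End cut_law.

Section future.
Context d (Om : measurableType d) (R : realType) (P : probability Om R).
Variable Y : nat -> {RV P >-> R}.

Definition future N l (F : nat -> set R) : set Om :=
  [set w | forall n, (n < l)%N -> F n (Y (N + n) w)].

Lemma measurable_pre (U : Om -> R) D : measurable_fun setT U -> measurable D ->
  measurable (U @^-1` D).
Proof. by move=> mU mD; rewrite -[X in measurable X]setTI; exact: mU. Qed.

Lemma futureS N l F :
  future N l.+1 F = Y N @^-1` F 0%N `&` future N.+1 l (fun n => F n.+1).
Proof.
apply/seteqP; split=> w /=.
  move=> H; split; first by have := H 0%N erefl; rewrite addn0.
  by move=> n nl; have := H n.+1 nl; rewrite addnS addSn.
by move=> [H0 H] [|n] nl; [rewrite addn0|rewrite addnS -addSn; exact: H].
Qed.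

Lemma future0 N F : future N 0 F = setT.
Proof. by apply/seteqP. Qed.

Lemma measurable_future N l F : (forall n, measurable (F n)) -> measurable (future N l F).
Proof.
elim: l N F => [|l IH] N F mF; first by rewrite future0.
by rewrite futureS; apply: measurableI; [exact: measurable_pre|exact: IH].
Qed.

(** Independence of the pair formed by the event [A] and the variable [U] from
all [Y n] with [N <= n]. This is all that has to be known of the past. *)
Definition future_independent (A : set Om) (U : Om -> R) N :=
  forall D F l, measurable D -> (forall n, measurable (F n)) ->
  P (A `&` U @^-1` D `&` future N l F) =
  (P (A `&` U @^-1` D) * \prod_(n < l) P (Y (N + n) @^-1` F n))%E.

Lemma future_independentU A A' U N : measurable A -> measurable A' ->
  measurable_fun setT U -> A `&` A' = set0 ->
  future_independent A U N -> future_independent A' U N ->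
  future_independent (A `|` A') U N.
Proof.
move=> mA mA' mU AA' iA iA' D F l mD mF.
have mUD := measurable_pre mU mD; have mFu := measurable_future N l mF.
have disj (X : set Om) : A `&` X `&` (A' `&` X) = set0.
  by apply/seteqP; split=> // w [[Aw _] [A'w _]]; rewrite -AA'.
have sum (X : set Om) : measurable X ->
    P ((A `|` A') `&` X) = (P (A `&` X) + P (A' `&` X))%E.
  by move=> mX; rewrite setIUl measureU//; exact: measurableI.
rewrite -!setIA !sum//; last exact: measurableI.
by rewrite !setIA iA// iA'// ge0_muleDl.
Qed.

Section step.
Variables (A : set Om) (U : Om -> R) (N : nat).
Hypotheses (mA : measurable A) (mU : measurable_fun setT U).
Hypothesis iA : future_independent A U N.

Local Notation pair := (fun w => (U w, Y N w)).
Let mpair : measurable_fun setT pair.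
Proof. exact: measurable_fun_pair. Qed.

Local Notation law := (distribution P (Y N)).

(** On the event [A], and whatever happens after time [N], the law of the pair
is a multiple of a product measure: both measures agree on rectangles, and
rectangles determine the measure. *)
Lemma joint_law_future (X : set (R * R)) F l : measurable X ->
  (forall n, measurable (F n)) ->
  P (A `&` pair @^-1` X `&` future N.+1 l F) =
  ((\int[cut_law P mA mU]_u law (xsection X u)) *
    \prod_(n < l) P (Y (N.+1 + n) @^-1` F n))%E.
Proof.
move=> mX mF; set Fu := future N.+1 l F; set c := (\prod_(n < l) _)%E.
have mFu : measurable Fu by exact: measurable_future.
have mAF : measurable (A `&` Fu) by exact: measurableI.
have c0 : (0 <= c)%E by apply: prode_ge0.
have cfin : c \is a fin_num by rewrite /c; apply: prode_fin_num => n _;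
  rewrite fin_num_measure//; exact: measurable_pre.
have iF D1 D2 : measurable D1 -> measurable D2 ->
    P (A `&` Fu `&` U @^-1` D1 `&` Y N @^-1` D2) =
    (P (A `&` U @^-1` D1) * law D2 * c)%E.
  move=> mD1 mD2; (* The event on [Y N] is the first one of a longer future. *)
  pose F' n := if n is n'.+1 then F n' else D2.
  have := @iA D1 F' l.+1 mD1; rewrite futureS/= big_ord_recl/= addn0 => H.
  rewrite -muleA -[law D2]/(P (Y N @^-1` D2)).
  have -> : c = (\prod_(i < l) P (Y (N + lift ord0 i) @^-1` F i))%E.
    by apply: eq_bigr => i _; rewrite /= /bump/= addnA addn1.
  rewrite -H; last by case.
  by congr (P _); rewrite /Fu; apply/seteqP; split=> w /=; tauto.
have iF1 D1 : measurable D1 ->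
    P (A `&` Fu `&` U @^-1` D1) = (P (A `&` U @^-1` D1) * c)%E.
  move=> mD1; have := iF D1 setT mD1 measurableT.
  have lawT : law setT = 1%E by exact: probability_setT.
  by rewrite preimage_setT setIT lawT mule1.
have -> : P (A `&` pair @^-1` X `&` Fu) = cut_law P mAF mpair X.
  by rewrite /cut_law; congr (P _); apply/seteqP; split=> w /=; tauto.
rewrite -(@product_measure_unique _ _ _ _ _ (cut_law P mAF mU) law)//; last first.
  move=> D1 D2 mD1 mD2; rewrite /= /cut_law iF1//.
  transitivity (P (A `&` Fu `&` U @^-1` D1 `&` Y N @^-1` D2)).
    by congr (P _); apply/seteqP; split=> w /=; tauto.
  by rewrite iF// muleAC.
rewrite /product_measure1/=.
pose cr := NngNum (fine_ge0 c0).
rewrite (eq_measure_integral (mscale cr (cut_law P mA mU))); last first.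
  by move=> D mD _; rewrite /= /mscale/= fineK// muleC; exact: iF1.
rewrite ge0_integral_mscale//.
  by rewrite /= fineK// muleC.
by have := measurable_fun_xsection law mX.
Qed.

Lemma joint_law (X : set (R * R)) : measurable X ->
  P (A `&` pair @^-1` X) = (\int[cut_law P mA mU]_u law (xsection X u))%E.
Proof.
move=> mX; have := @joint_law_future X (fun=> setT) 0 mX (fun=> measurableT).
by rewrite future0 setIT big_ord0 mule1.
Qed.

Lemma future_independent_step (X : set (R * R)) (phi : R * R -> R) :
  measurable X -> measurable_fun setT phi ->
  future_independent (A `&` pair @^-1` X) (phi \o pair) N.+1.
Proof.
move=> mX mphi D F l mD mF.
have mXD : measurable (X `&` phi @^-1` D).
  by apply: measurableI => //; rewrite -[X in measurable X]setTI; exact: mphi.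
have -> : A `&` pair @^-1` X `&` (phi \o pair) @^-1` D = A `&` pair @^-1` (X `&` phi @^-1` D).
  by apply/seteqP; split=> w /=; tauto.
by rewrite joint_law_future// joint_law.
Qed.

End step.
End future.

(** * The probability of a number of visits *)
(** The order in which the process reads its coordinates: initial point,
[eps_0], [eta_0], [eps_1], [eta_1], and so on. The position at time [m] depends on
the ranks up to [2 * m], and its observation on the rank [2 * m + 1] besides. *)
Definition coordinate_of_rank (n : nat) : option (nat + nat) :=
  if n is n'.+1 then Some (if odd n' then inl n'./2 else inr n'./2) else None.

Definition rank_of_coordinate (i : option (nat + nat)) : nat :=
  match i with
  | None => 0
  | Some (inr k) => k.*2.+1
  | Some (inl k) => k.*2.+2
  end.

Lemma coordinate_of_rankK : cancel coordinate_of_rank rank_of_coordinate.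
Proof.
move=> [//|n] /=; have := odd_double_half n.
by case: (odd n) => /=; [rewrite add1n => ->|rewrite add0n => ->].
Qed.

Lemma measurable_indicator_bound (R : realType) (q : R -> R) (D : set R) :
  measurable_fun setT q -> (forall x, 0 <= q x <= 1) -> bmeas D q.
Proof.
move=> mq q01; split=> //; exists 1 => x _; have /andP[? ?] := q01 x.
by rewrite ger0_norm.
Qed.

Section hit_probability.
Context (R : realType) (psi : probability (measurableTypeR R) R) (B : set R).
Hypothesis mB : measurable B.

Definition hit_prob (x : R) : R := fine (psi [set e | B (x + e)]).

Lemma measurable_shift_pairs : measurable [set p : R * R | B (p.1 + p.2)].
Proof.
rewrite -[X in measurable X]setTI;
  apply: (_ : measurable_fun setT (fun p : R * R => p.1 + p.2)) => //.
exact: measurable_funD.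
Qed.

Lemma measurable_shift x : measurable [set e | B (x + e)].
Proof.
rewrite -[X in measurable X]setTI; apply: (_ : measurable_fun setT (fun e : R => x + e)) => //.
exact: measurable_funD.
Qed.

Lemma EFin_hit_prob x : (hit_prob x)%:E = psi [set e | B (x + e)].
Proof. by rewrite /hit_prob fineK// fin_num_measure//; exact: measurable_shift. Qed.

Lemma hit_prob01 x : 0 <= hit_prob x <= 1.
Proof. by rewrite -!lee_fin EFin_hit_prob measure_ge0 probability_le1//;
  exact: measurable_shift. Qed.

Lemma measurable_hit_prob : measurable_fun setT hit_prob.
Proof.
apply: measurableT_comp; first exact: fine_measurable.
have := measurable_fun_xsection psi measurable_shift_pairs.
congr (measurable_fun _ _); apply/funext => x /=; congr (psi _).
by apply/seteqP; split=> e; rewrite /xsection/= inE.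
Qed.

Lemma bmeas_hit_prob D : bmeas D hit_prob.
Proof. exact: (measurable_indicator_bound D measurable_hit_prob hit_prob01). Qed.

End hit_probability.

Lemma measurable_noisy_step (R : realType) (M : noisy_map R) : assumption_TM M ->
  measurable_fun setT (fun p : R * R => noisy_step M p.2 p.1).
Proof.
move=> TM; apply: measurable_funD.
  exact: (measurableT_comp (tm_measurable TM) measurable_fst).
apply: measurable_funM; last exact: measurable_snd.
apply: (@measurableT_comp _ _ _ _ _ _ (nm_sigma M)); last exact: measurable_fst.
apply: continuous_measurable_fun => z; apply: differentiable_continuous.
by apply/derivable1_diffP; exact: (tm_sigma_derivable TM).
Qed.

Section counting_process.
Context (R : realType) (M : noisy_map R).
Local Notation leb := (@lebesgue_measure R).
Local Notation Dm := (dom M).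
Local Notation k := (Defs.kernel M).
Local Notation I f := (\int[leb]_(x in Dm) f x).
Local Notation bm := (bmeas Dm).
Local Notation L := (transfer M).
Hypothesis TM : assumption_TM M.
Hypothesis mass1 : noise_law M setT = 1%E.
Variable C : R.
Hypothesis kernelC : forall x z, Dm x -> k x z <= C.
Let mD : measurable (Dm : set (measurableTypeR R)) := measurable_dom M.
Let muD : ((leb : {sigma_finite_measure set (measurableTypeR R) -> \bar R}) Dm < +oo)%E
  := leb_dom_fin TM.

Context d (Om : measurableType d) (P : probability Om R).
Variables (x0 : {RV P >-> R}) (eta eps : nat -> {RV P >-> R}).
Variables (psi : probability (measurableTypeR R) R) (B : set R).
Hypothesis mB : measurable B.
Hypothesis indep : mutually_independent (driving_family x0 eta eps).
Hypothesis law_eta : forall n A, measurable A -> distribution P (eta n) A = noise_law M A.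
Hypothesis law_eps : forall n A, measurable A -> distribution P (eps n) A = psi A.

Definition driving (n : nat) : {RV P >-> R} :=
  driving_family x0 eta eps (coordinate_of_rank n).
Local Notation Y := driving.
Local Notation w := (hit_prob psi B).

Lemma driving_eps m : Y m.*2.+1 = eps m.
Proof. by rewrite /driving/= odd_double doubleK. Qed.

Lemma driving_eta m : Y m.*2.+2 = eta m.
Proof. by rewrite /driving/= odd_double/= uphalf_double. Qed.

Lemma future_independent_start : future_independent Y setT x0 1.
Proof.
move=> D F l mDD mF.
pose A i := if rank_of_coordinate i is n.+1 then F n else D.
have := @indep (map coordinate_of_rank (iota 0 l.+1)) A.
rewrite map_inj_uniq ?iota_uniq; last exact: can_inj coordinate_of_rankK.
move=> /(_ erefl); rewrite big_map => H.
have {}H : P [set w | forall i, i \in map coordinate_of_rank (iota 0 l.+1) ->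
      A i (driving_family x0 eta eps i w)] =
    (\prod_(i <- iota 0 l.+1) P (Y i @^-1` A (coordinate_of_rank i)))%E.
  by rewrite H// => i; rewrite /A; case: (rank_of_coordinate i).
have memE i : i \in map coordinate_of_rank (iota 0 l.+1) ->
    exists2 n, (n < l.+1)%N & i = coordinate_of_rank n.
  by move=> /seq.mapP[n]; rewrite mem_iota add0n => /andP[_ nl] ->; exists n.
have memI n : (n < l.+1)%N ->
    coordinate_of_rank n \in map coordinate_of_rank (iota 0 l.+1).
  by move=> nl; apply/seq.mapP; exists n => //; rewrite mem_iota.
set s := map _ _ in H memE memI *.
have -> : setT `&` x0 @^-1` D `&` future Y 1 l F = [set w | forall i, i \in s ->
  A i (driving_family x0 eta eps i w)].
  apply/seteqP; split=> om /=.
    move=> [[_ Dx] Fu] i /memE[[|n] nl ->]; first exact: Dx.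
    by rewrite /A coordinate_of_rankK; exact: Fu.
  move=> H'; split; first by split=> //; exact: (H' None (memI 0%N erefl)).
  by move=> n nl; have := H' _ (memI n.+1 nl); rewrite /A coordinate_of_rankK.
rewrite H setTI -[iota _ _]/(index_iota 0 l.+1) big_mkord big_ord_recl; congr (_ * _)%E.
by apply: eq_bigr => n _; rewrite /A coordinate_of_rankK.
Qed.

Section one_step.
Variables (A : set Om) (U : Om -> R) (N : nat) (g : R -> R).
Hypotheses (mA : measurable A) (mU : measurable_fun setT U).
Hypothesis iA : future_independent Y A U N.
Hypothesis bg : bm g.

Definition has_density (A : set Om) (U : Om -> R) (g : R -> R) := forall D, measurable D ->
  P (A `&` U @^-1` D) = (I (fun x => g x * \1_D x))%:E.

Hypothesis dA : has_density A U g.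

Lemma integral_cut_law (q : R -> R) : measurable_fun setT q -> (forall x, 0 <= q x <= 1) ->
  (\int[cut_law P mA mU]_u (q u)%:E = (I (fun x => g x * q x))%:E)%E.
Proof.
move=> mq q01.
have bq : bm q by exact: measurable_indicator_bound.
pose f x : \bar R := (g x * \1_Dm x)%:E.
have intf E : measurable E -> (\int[leb]_(x in E) f x)%E = (I (fun x => g x * \1_E x))%:E.
  move=> mE; rewrite (EFin_Rint mD muD); last by apply: bmeasM => //; exact: bmeas_indic.
  rewrite [LHS]integral_mkcond [RHS]integral_mkcond; apply: eq_integral => x _.
  rewrite !patchE /f !indicE; case: (x \in E); case: (x \in Dm); rewrite ?mulr1 ?mulr0//.
have fi : (leb : {sigma_finite_measure set (measurableTypeR R) -> \bar R}).-integrable setT f.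
  have := bmeas_integrable mD muD bg.
  move/(integrable_mkcond _ mD); apply: eq_integrable => // x _.
  by rewrite patchE /f indicE /=; case: ifP; rewrite ?mulr1 ?mulr0.
have mU' : measurable_fun setT (U : Om -> measurableTypeR R) by exact: mU.
pose idR : measurableTypeR R -> R := id.
have mid : measurable_fun setT idR by move=> _ E mE; rewrite setTI.
(* The real line carries two structures of Borel sets, that of the random
   variables and that of the Lebesgue measure; the image under the identity
   passes from one to the other. *)
pose nu : {measure set R -> \bar R} := pushforward (cut_law P mA mU') idR.
rewrite (eq_measure_integral (nu mid)); last by [].
rewrite (ge0_integral_pushforward mid)//; last 2 first.
- exact/measurable_EFinP.
- by move=> x _; rewrite lee_fin; have /andP[] := q01 x.
rewrite preimage_setT.
have intA E : measurable E -> cut_law P mA mU' E = (\int[leb]_(x in E) f x)%E.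
  by move=> mE; rewrite intf//; exact: dA.
apply: (eq_trans (@integral_density _ (measurableTypeR R) R (cut_law P mA mU') leb f (EFin \o q)
  fi intA _)).
  apply: (@le_integrable _ _ _ _ _ _ _ (cst 1%E)) => //.
  - exact/measurable_EFinP.
  - by move=> x _; rewrite /= lee_fin normr1 ger0_norm; have /andP[] := q01 x.
  - by have := finite_measure_integrable_cst (cut_law P mA mU') 1 measurableT.
rewrite (EFin_Rint mD muD); last exact: bmeasM.
rewrite [RHS]integral_mkcond; apply: eq_integral => x _.
by rewrite patchE /f indicE /= -EFinM mulrCA mulrA; case: ifP; rewrite ?mulr1 ?mulr0.
Qed.

(** Given the position, the event [X] depends only on the fresh coordinate
[Y N], so its conditional probability multiplies the density. *)
Lemma density_restrict (X : set (R * R)) (q : R -> R) : measurable X ->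
  measurable_fun setT q -> (forall x, 0 <= q x <= 1) ->
  (forall u, distribution P (Y N) (xsection X u) = (q u)%:E) ->
  has_density (A `&` (fun om => (U om, Y N om)) @^-1` X) U (fun x => q x * g x).
Proof.
move=> mX mq q01 qX D mDD.
have mXD : measurable (X `&` fst @^-1` D).
  by apply: measurableI => //; rewrite -[X in measurable X]setTI; exact: measurable_fst.
have -> : A `&` (fun om => (U om, Y N om)) @^-1` X `&` U @^-1` D =
   A `&` (fun om => (U om, Y N om)) @^-1` (X `&` fst @^-1` D).
  by apply/seteqP; split=> om /=; tauto.
rewrite (joint_law mA mU iA mXD).
rewrite (eq_integral (fun u => (q u * \1_D u)%:E)); last first.
  move=> u _; rewrite indicE; case: (boolP (u \in D)) => [/set_mem Du|uD].
    rewrite mulr1 -qX; congr (distribution _ _ _); apply/seteqP; split=> y;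
      rewrite /xsection/= !inE/=; by [case|split].
  rewrite mulr0 (_ : xsection _ _ = set0) ?measure0//.
  apply/seteqP; split=> y //; rewrite /xsection/= inE => -[_ /= Du].
  by move: uD; rewrite notin_setE.
rewrite integral_cut_law.
- by congr EFin; apply: eq_Rintegral => x _; rewrite mulrA [g x * _]mulrC.
- by apply: measurable_funM => //; exact: measurable_indic.
- move=> x; have /andP[q0 q1] := q01 x; rewrite mulr_ge0 ?indicE ?ler0n//=.
  by case: (x \in D); rewrite ?mulr1 ?mulr0.
Qed.

(** The transfer operator is dual to the noisy step, and the fresh noise is
independent of the position and of the event. *)
Lemma density_noisy_step : (forall D, measurable D -> distribution P (Y N) D = noise_law M D) ->
  has_density A (fun om => noisy_step M (Y N om) (U om)) (L g).
Proof.
move=> lawY D mDD.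
pose X := [set p : R * R | D (noisy_step M p.2 p.1)].
have mstep : measurable_fun setT (fun p : R * R => noisy_step M p.2 p.1).
  exact: measurable_noisy_step TM.
have mX : measurable X by rewrite -[X]setTI; exact: mstep.
pose q u := fine (distribution P (Y N) (xsection X u)).
have mXu u : measurable (xsection X u) by exact: measurable_xsection.
have qE u : (q u)%:E = distribution P (Y N) (xsection X u).
  by rewrite /q fineK// fin_num_measure.
have mq : measurable_fun setT q.
  apply: measurableT_comp; first exact: fine_measurable.
  exact: measurable_fun_xsection.
have q01 u : 0 <= q u <= 1 by rewrite -!lee_fin qE measure_ge0 probability_le1.
transitivity (P (A `&` (fun om => (U om, Y N om)) @^-1` X)); first by [].
rewrite (joint_law mA mU iA mX) (eq_integral (fun u => (q u)%:E)); last by move=> u _; rewrite qE.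
rewrite integral_cut_law//; congr EFin.
have bD : bm (\1_D : R -> R) by exact: (bmeas_indic R Dm mDD).
have -> : I (fun x => L g x * \1_D x) = I (fun z => \1_D z * L g z).
  by apply: eq_Rintegral => z _; rewrite mulrC.
rewrite (Rint_transferM TM kernelC bg bD).
apply: eq_Rintegral => x /set_mem Dx; congr (_ * _).
apply: EFin_inj; rewrite qE (EFin_Rint mD muD); last by apply: bmeasM => //;
  exact: (bmeas_kernel_r TM kernelC).
rewrite (_ : xsection X x = [set y | D (noisy_step M y x)]); last first.
  by apply/seteqP; split=> y; rewrite /xsection/= inE.
have mDs : measurable [set y | D (noisy_step M y x)].
  by have := mXu x; rewrite (_ : xsection X x = [set y | D (noisy_step M y x)])//;
     apply/seteqP; split=> y; rewrite /xsection/= inE.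
rewrite lawY// (noise_law_dom TM Dx mDD) (noise_lawE TM mass1 kernelC Dx); last first.
  by apply: measurableI => //; exact: measurable_dom.
rewrite [LHS]integral_mkcond [RHS]integral_mkcond; apply: eq_integral => z _.
rewrite !patchE in_setI indicE; case: (z \in D); case: (z \in Dm); rewrite ?mul1r ?mul0r//.
Qed.

End one_step.

Definition orbit m om := noisy_iter M (fun j => eta j om) m (x0 om).
Definition hit m := [set om | B (orbit m om + eps m om)].

(** The same recursion in time as for [visit_density], so that the two can be
matched by induction. *)
Fixpoint visits (m j : nat) : set Om :=
  if m is m'.+1 then
    (visits m' j `&` ~` hit m') `|`
    ((if j is j'.+1 then visits m' j' else set0) `&` hit m')
  else if j is 0%N then setT else set0.

Lemma measurable_orbit m : measurable_fun setT (orbit m).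
Proof.
elim: m => [|m IH]; first exact: measurable_funP.
have := measurableT_comp (measurable_noisy_step TM) (measurable_fun_pair IH (measurable_funP
  (eta m))).
by [].
Qed.

Lemma measurable_hit m : measurable (hit m).
Proof.
rewrite -[hit m]setTI.
apply: (_ : measurable_fun setT (fun om => orbit m om + eps m om)) => //.
by apply: measurable_funD; [exact: measurable_orbit|exact: measurable_funP].
Qed.

Lemma measurable_visits m j : measurable (visits m j).
Proof.
elim: m j => [|m IH] j /=; first by case: j.
apply: measurableU; apply: measurableI => //.
- by apply: measurableC; exact: measurable_hit.
- by case: j.
- exact: measurable_hit.
Qed.

Variable h : R -> R.
Hypothesis bh : bm h.
Hypothesis law_x0 : has_density setT x0 h.

Lemma has_density0 U : has_density set0 U (cst 0).
Proof.
move=> D mDD; rewrite set0I measure0.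
under eq_Rintegral do rewrite mul0r.
by rewrite (Rintegral_cst _ mD) mul0r.
Qed.

Lemma future_independent0 U N : future_independent Y set0 U N.
Proof. by move=> D F l mDD mF; rewrite !set0I measure0 mul0e. Qed.

(** One unit of time reads two coordinates: the observational noise decides
whether the visit is counted, then the dynamical noise moves the point. The
independence of the remaining coordinates is carried along, as it is what allows
the next step. *)
Lemma visits_law m j :
  future_independent Y (visits m j) (orbit m) m.*2.+1 /\
  has_density (visits m j) (orbit m) (visit_density M h w m j).
Proof.
have bw : bm w by exact: bmeas_hit_prob.
have w01 : forall x, 0 <= w x <= 1 by move=> x; exact: hit_prob01.
have bvd i l : bm (visit_density M h w i l) by exact: (bmeas_visit_density TM kernelC bh bw).
elim: m j => [|m IH] j.
  case: j => [|j] /=; first by split=> //; exact: future_independent_start.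
  by split; [exact: future_independent0|exact: has_density0].
pose vp := if j is j'.+1 then visits m j' else set0.
have mvp : measurable vp by rewrite /vp; case: (j) => // i; exact: measurable_visits.
have IHp : future_independent Y vp (orbit m) m.*2.+1 /\
    has_density vp (orbit m) (one_less (visit_density M h w m) j).
  by rewrite /vp; case: (j) => [|i]; [split;
    [exact: future_independent0|exact: has_density0]|exact: IH].
have [iv dv] := IH j; have [ivp dvp] := IHp.
have mU := measurable_orbit m; have mv := measurable_visits m j.
pose X := [set p : R * R | B (p.1 + p.2)].
have mX : measurable X by exact: measurable_shift_pairs.
have hitE : hit m = (fun om => (orbit m om, Y m.*2.+1 om)) @^-1` X.
  by rewrite driving_eps.
have hitCE : ~` hit m = (fun om => (orbit m om, Y m.*2.+1 om)) @^-1` (~` X).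
  by rewrite hitE preimage_setC.
have mXC : measurable (~` X) by exact: measurableC.
have lawX u : distribution P (Y m.*2.+1) (xsection X u) = (w u)%:E.
  rewrite driving_eps law_eps; last exact: measurable_xsection.
  rewrite EFin_hit_prob//; congr (psi _).
  by apply/seteqP; split=> e; rewrite /xsection/= inE.
have lawXC u : distribution P (Y m.*2.+1) (xsection (~` X) u) = (1 - w u)%:E.
  have -> : xsection (~` X) u = ~` xsection X u.
    by apply/seteqP; split=> e; rewrite /xsection/= !inE.
  transitivity (1 - (w u)%:E)%E; last by [].
  by rewrite -lawX; apply: probability_setC; exact: measurable_xsection.
have w01' x : 0 <= 1 - w x <= 1 by have := w01 x; lra.
have mw : measurable_fun setT w by exact: measurable_hit_prob.
have mw' : measurable_fun setT (fun x => 1 - w x) by exact: measurable_funB.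
have d1 := density_restrict mvp mU ivp (bmeas_one_less _ (bvd m)) dvp mX mw w01 lawX.
have d0 := density_restrict mv mU iv (bvd m j) dv mXC mw' w01' lawXC.
have i1 := future_independent_step mvp mU ivp mX measurable_fst.
have i0 := future_independent_step mv mU iv mXC measurable_fst.
rewrite -hitE in d1 i1; rewrite -hitCE in d0 i0.
have mh := measurable_hit m.
have mA0 : measurable (visits m j `&` ~` hit m) by apply: measurableI => //; exact: measurableC.
have mA1 : measurable (vp `&` hit m) by exact: measurableI.
have disj : visits m j `&` ~` hit m `&` (vp `&` hit m) = set0.
  by apply/seteqP; split=> // om [[_ H] [_ H']].
have ivs : future_independent Y (visits m.+1 j) (orbit m) m.*2.+2.
  exact: (future_independentU mA0 mA1 mU disj i0 i1).
have bt : bm (visit_update w (visit_density M h w m) j) by exact: (bmeas_visit_update bw).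
have dvs : has_density (visits m.+1 j) (orbit m) (visit_update w (visit_density M h w m) j).
  move=> D mDD; have mUD := measurable_pre mU mDD.
  have -> : P (visits m.+1 j `&` orbit m @^-1` D) =
      (P (visits m j `&` ~` hit m `&` orbit m @^-1` D) + P (vp `&` hit m `&` orbit m @^-1` D))%E.
    rewrite /= setIUl measureU//; [exact: measurableI|exact: measurableI|].
    by apply/seteqP; split=> // om [[[_ H] _] [[_ H'] _]].
  rewrite d0// d1// -EFinD; congr EFin.
  have b1 : bm (\1_D : R -> R) by exact: (bmeas_indic R Dm mDD).
  have bo := bmeasB (bmeas_cst Dm 1) bw.
  rewrite -(RintD mD muD (bmeasM (bmeasM bo (bvd m j)) b1) (bmeasM (bmeasM bw (bmeas_one_less _
    (bvd m))) b1)).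
  by apply: eq_Rintegral => x _; rewrite /visit_update -mulrDl.
have mvs := measurable_visits m.+1 j.
split.
  rewrite doubleS.
  have := future_independent_step mvs mU ivs measurableT (measurable_noisy_step TM).
  by rewrite preimage_setT setIT driving_eta.
have := density_noisy_step mvs mU ivs bt dvs.
rewrite driving_eta; apply => D mDD; exact: law_eta.
Qed.

Lemma visits_mass m j : P (visits m j) = (I (visit_density M h w m j))%:E.
Proof.
have := (visits_law m j).2 setT measurableT; rewrite preimage_setT setIT => ->.
by congr EFin; apply: eq_Rintegral => x _; rewrite indicT mulr1.
Qed.

End counting_process.

(** * The perturbed operator and the return ratios *)
Section characteristic.
Local Open Scope complex_scope.
Context (R : realType) (psi : probability (measurableTypeR R) R) (B : set R).
Hypothesis mB : measurable B.
Variable lam : R.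
Local Notation w := (hit_prob psi B).

(** A function of an indicator is affine in it; hence the noise enters the
characteristic function only through the probability of a hit. *)
Lemma trig_indicator (b : bool) :
  cos (lam * b%:R) = 1 - (1 - cos lam) * b%:R /\ sin (lam * b%:R) = sin lam * b%:R.
Proof. by case: b; rewrite ?mulr1 ?mulr0 ?subrr ?cos0 ?sin0 ?subr0 ?opprB ?subrK// addrC subrK. Qed.

Let psT : (psi setT < +oo)%E. Proof. by rewrite probability_setT ltry. Qed.

Lemma indicator_law x :
  \int[psi]_e (\1_B (x + e)) = w x.
Proof.
rewrite /Rintegral /hit_prob; congr fine.
transitivity (\int[psi]_e (\1_[set e | B (x + e)] e)%:E)%E.
  by apply: eq_integral => e _; rewrite !indicE; congr (_%:R%:E); apply/idP/idP; rewrite !inE.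
by rewrite integral_indic ?setIT//; exact: measurable_shift.
Qed.

Lemma characteristic x :
  cintegral psi setT (fun e => expi (lam * \1_B (x + e))) =
  (1 - (1 - cos lam) * w x) +i* (sin lam * w x).
Proof.
have mT : measurable [set: measurableTypeR R] by [].
have bB : bmeas [set: measurableTypeR R] (fun e => \1_B (x + e) : R).
  have -> : (fun e => \1_B (x + e) : R) = \1_[set e | B (x + e)].
    by apply/funext => e; rewrite !indicE; congr (_%:R); apply/idP/idP; rewrite !inE.
  exact: (bmeas_indic R _ (measurable_shift mB x)).
rewrite /cintegral; congr (_ +i* _).
  transitivity (\int[psi]_e (1 - (1 - cos lam) * \1_B (x + e))).
    by apply: eq_Rintegral => e _ /=; rewrite indicE (trig_indicator _).1.
  rewrite (RintB mT psT (bmeas_cst _ 1) (bmeasZ _ bB)) (RintZ mT psT _ bB).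
  rewrite (Rintegral_cst psi mT) mul1r.
  congr (_ - _ * _); last exact: indicator_law.
  exact: (congr1 fine (probability_setT psi)).
transitivity (\int[psi]_e (sin lam * \1_B (x + e))).
  by apply: eq_Rintegral => e _ /=; rewrite indicE (trig_indicator _).2.
by rewrite (RintZ mT psT _ bB) indicator_law.
Qed.

End characteristic.

Section perturbation.
Local Open Scope complex_scope.
Context (R : realType) (M : noisy_map R).
Local Notation leb := (@lebesgue_measure R).
Local Notation D := (dom M).
Local Notation G := (Gamma M).
Local Notation k := (Defs.kernel M).
Local Notation I f := (\int[leb]_(x in D) f x).
Local Notation bm := (bmeas D).
Local Notation L := (transfer M).
Hypothesis TM : assumption_TM M.
Hypothesis mass1 : noise_law M setT = 1%E.
Variable C : R.
Hypothesis kernelC : forall x z, D x -> k x z <= C.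
Let mD : measurable (D : set (measurableTypeR R)) := measurable_dom M.
Let G0 : 0 < G := Gamma_gt0 TM.
Let muD : ((leb : {sigma_finite_measure set (measurableTypeR R) -> \bar R}) D < +oo)%E
  := leb_dom_fin TM.
Let C0 : 0 <= C := kernel_bound_ge0 TM kernelC.
Variables (psi : probability (measurableTypeR R) R) (B : nat -> set R) (n : nat).
Hypothesis mB : measurable (B n).
Local Notation w := (hit_prob psi (B n)).
Variables (h : R -> R) (lam : R).
Hypotheses (bh : bm h) (h0 : forall x, 0 <= h x).
Local Notation hC := (fun x => (h x)%:C).
Let ell := I w.
Let Dl := I (fun x => w x * h x).
Local Notation a := (1 - cos lam).
Local Notation s := (sin lam).

Let bw : bm w. Proof. exact: bmeas_hit_prob. Qed.
Let w01 x : 0 <= w x <= 1. Proof. exact: hit_prob01. Qed.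
Let w0 x : 0 <= w x. Proof. by have /andP[] := w01 x. Qed.

Lemma defect_bound_coefs : 0 <= a <= 2 /\ `|s| <= 1.
Proof.
split; last by rewrite ler_norml sin_geN1 sin_le1.
by have := cos_geN1 lam; have := cos_le1 lam; lra.
Qed.

(** The bound is on the real and imaginary parts, on which the operators act
through the real transfer operator. *)
Definition cbounded (f : R -> R[i]) b :=
  [/\ bm (fun x => complex.Re (f x)), bm (fun x => complex.Im (f x)) &
   forall x, D x -> `|complex.Re (f x)| <= b /\ `|complex.Im (f x)| <= b].

Lemma markov_parts f : Defs.markov M f =
  (fun z => L (fun x => complex.Re (f x)) z +i* L (fun x => complex.Im (f x)) z).
Proof.
apply/funext => z; rewrite /Defs.markov /cintegral; congr (_ +i* _);
  by apply: eq_Rintegral => x _; case: (f x) => u v /=; rewrite mulr0 ?subr0 ?add0r.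
Qed.

Let fre (f : R -> R[i]) x := complex.Re (f x) * (1 - a * w x) - complex.Im (f x) * (s * w x).
Let fim (f : R -> R[i]) x := complex.Re (f x) * (s * w x) + complex.Im (f x) * (1 - a * w x).

Lemma perturbed_parts f : perturbed M psi B lam n f = (fun z => L (fre f) z +i* L (fim f) z).
Proof.
rewrite /perturbed markov_parts; apply/funext => z.
congr (_ +i* _); apply: eq_Rintegral => x _; rewrite /= characteristic//;
  by rewrite /fre /fim; case: (f x).
Qed.

Let baw : bm (fun x => 1 - a * w x).
Proof. by apply: bmeasB; [exact: (bmeas_cst D 1)|exact: bmeasZ]. Qed.
Let bsw : bm (fun x => s * w x). Proof. exact: bmeasZ. Qed.

Lemma damping_bounds x : `|1 - a * w x| <= 1 /\ `|s * w x| <= 1.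
Proof.
have [/andP[a0 a2] s1] := defect_bound_coefs; have /andP[x0 x1] := w01 x.
split; first by rewrite ler_norml; nra.
by rewrite normrM -[leRHS]mulr1 ler_pM// ger0_norm.
Qed.

Lemma cbounded_perturbed f b : 0 <= b -> cbounded f b ->
  cbounded (perturbed M psi B lam n f) (C * (2 * b * (1 + G))).
Proof.
move=> b0 [br bi fb].
have bfre : bm (fre f) by apply: bmeasB; exact: bmeasM.
have bfim : bm (fim f) by apply: bmeasD; exact: bmeasM.
have bd (g : R -> R) z :
  bm g -> (forall x, D x -> `|g x| <= 2 * b) -> `|L g z| <= C * (2 * b * (1 + G)).
  move=> bg gb; apply: (le_trans (norm_transfer TM kernelC z bg)).
  apply: (le_trans (transfer_le TM kernelC z (bmeas_norm bg) _)); first by [].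
  rewrite ler_wpM2l// -(fine_leb_dom TM); apply: (le_Rint_cst mD muD) => //.
  exact: bmeas_norm.
rewrite perturbed_parts; split.
- exact: (bmeas_transfer TM kernelC bfre).
- exact: (bmeas_transfer TM kernelC bfim).
have two u v u' v' : `|u| <= b -> `|v| <= b -> `|u'| <= 1 -> `|v'| <= 1 ->
    `|u * u'| + `|v * v'| <= 2 * b.
  move=> ub vb u1 v1; rewrite !normrM.
  have -> : 2 * b = b * 1 + b * 1 by ring.
  by apply: lerD; apply: ler_pM.
move=> x Dx /=; split; apply: bd => // y Dy;
  have [d1 d2] := damping_bounds y; have [f1 f2] := fb y Dy.
- by rewrite /fre; apply: (le_trans (ler_normB _ _)); apply: two.
- by rewrite /fim; apply: (le_trans (ler_normD _ _)); apply: two.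
Qed.

Lemma cbounded_iter j f b : 0 <= b -> cbounded f b ->
  cbounded (iter j (perturbed M psi B lam n) f) ((C * (2 * (1 + G))) ^+ j * b).
Proof.
move=> b0 fb; elim: j => [|j IH]; first by rewrite expr0 mul1r.
have q0 : 0 <= (C * (2 * (1 + G))) ^+ j * b.
  by rewrite mulr_ge0// exprn_ge0// mulr_ge0// mulr_ge0//; have := G0; lra.
have := cbounded_perturbed q0 IH; rewrite iterS exprS.
by congr (cbounded _ _); ring.
Qed.

Let gre (f : R -> R[i]) x := complex.Re (f x) * (a * w x) + complex.Im (f x) * (s * w x).
Let gim (f : R -> R[i]) x := complex.Im (f x) * (a * w x) - complex.Re (f x) * (s * w x).

Let baw' : bm (fun x => a * w x). Proof. exact: bmeasZ. Qed.

Let bgre f b : cbounded f b -> bm (gre f).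
Proof. by move=> [br bi _]; apply: bmeasD; exact: bmeasM. Qed.

Let bgim f b : cbounded f b -> bm (gim f).
Proof. by move=> [br bi _]; apply: bmeasB; exact: bmeasM. Qed.

Lemma defect_parts f b : cbounded f b ->
  defect M psi B lam n f = (fun z => L (gre f) z +i* L (gim f) z).
Proof.
move=> [br bi fb]; apply/funext => z; rewrite /defect markov_parts perturbed_parts.
have bfre : bm (fre f) by apply: bmeasB; exact: bmeasM.
have bfim : bm (fim f) by apply: bmeasD; exact: bmeasM.
transitivity ((L (fun x => complex.Re (f x)) z - L (fre f) z) +i*
  (L (fun x => complex.Im (f x)) z - L (fim f) z)); first by [].
rewrite -(transferB TM kernelC z br bfre) -(transferB TM kernelC z bi bfim).
by congr (_ +i* _); apply: eq_Rintegral => x _; congr (_ * _); rewrite /fre /fim /gre /gim; ring.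
Qed.

Lemma cintegral_defect f b : cbounded f b ->
  cintegral leb D (defect M psi B lam n f) = I (gre f) +i* I (gim f).
Proof.
move=> fb; rewrite (defect_parts fb) /cintegral/=.
by rewrite !(Rint_transfer TM mass1 kernelC)//; [exact: bgim fb|exact: bgre fb].
Qed.

Let loss_bound (u v b x : R) : `|u| <= b -> `|v| <= b ->
  `|u * (a * w x)| + `|v * (s * w x)| <= 3 * b * w x.
Proof.
move=> ub vb; have [/andP[a0 a2] s1] := defect_bound_coefs.
have -> : 3 * b * w x = b * (2 * w x) + b * (1 * w x) by ring.
rewrite !normrM; apply: lerD; apply: ler_pM => //; rewrite ?mulr_ge0//.
  by rewrite (ger0_norm a0) (ger0_norm (w0 x)) ler_wpM2r.
by rewrite (ger0_norm (w0 x)) ler_wpM2r.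
Qed.

Lemma modulus_le (u v : R) : modulus (u +i* v) <= `|u| + `|v|.
Proof.
rewrite modulusE/= -[leRHS]ger0_norm ?addr_ge0// -sqrtr_sqr ler_wsqrtr//.
rewrite sqrrD !real_normK ?num_real// lerD2r lerDl mulrn_wge0// mulr_ge0//.
Qed.

(** The defect of [f] is the transfer of [f] times [(1 - e^(i lam)) w], whose
integral is controlled by that of [w]. The constants are the bounds [2] and [1]
for the parts of [1 - e^(i lam)], summed over both parts of the product. *)
Lemma modulus_cintegral_defect f b : cbounded f b ->
  modulus (cintegral leb D (defect M psi B lam n f)) <= 6 * b * ell.
Proof.
move=> fb; rewrite (cintegral_defect fb); apply: (le_trans (modulus_le _ _)).
have -> : 6 * b * ell = 3 * b * ell + 3 * b * ell by ring.
have bnd (g : R -> R) : bm g -> (forall x, D x -> `|g x| <= 3 * b * w x) -> `|I g| <= 3 * b * ell.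
  move=> bg gb; apply: (le_trans (Rint_norm mD muD bg)).
  rewrite -(RintZ mD muD _ bw); apply: (le_Rint mD muD) => //; first exact: bmeas_norm.
  exact: bmeasZ.
have [_ _ fb'] := fb.
apply: lerD; apply: bnd.
- exact: bgre fb.
- move=> x Dx; have [f1 f2] := fb' x Dx.
  by rewrite /gre; apply: (le_trans (ler_normD _ _)); exact: loss_bound.
- exact: bgim fb.
move=> x Dx; have [f1 f2] := fb' x Dx.
by rewrite /gim; apply: (le_trans (ler_normB _ _)); exact: loss_bound.
Qed.

Let cb_h : exists b, cbounded hC b.
Proof.
have [b b0 hb] := bmeas_ge0 bh; exists b; split; first exact: bh.
  exact: (bmeas_cst D 0).
by move=> x Dx /=; rewrite normr0 hb.
Qed.

Let bwh : bm (fun x => w x * h x). Proof. exact: bmeasM. Qed.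

Let gre_h : gre hC = (fun x => a * (w x * h x)).
Proof. by apply/funext => x; rewrite /gre/=; ring. Qed.

Let gim_h : gim hC = (fun x => - s * (w x * h x)).
Proof. by apply/funext => x; rewrite /gim/=; ring. Qed.

Lemma Delta'E : Delta' M psi h B lam n = (1 - expi lam) * Dl%:C.
Proof.
have [b hb] := cb_h; rewrite /Delta' (cintegral_defect hb) gre_h gim_h.
rewrite !(RintZ mD muD _ bwh) -/Dl /expi.
by apply/eqP; rewrite eq_complex/=; apply/andP; split; apply/eqP; ring.
Qed.

Lemma cbounded_defect_h : cbounded (defect M psi B lam n hC) (2 * C * Dl).
Proof.
have [b hb] := cb_h; rewrite (defect_parts hb); split.
- exact: (bmeas_transfer TM kernelC (bgre hb)).
- exact: (bmeas_transfer TM kernelC (bgim hb)).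
have [/andP[a0 a2] s1] := defect_bound_coefs.
have bnd (c x : R) : `|c| <= 2 -> `|L (fun x => c * (w x * h x)) x| <= 2 * C * Dl.
  move=> c2; have bc : bm (fun x => c * (w x * h x)) by exact: bmeasZ.
  apply: (le_trans (norm_transfer TM kernelC _ bc)).
  apply: (le_trans (transfer_le TM kernelC _ (bmeas_norm bc) _)); first by [].
  rewrite [2 * C]mulrC -mulrA ler_wpM2l// -(RintZ mD muD _ bwh).
  apply: (le_Rint mD muD); [exact: bmeas_norm|exact: bmeasZ|].
  by move=> y Dy; rewrite normrM (ger0_norm (_ : 0 <= w y * h y)) ?mulr_ge0// ler_wpM2r// mulr_ge0.
move=> x Dx /=; rewrite gre_h gim_h; split; apply: bnd; rewrite ?normrN; first by rewrite ger0_norm.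
by apply: (le_trans s1); rewrite ler1n.
Qed.

(** In the numerator the inner defect contributes a factor [Delta], by
[cbounded_defect_h], and the outer one a factor [ell]; the first cancels against
the denominator. *)
Lemma modulus_return_ratio j : 0 < Dl -> expi lam != 1 ->
  modulus (return_ratio M psi h B lam j n) <=
  12 * C * (C * (2 * (1 + G))) ^+ j / modulus (1 - expi lam) * ell.
Proof.
move=> D0 lam1; rewrite /return_ratio Delta'E.
have mM (x y : R[i]) : modulus (x * y) = modulus x * modulus y.
  by rewrite /modulus normrM; rewrite !normc_def/= mulr0 subr0.
have mV (x : R[i]) : modulus x^-1 = (modulus x)^-1.
  rewrite /modulus normfV normc_def/= expr0n addr0; set r := Num.sqrt _.
  have [->|r0] := eqVneq r 0; first by rewrite mul0r invr0.
  by rewrite expr2 invfM mulrA divff// mul1r.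
have e0 : 0 < modulus (1 - expi lam).
  rewrite lt_neqAle modulus_ge0 andbT eq_sym; apply: contra lam1 => /eqP z0.
  have := norm_Re_le (1 - expi lam); have := norm_Im_le (1 - expi lam).
  rewrite z0 !normr_le0 => i0 r0.
  by rewrite eq_sym -subr_eq0 eq_complex r0 i0.
rewrite mM mV mM modulus_real (gtr0_norm D0).
have c0 : 0 <= 2 * C * Dl by rewrite !mulr_ge0// ltW.
have := modulus_cintegral_defect (cbounded_iter j c0 cbounded_defect_h).
set z := modulus (cintegral _ _ _) => zb.
rewrite ler_pdivrMr; last by rewrite mulr_gt0.
apply: (le_trans zb); rewrite le_eqVlt; apply/orP; left; apply/eqP.
by field; rewrite gt_eqF.
Qed.

End perturbation.

(** * The size of a target set *)
Section targets.
Context (R : realType).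
Local Notation leb := (@lebesgue_measure R).
Variable psi : probability (measurableTypeR R) R.

Lemma lebesgue_measure_shift (B : set R) e : measurable B ->
  leb [set x | B (x + e)] = leb B.
Proof.
move=> mB; rewrite (lebesgue_measure_affine e ltr01 mB) mul1e.
by congr (leb _); apply/seteqP; split=> x /=; rewrite mul1r addrC.
Qed.

(** Tonelli and the invariance of the Lebesgue measure under translations. *)
Lemma Rint_hit_prob_le (D B : set R) : measurable D -> (leb D < +oo)%E -> measurable B ->
  ((\int[leb]_(x in D) hit_prob psi B x)%:E <= leb B)%E.
Proof.
move=> mD muD mB.
rewrite (@EFin_Rint _ (measurableTypeR R) R leb D mD muD); last exact: bmeas_hit_prob.
pose f (p : measurableTypeR R * measurableTypeR R) : \bar R := (\1_B (p.1 + p.2))%:E.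
have mf : measurable_fun setT f.
  apply/measurable_EFinP.
  apply: (@measurableT_comp _ _ _ _ _ _ (\1_B : R -> R)); first exact: measurable_indic.
  exact: measurable_funD.
have f0 p : (0 <= f p)%E by rewrite lee_fin indicE.
have fub := @fubini_tonelli _ _ (measurableTypeR R) (measurableTypeR R) R leb psi f mf f0.
apply: (@le_trans _ _ (\int[leb]_x (hit_prob psi B x)%:E)%E).
  apply: ge0_subset_integral => //.
    by apply/measurable_EFinP; exact: measurable_hit_prob.
  by move=> x _; rewrite lee_fin; have /andP[] := hit_prob01 psi mB x.
rewrite (eq_integral (fun x => \int[psi]_e f (x, e)))%E; last first.
  move=> x _; rewrite EFin_hit_prob//.
  rewrite -[LHS](_ : \int[psi]_e (\1_[set e | B (x + e)] e)%:E = _)%E; last first.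
    by rewrite integral_indic ?setIT//; exact: measurable_shift.
  by apply: eq_integral => e _; rewrite /f/= !indicE; congr (_%:R%:E); apply/idP/idP; rewrite !inE.
rewrite fub (eq_integral (cst (leb B))); last first.
  move=> e _ /=; rewrite -(lebesgue_measure_shift e mB).
  rewrite -[RHS](_ : \int[leb]_x (\1_[set x | B (x + e)] x)%:E = _)%E; last first.
    rewrite integral_indic ?setIT//.
    rewrite (_ : [set x | B (x + e)] = [set x | B (e + x)]); first exact: measurable_shift.
    by apply/seteqP; split=> x /=; rewrite addrC.
  by apply: eq_integral => x _; rewrite /f/= !indicE; congr (_%:R%:E); apply/idP/idP; rewrite !inE.
rewrite integral_cst//.
by rewrite -[leRHS]mule1 le_eqVlt; apply/orP; left; apply/eqP; congr (_ * _)%E;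
  exact: probability_setT.
Qed.

Lemma lebesgue_measure_le_diameter (B : set R) (a b : R) : measurable B ->
  B `<=` `[a, b]%classic -> (leb B <= (2 * diameter B)%:E)%E.
Proof.
move=> mB Bab.
have [->|/set0P[x Bx]] := eqVneq B set0.
  rewrite measure0 lee_fin mulr_ge0// /diameter.
  rewrite (_ : [set _ | _ in _] = set0) ?sup0//.
  by apply/seteqP; split=> // _ [[? ?] [[]]].
have dist y : B y -> `|x - y| <= diameter B.
  move=> By; apply: ub_le_sup; last by exists (x, y).
  exists (b - a) => _ [[u v] [/= /Bab + /Bab +] <-]; rewrite /= !in_itv/= => u1 v1.
  by rewrite ler_norml; lra.
have sub : B `<=` `[x - diameter B, x + diameter B]%classic.
  by move=> y /dist; rewrite /= in_itv/= ler_norml; lra.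
apply: (@le_trans _ _ (leb `[x - diameter B, x + diameter B]%classic)).
  by apply: le_measure; rewrite ?inE.
rewrite lebesgue_measure_itv/= lte_fin; case: ifP => _.
  by rewrite -EFinD lee_fin; lra.
by rewrite lee_fin mulr_ge0//; have := dist x Bx; rewrite subrr normr0.
Qed.

(** The complement of the support is negligible, being a countable union of
negligible balls with rational centres and radii. *)
Lemma support_meets (A : set R) : measurable A -> (0 < psi A)%E ->
  exists2 e, A e & measure_support psi e.
Proof.
move=> mA A0; apply: contrapT => /forall2NP nosupp.
pose F n : set R := if unpickle n is Some (q, j) then
  (if psi (ball (ratr q : R) (j.+1%:R^-1)) == 0%E then ball (ratr q : R) (j.+1%:R^-1) else set0)
  else set0.
have mF n : measurable (F n).
  by rewrite /F; case: unpickle => [[q j]|]//; case: ifP => // _; exact: measurable_ball.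
have F0 n : psi (F n) = 0%E.
  rewrite /F; case: unpickle => [[q j]|]; last exact: measure0.
  by case: ifP => [/eqP //|_]; exact: measure0.
have AF : A `<=` \bigcup_n F n.
  move=> e Ae; have [//|] := nosupp e => /existsNP[r] /not_implyP[r0].
  move/negP; rewrite -leNgt => pr0.
  have [j jr] : exists j : nat, (j.+1%:R^-1 : R) < r / 2.
    have r2 : 0 < r / 2 by rewrite divr_gt0.
    by have := near_infty_natSinv_lt (PosNum r2) => -[N _ H]; exists N; exact: H N (leqnn N).
  have jp : 0 < (j.+1%:R^-1 : R) by rewrite invr_gt0.
  have ltj : e - j.+1%:R^-1 < e + j.+1%:R^-1 :> R.
    by rewrite ltrD2l (lt_trans _ jp)// oppr_lt0.
  have [q] := rat_in_itvoo ltj.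
  rewrite in_itv/= => /andP[q1 q2].
  exists (pickle (q, j)); first exact: Logic.I.
  rewrite /F pickleK.
  have sub : ball (ratr q : R) j.+1%:R^-1 `<=` ball e r.
    move=> y; rewrite -!ball_normE/= => qy.
    have -> : e - y = (e - ratr q) + (ratr q - y) by ring.
    apply: (le_lt_trans (ler_normD _ _)).
    have eq : `|e - ratr q| < j.+1%:R^-1.
      by rewrite ltr_norml; move: q1 q2; set dl : R := _^-1 => *; lra.
    by move: eq qy jr; set dl : R := _^-1 => *; lra.
  rewrite ifT; first by rewrite -ball_normE/= ltr_norml; move: q1 q2; set dl : R := _^-1 => *; lra.
  rewrite eq_le measure_ge0 andbT (le_trans _ pr0)// le_measure ?inE//; exact: measurable_ball.
move: A0; rewrite ltNge => /negP; apply.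
apply: (le_trans (measure_sigma_subadditive psi mF mA AF)).
by rewrite eseries0// => n _ _; exact: F0.
Qed.

Lemma hit_prob_le_weighted (B : set R) (D : set R) (h : R -> R) (m : R) : measurable B ->
  0 <= m -> (forall x, 0 <= h x) ->
  (forall x, D x -> (exists2 e, measure_support psi e & B (x + e)) -> m <= h x) ->
  forall x, D x -> m * hit_prob psi B x <= hit_prob psi B x * h x.
Proof.
move=> mB m0 h0 mh x Dx; rewrite mulrC; have /andP[w0 _] := hit_prob01 psi mB x.
have [->|wn0] := eqVneq (hit_prob psi B x) 0; first by rewrite !mul0r.
rewrite ler_wpM2l// mh//.
have [|e Be se] := @support_meets [set e | B (x + e)] (measurable_shift mB x).
  by rewrite -EFin_hit_prob// lte_fin lt_neqAle eq_sym wn0.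
by exists e.
Qed.

End targets.

(** * The Poisson limit and its distribution function *)
Section poisson_limit.
Context (R : realType).
Variables (tau C V m r : R) (p0 j : nat) (Dl ell x : nat -> R).
Local Notation q := (@poisson_mass R).
Local Notation N n := (Num.truncn (tau / Dl n)).+1.
Hypotheses (tau0 : 0 < tau) (C0 : 0 <= C) (V0 : 0 <= V) (m0 : 0 < m) (r01 : 0 <= r < 1).
Hypotheses (Dl0 : forall n, 0 < Dl n) (ell0 : forall n, 0 <= ell n).
Hypothesis mell : forall n, m * ell n <= Dl n.
Hypotheses (cDl : Dl n @[n --> \oo] --> 0) (cell : ell n @[n --> \oo] --> 0).
Hypothesis x_near : forall n p, (p0 <= p)%N ->
  `|x n - q ((N n)%:R * Dl n) j| <= 2 * p%:R * Dl n + (N n)%:R *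
   (2 * (ell n * (C * (p%:R * Dl n)) + ell n * (r ^+ p * V) + Dl n * (p%:R * Dl n)) +
    j.+2%:R * Dl n ^+ 2).

Lemma count_scale n : tau <= (N n)%:R * Dl n <= tau + Dl n.
Proof.
have t0 : 0 <= tau / Dl n by rewrite divr_ge0// ltW.
have /andP[t1 t2] : (Num.truncn (tau / Dl n))%:R <= tau / Dl n < (N n)%:R.
  by rewrite truncn_itv.
apply/andP; split; first by rewrite -ler_pdivrMr// ltW.
by rewrite -natr1 mulrDl mul1r lerD2r -ler_pdivlMr.
Qed.

Let slack p n := 2 * p%:R * Dl n +
  (tau + 1) * (2 * C * p%:R * ell n + 2 * p%:R * Dl n + j.+2%:R * Dl n).

Let cslack p : slack p n @[n --> \oo] --> 0.
Proof.
have -> : (0 : R) = 2 * p%:R * 0 + (tau + 1) * (2 * C * p%:R * 0 + 2 * p%:R * 0 + j.+2%:R * 0).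
  by rewrite !(mulr0, addr0).
by apply: cvgD; [exact: cvgMr|apply: cvgMr; apply: cvgD; [apply: cvgD; exact: cvgMr|exact: cvgMr]].
Qed.

(** The number of steps times [Delta] is at most [tau + 1], and [ell] is at
most [Delta / m]: every error term but the one in [r ^+ p] keeps a factor that
tends to [0] when [p] is fixed. *)
Lemma x_near_slack n p : (p0 <= p)%N -> Dl n <= 1 ->
  `|x n - q ((N n)%:R * Dl n) j| <= slack p n + (tau + 1) * (2 * V / m) * r ^+ p.
Proof.
move=> pp D1; apply: (le_trans (x_near n pp)).
have /andP[_ ND] := count_scale n; have /andP[r0 _] := r01.
have rp0 : 0 <= r ^+ p by rewrite exprn_ge0.
set Nn : R := (N n)%:R in ND *; have Nn0 : 0 <= Nn by rewrite ler0n.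
have D0 := Dl0 n; have l0 := ell0 n.
have lD : ell n <= Dl n / m by rewrite ler_pdivlMr// mulrC.
have ND1 : Nn * Dl n <= tau + 1 by lra.
set pR : R := p%:R; have pR0 : 0 <= pR by rewrite ler0n.
set jR : R := j.+2%:R; have jR0 : 0 <= jR by rewrite ler0n.
have -> : slack p n + (tau + 1) * (2 * V / m) * r ^+ p =
   2 * pR * Dl n + (tau + 1) * (2 * C * pR * ell n + 2 * pR * Dl n + jR * Dl n + 2 * V / m * r
     ^+ p).
  by rewrite /slack -/pR -/jR; ring.
rewrite lerD2l.
apply: (@le_trans _ _ (Nn * Dl n * (2 * C * pR * ell n + 2 * pR * Dl n + jR * Dl n + 2 * V / m *
  r ^+ p))).
  rewrite -mulrA; apply: ler_wpM2l => //.
  have H : ell n * (r ^+ p * V) <= Dl n / m * (r ^+ p * V).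
    by apply: ler_wpM2r => //; rewrite mulr_ge0.
  have -> : Dl n * (2 * C * pR * ell n + 2 * pR * Dl n + jR * Dl n + 2 * V / m * r ^+ p) =
     2 * (ell n * (C * (pR * Dl n))) + 2 * (Dl n / m * (r ^+ p * V)) + 2 * (Dl n * (pR * Dl n))
       + jR * Dl n ^+ 2.
    by ring.
  lra.
apply: ler_wpM2r => //.
have D0' := ltW D0; have m0' := ltW m0.
apply: addr_ge0; last by rewrite mulr_ge0// divr_ge0// mulr_ge0.
by apply: addr_ge0; [apply: addr_ge0|]; rewrite !mulr_ge0.
Qed.

(** The exponent [p] is chosen first, to make the mixing error small; the
remaining errors then vanish as [n] tends to infinity. *)
Lemma poisson_limit : x n @[n --> \oo] --> q tau j.
Proof.
apply/cvgrPdist_lt => e e0.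
have e3 : 0 < e / 3 by lra.
have [p [pp rp]] : exists p, (p0 <= p)%N /\ (tau + 1) * (2 * V / m) * r ^+ p < e / 3.
  have /andP[r0 r1] := r01.
  have cr : (tau + 1) * (2 * V / m) * r ^+ p @[p --> \oo] --> (0 : R).
    rewrite -[0](mulr0 ((tau + 1) * (2 * V / m))); apply: cvgMr.
    by apply: cvg_expr; rewrite ger0_norm.
  have [p1 _ H] := cvgr_lt (0 : R) cr (e / 3) e3.
  by exists (maxn p0 p1); split; [exact: leq_maxl|apply: H; exact: leq_maxr].
have cND : (N n)%:R * Dl n @[n --> \oo] --> tau.
  apply: (@squeeze_cvgr _ _ _ _ (cst tau) (fun n => tau + Dl n)).
  - by apply: nearW => n; exact: count_scale.
  - exact: cvg_cst.
  - by rewrite -[tau in X in _ --> X]addr0; apply: cvgD => //; exact: cvg_cst.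
have cq : q ((N n)%:R * Dl n) j @[n --> \oo] --> q tau j.
  exact: (continuous_cvg _ (@poisson_mass_continuous R j tau) cND).
near=> n.
have D1 : Dl n <= 1 by apply/ltW; near: n; exact: (cvgr_lt _ cDl).
have sl : slack p n < e / 3 by near: n; exact: (cvgr_lt _ (cslack p)).
have qq : `|q tau j - q ((N n)%:R * Dl n) j| < e / 3.
  by near: n; move/cvgrPdist_lt : cq; exact.
have xx := x_near_slack pp D1.
have -> : q tau j - x n = (q tau j - q ((N n)%:R * Dl n) j) - (x n - q ((N n)%:R * Dl n) j) by ring.
apply: (le_lt_trans (ler_normB _ _)); lra.
Unshelve. all: by end_near.
Qed.

End poisson_limit.

Section integer_valued.
Context d (Om : measurableType d) (R : realType) (P : probability Om R).
Variable X : {RV P >-> R}.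
Hypothesis X_nat : P [set w | exists j : nat, X w = j%:R] = 1%E.

Let Nat : set Om := [set w | exists j : nat, X w = j%:R].

Let mlevel j : measurable (X @^-1` [set (j%:R : R)]).
Proof. by apply: measurable_pre => //; exact: measurable_funP. Qed.

Let NatE : Nat = \bigcup_j X @^-1` [set (j%:R : R)].
Proof. by apply/seteqP; split=> w; [move=> [j wj]; exists j|move=> [j _ wj]; exists j]. Qed.

Let mNat : measurable Nat.
Proof. by rewrite NatE; exact: bigcupT_measurable. Qed.

Lemma probability_restrict (A : set Om) : measurable A -> P A = P (A `&` Nat).
Proof.
move=> mA; apply/eqP; rewrite eq_le; apply/andP; split; last first.
  by rewrite le_measure ?inE//; exact: measurableI.
have C0 : P (~` Nat) = 0%E by rewrite probability_setC// X_nat subee.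
apply: (@le_trans _ _ (P ((A `&` Nat) `|` ~` Nat))).
  apply: le_measure; rewrite ?inE//.
    by apply: measurableU; [exact: measurableI|exact: measurableC].
  by move=> w Aw; have [wN|wN] := pselect (Nat w); [left|right].
have -> : P ((A `&` Nat) `|` ~` Nat) = (P (A `&` Nat) + P (~` Nat))%E.
  rewrite measureU//; [exact: measurableI|exact: measurableC|].
  by apply/seteqP; split=> // w [[_ ?] ?].
by rewrite C0 adde0.
Qed.

Lemma cdf_integer t : cdf X t =
  (\sum_(j < (if (0 <= t)%R then (Num.truncn t).+1 else 0%N)) P (X @^-1` [set (j%:R : R)]))%E.
Proof.
set K := if _ then _ else _.
have mA : measurable (X @^-1` `]-oo, t]%classic) by apply: measurable_pre => //;
  exact: measurable_funP.
rewrite /cdf /distribution /pushforward (probability_restrict mA).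
have -> : X @^-1` `]-oo, t]%classic `&` Nat = \big[setU/set0]_(j < K) X @^-1` [set (j%:R : R)].
  rewrite -(bigcup_mkord K (fun j => X @^-1` [set (j%:R : R)])); apply/seteqP; split=> w /=.
    rewrite in_itv/= => -[wt [j wj]]; exists j => //=; rewrite /K.
    have t0 : 0 <= t by apply: le_trans wt; rewrite wj.
    by rewrite t0 ltnS truncn_ge_nat// -wj.
  move=> [j /= jK wj]; split; last by exists j.
  rewrite in_itv/= wj; move: jK; rewrite /K; case: ifP => // t0.
  by rewrite ltnS truncn_ge_nat.
apply: (measure_bigsetU P (F := fun j : nat => X @^-1` [set (j%:R : R)])) => //.
apply/trivIsetP => i j _ _ ij; apply/seteqP; split=> // w [/= -> /eqP].
by rewrite eqr_nat (negbTE ij).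
Qed.

End integer_valued.

(** At each [t] the distribution function is the sum of the same finitely many
point probabilities for all the variables. *)
Lemma cvg_cdf_integer (R : realType) d (Om : measurableType d) (P : probability Om R)
  (S : nat -> {RV P >-> R}) d' (Om' : measurableType d') (Q : probability Om' R)
  (W : {RV Q >-> R}) (a : nat -> nat -> R) (b : nat -> R) :
  (forall n, P [set w | exists j : nat, S n w = j%:R] = 1%E) ->
  Q [set w | exists j : nat, W w = j%:R] = 1%E ->
  (forall n j, P (S n @^-1` [set (j%:R : R)]) = (a n j)%:E) ->
  (forall j, Q (W @^-1` [set (j%:R : R)]) = (b j)%:E) ->
  (forall j, a n j @[n --> \oo] --> b j) ->
  cvg_in_distribution S W.
Proof.
move=> SN WN Sa Wb ab t _; pose K := if 0 <= t then (Num.truncn t).+1 else 0%N.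
have -> : cdf W t = (\sum_(j < K) b j)%:E.
  by rewrite (cdf_integer WN) -sumEFin; apply: eq_bigr => j _; exact: Wb.
have -> : (fun n => cdf (S n) t) = EFin \o (fun n => \sum_(j < K) a n j).
  apply/funext => n; rewrite (cdf_integer (SN n)) /= -sumEFin.
  by apply: eq_bigr => j _; exact: Sa.
apply: cvg_EFin; first by apply: nearW.
apply: cvg_big => [|j _]; [exact: add_continuous|exact: ab].
Qed.

(** The Poisson masses add up to [1]. *)
Lemma poisson_support (R : realType) d (Om : measurableType d) (Q : probability Om R)
  (W : {RV Q >-> R}) (tau : R) : 0 < tau ->
  (forall j, Q (W @^-1` [set (j%:R : R)]) = (poisson_mass tau j)%:E) ->
  Q [set w | exists j : nat, W w = j%:R] = 1%E.
Proof.
move=> tau0 QW.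
have -> : [set w | exists j : nat, W w = j%:R] = \bigcup_j W @^-1` [set (j%:R : R)].
  by apply/seteqP; split=> w; [move=> [j wj]; exists j|move=> [j _ wj]; exists j].
have mlev j : measurable (W @^-1` [set (j%:R : R)]).
  by apply: measurable_pre => //; exact: measurable_funP.
have tlev : trivIset setT (fun j : nat => W @^-1` [set (j%:R : R)]).
  apply/trivIsetP => i j _ _ ij; apply/seteqP; split=> // w [/= -> /eqP].
  by rewrite eqr_nat (negbTE ij).
have -> : Q (\bigcup_j W @^-1` [set (j%:R : R)]) =
    (\sum_(0 <= j <oo | j \in [set: nat]) Q (W @^-1` [set (j%:R : R)]))%E.
  by rewrite measure_bigcup.
have -> : (1%E : \bar R) = (\esum_(k in [set: nat]) (poisson_pmf tau k)%:E)%E.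
  have := @probability_setT _ _ R (poisson_prob tau 0).
  by rewrite [LHS]/= /poisson_prob tau0 => <-.
rewrite -nneseries_esumT; last by move=> *; rewrite lee_fin poisson_pmf_ge0.
rewrite (eq_eseriesl (Q := xpredT)); last by move=> i; rewrite in_setT.
apply: eq_eseriesr => j _; rewrite QW /poisson_mass /poisson_pmf tau0.
by congr EFin; rewrite mulrAC.
Qed.

(** * The constants of the random map *)
Section assembly.
Context (R : realType) (M : noisy_map R).
Variables (mu : probability (measurableTypeR R) R) (h : R -> R) (psi :
  probability (measurableTypeR R) R).
Variables (phi : R -> \bar R) (u : nat -> R).
Context (d : measure_display) (Omega : measurableType d) (P : probability Omega R).
Variables (x0 : {RV P >-> R}) (eta eps : nat -> {RV P >-> R}).
Hypotheses (TM : assumption_TM M) (ST : stationary_setting M mu h)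
  (BB : assumption_B M psi h phi u)
  (DV : driving_variables M mu psi x0 eta eps).
Local Notation leb := (@lebesgue_measure R).
Local Notation D := (dom M).
Local Notation G := (Gamma M).
Local Notation k := (Defs.kernel M).
Local Notation I f := (\int[leb]_(x in D) f x).
Local Notation bm := (bmeas D).
Local Notation L := (transfer M).
Local Notation B := (target M phi u).
Local Notation w n := (hit_prob psi (B n)).
Local Notation Dl := (Delta mu psi B).
Let mD : measurable (D : set (measurableTypeR R)) := measurable_dom M.
Let G0 : 0 < G := Gamma_gt0 TM.
Let muD : ((leb : {sigma_finite_measure set (measurableTypeR R) -> \bar R}) D < +oo)%E
  := leb_dom_fin TM.

(** The noise density is normalized because it is that of a random variable. *)
Lemma noise_mass1 : noise_law M setT = 1%E.
Proof. by rewrite -(dv_eta DV 0 measurableT); exact: probability_setT. Qed.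
Let mass1 := noise_mass1.

Lemma density_off_dom x : ~ D x -> h x = 0.
Proof.
move=> nDx; apply: (st_h_support ST) => xG; apply: nDx; move: xG.
have g0 := G0; have D1 : D (1 - G / 2) by rewrite /dom/= in_itv/=; lra.
have /andP[T0 _] := T_dom TM D1.
rewrite /dom_Gamma /dom/= !in_itv/= => /andP[x1 x2]; lra.
Qed.

Lemma integral_density_dom (A : set R) : measurable A ->
  (\int[leb]_(x in A) (h x)%:E = \int[leb]_(x in D) (h x * \1_A x)%:E)%E.
Proof.
move=> mA; rewrite [LHS]integral_mkcond [RHS]integral_mkcond; apply: eq_integral => x _.
rewrite !patchE indicE; have [Dx|/negP] := boolP (x \in D).
  by case: (x \in A); rewrite ?mulr1 ?mulr0.
by rewrite inE => /density_off_dom ->; rewrite if_same.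
Qed.

Lemma integral_h : (\int[leb]_(x in D) (h x)%:E = 1)%E.
Proof.
have [muD1 _] := st_stationary ST.
by rewrite -(st_density ST mD) muD1.
Qed.

Section constants.
Variable C : R.
Hypothesis kernelC : forall x z, D x -> k x z <= C.

Lemma transfer_h z : D z -> L h z = h z.
Proof.
move=> Dz; have := st_h_fixed ST Dz; rewrite (markov_real M) => /eqP.
by rewrite eq_complex/= => /andP[/eqP].
Qed.

(** The fixed point equation gives [h = L h <= C]. The integral is estimated
in the extended reals because the integrability of [h * k] is not known before. *)
Lemma bmeas_h : bm h.
Proof.
split; first exact: (st_h_measurable ST).
exists C => z Dz; rewrite ger0_norm ?(st_h_ge0 ST)// -(transfer_h Dz) -lee_fin.
have C0 := kernel_bound_ge0 TM kernelC.
have le : (\int[leb]_(x in D) (h x * k x z)%:E <= C%:E)%E.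
  rewrite -[leRHS]mule1 -integral_h -ge0_integralZl//.
  - apply: ge0_le_integral => //.
    + by move=> x _; rewrite lee_fin mulr_ge0 ?(st_h_ge0 ST)// kernel_ge0.
    + apply/measurable_EFinP; apply: measurable_funTS; apply: measurable_funM;
      first exact: (st_h_measurable ST).
      exact: (bmeas_measurable (bmeas_kernel TM kernelC z)).
    + apply/measurable_EFinP; apply: measurable_funTS; apply: measurable_funM => //;
      exact: (st_h_measurable ST).
    + by move=> x Dx; rewrite lee_fin mulrC ler_wpM2r ?(st_h_ge0 ST)// kernelC.
  - apply/measurable_EFinP; apply: measurable_funTS; exact: (st_h_measurable ST).
  - by move=> x _; rewrite lee_fin (st_h_ge0 ST).
rewrite /transfer /Rintegral fineK// ge0_fin_numE; first exact: le_lt_trans le (ltry _).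
by apply: integral_ge0 => x _; rewrite lee_fin mulr_ge0 ?(st_h_ge0 ST)// kernel_ge0.
Qed.

Lemma Rint_h : I h = 1.
Proof. by rewrite /Rintegral integral_h. Qed.

Lemma law_x0 : has_density M P setT x0 h.
Proof.
move=> A mA; rewrite setTI -[LHS]/(distribution P x0 A) (dv_x0 DV mA) (st_density ST mA).
rewrite integral_density_dom// (EFin_Rint mD muD)//.
by apply: bmeasM; [exact: bmeas_h|exact: (bmeas_indic R D mA)].
Qed.

Lemma measurable_target n : measurable (B n).
Proof.
have := emeasurable_fun_o_infty mD (b_measurable BB) (u n)%:E.
by congr (measurable _).
Qed.
Let mB := measurable_target.

Lemma DeltaE n : Dl n = I (fun x => w n x * h x).
Proof.
rewrite /Delta -[LHS]/(\int[mu]_x w n x) /Rintegral; congr fine.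
have bh := bmeas_h.
pose f x : \bar R := (h x)%:E.
have hD : (fun x => (h x)%:E) = (fun x => (h x)%:E) \_ D.
  apply/funext => x; rewrite patchE; case: ifPn => // /negP; rewrite inE => /density_off_dom -> //.
have fi : (leb : {sigma_finite_measure set (measurableTypeR R) -> \bar R}).-integrable setT f.
  have := bmeas_integrable mD muD bh.
  by move/(integrable_mkcond _ mD); rewrite /f hD.
rewrite (@integral_density _ (measurableTypeR R) R mu leb f)//.
- rewrite [RHS]integral_mkcond; apply: eq_integral => x _; rewrite patchE /f /= -EFinM.
  by case: ifPn => // /negP; rewrite inE => /density_off_dom ->; rewrite mulr0.
- exact: (st_density ST).
apply: (@le_integrable _ _ _ _ _ _ _ (cst 1%E)) => //.
- by apply/measurable_EFinP; exact: measurable_hit_prob.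
- by move=> x _; rewrite /= lee_fin normr1 ger0_norm; have /andP[] := hit_prob01 psi (mB n) x.
- by have := finite_measure_integrable_cst mu 1 measurableT.
Qed.

Lemma hit_mass_cvg0 : I (w n) @[n --> \oo] --> 0.
Proof.
have c2 : 2 * diameter (B n) @[n --> \oo] --> 0.
  by rewrite -[0](mulr0 2); apply: cvgMr; exact: (b_diameter BB).
apply: (squeeze_cvgr _ (cvg_cst 0) c2).
apply: nearW => n; apply/andP; split.
  by apply: Rintegral_ge0 => x _; have /andP[] := hit_prob01 psi (mB n) x.
rewrite -lee_fin; apply: (le_trans (Rint_hit_prob_le psi mD muD (mB n))).
by apply: (lebesgue_measure_le_diameter (mB n)) => x [Dx _]; exact: Dx.
Qed.

Lemma Delta_le n : Dl n <= C * I (w n).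
Proof.
have bw := bmeas_hit_prob psi (mB n) D.
rewrite DeltaE -(RintZ mD muD _ bw); apply: (le_Rint mD muD).
- by apply: bmeasM => //; exact: bmeas_h.
- exact: bmeasZ.
move=> x Dx; have /andP[w0 _] := hit_prob01 psi (mB n) x.
rewrite mulrC ler_wpM2r// -(transfer_h Dx).
have := transfer_le TM kernelC x bmeas_h (fun y _ => st_h_ge0 ST y).
by rewrite Rint_h mulr1.
Qed.

Lemma Delta_cvg0 : Dl n @[n --> \oo] --> 0.
Proof.
have c2 : C * I (w n) @[n --> \oo] --> 0.
  by rewrite -[0](mulr0 C); apply: cvgMr; exact: hit_mass_cvg0.
apply: (squeeze_cvgr _ (cvg_cst 0) c2); apply: nearW => n.
rewrite Delta_le andbT DeltaE; apply: Rintegral_ge0 => x _.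
by rewrite mulr_ge0 ?(st_h_ge0 ST)//; have /andP[] := hit_prob01 psi (mB n) x.
Qed.

(** This turns the error [ell * r ^+ p] of one step into [Delta * r ^+ p / m],
which stays small when summed over [tau / Delta] steps. *)
Lemma Delta_ge : exists2 m : R, 0 < m & forall n, m * I (w n) <= Dl n.
Proof.
have [m m0 mh] := b_density BB; exists m => // n.
have bw := bmeas_hit_prob psi (mB n) D.
rewrite DeltaE -(RintZ mD muD _ bw); apply: (le_Rint mD muD).
- exact: bmeasZ.
- by apply: bmeasM => //; exact: bmeas_h.
exact: (hit_prob_le_weighted (mB n) (ltW m0) (st_h_ge0 ST) (mh n)).
Qed.

End constants.
End assembly.

(** * Visit counts and their limit *)
Lemma cvg0_modulus (R : realType) (z : nat -> R[i]) (b : nat -> R) :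
  (forall n, modulus (z n) <= b n) -> b n @[n --> \oo] --> 0 -> z n @[n --> \oo] --> 0.
Proof.
move=> zb b0; apply/cvgrPdist_lt => e; rewrite ltcE/= => /andP[/eqP ie re].
have : \forall n \near \oo, b n < complex.Re e by exact: (cvgr_lt _ b0).
apply: filterS => n bn; rewrite sub0r normrN ltcE ie; apply/andP; split.
  by rewrite normc_def.
exact: le_lt_trans (zb n) bn.
Qed.

Lemma return_ratio_cvg0 (R : realType) (M : noisy_map R)
    (mu : probability (measurableTypeR R) R) (h : R -> R) (psi : probability (measurableTypeR R) R)
    (phi : R -> \bar R) (u : nat -> R) (lam : R) (j : nat) :
  assumption_TM M -> noise_law M setT = 1%E ->
  stationary_setting M mu h -> assumption_B M psi h phi u ->
  (forall n, 0 < Delta mu psi (target M phi u) n) -> expi lam != 1 ->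
  return_ratio M psi h (target M phi u) lam j n @[n --> \oo] --> 0.
Proof.
move=> TM mass1 ST BB D0 lam1; have [C kernelC] := st_kernel_bounded ST.
have bh := bmeas_h TM ST kernelC.
pose c := 12 * C * (C * (2 * (1 + Gamma M))) ^+ j / modulus (1 - expi lam).
apply: (cvg0_modulus (b := fun n => c *
   \int[lebesgue_measure]_(x in dom M) hit_prob psi (target M phi u n) x)).
  move=> n; have mB := measurable_target BB n.
  apply: (modulus_return_ratio TM mass1 kernelC mB bh) => //.
  - exact: (st_h_ge0 ST).
  - by rewrite -(DeltaE TM ST BB kernelC).
by rewrite -[0](mulr0 c); apply: cvgMr; exact: (hit_mass_cvg0 TM BB).
Qed.

Section visit_count.
Context (R : realType) (M : noisy_map R) d (Omega : measurableType d) (P : probability Omega R).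
Variables (x0 : {RV P >-> R}) (eta eps : nat -> {RV P >-> R}) (B : set R).

Definition visit_count (m : nat) (om : Omega) : nat :=
  \sum_(0 <= i < m) (observed M x0 eta eps i om \in B).

Lemma visitsE m j : visits M x0 eta eps B m j = [set om | visit_count m om = j].
Proof.
rewrite /visit_count; elim: m j => [|m IH] j.
  by case: j => [|j]; apply/seteqP; split=> om //=; rewrite big_nil.
apply/seteqP; split=> om /=; rewrite big_nat_recr//=.
  rewrite IH => -[[/= -> nhit]|[]].
    by rewrite memNset ?addn0.
  by case: j => [//|i]; rewrite IH /= => -> hitm; rewrite mem_set ?addn1.
have [ob|ob] := boolP (observed M x0 eta eps m om \in B); last first.
  by rewrite addn0 => mj; left; rewrite IH; split=> //; move/negP: ob; rewrite inE.
rewrite addn1 => mj; right; split; last by move: ob; rewrite inE.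
by rewrite -mj IH.
Qed.

Lemma visit_sumE m om :
  \sum_(0 <= i < m) \1_B (observed M x0 eta eps i om) = (visit_count m om)%:R :> R.
Proof. by rewrite /visit_count natr_sum; apply: eq_bigr => i _; rewrite indicE. Qed.

Hypothesis TM : assumption_TM M.
Hypothesis mB : measurable B.

Lemma measurable_visit_sum m : measurable_fun setT
  (fun om => \sum_(0 <= i < m) \1_B (observed M x0 eta eps i om) : R).
Proof.
elim: m => [|m IH].
  by have -> : (fun om => \sum_(0 <= i < 0) \1_B (observed M x0 eta eps i om) : R) = cst 0
    by apply/funext => om; rewrite big_nil.
have -> : (fun om => \sum_(0 <= i < m.+1) \1_B (observed M x0 eta eps i om) : R) =
   (fun om => \sum_(0 <=
     i < m) \1_B (observed M x0 eta eps i om) + \1_B (observed M x0 eta eps m om)).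
  by apply/funext => om; rewrite big_nat_recr.
apply: measurable_funD => //.
apply: (@measurableT_comp _ _ _ _ _ _ (\1_B : R -> R)); first exact: measurable_indic.
by apply: measurable_funD; [exact: (measurable_orbit TM)|exact: measurable_funP].
Qed.

Definition visit_sum m : {RV P >-> R} :=
  HB.pack (fun om => \sum_(0 <= i < m) \1_B (observed M x0 eta eps i om) : R)
    (isMeasurableFun.Build _ _ _ _ _ (measurable_visit_sum m)).

Lemma visit_sum_level m j : visit_sum m @^-1` [set (j%:R : R)] = visits M x0 eta eps B m j.
Proof.
rewrite visitsE; apply/seteqP; split=> om /=; rewrite visit_sumE.
  by move/eqP; rewrite eqr_nat => /eqP.
by move=> ->.
Qed.

End visit_count.

Lemma visit_probability_cvg (R : realType) (M : noisy_map R)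
    (mu : probability (measurableTypeR R) R) (h : R -> R) (psi : probability (measurableTypeR R) R)
    (phi : R -> \bar R) (u : nat -> R)
    (d : measure_display) (Omega : measurableType d) (P : probability Omega R)
    (x0 : {RV P >-> R}) (eta eps : nat -> {RV P >-> R}) (tau : R) (j : nat) :
  assumption_TM M -> stationary_setting M mu h -> assumption_B M psi h phi u ->
  driving_variables M mu psi x0 eta eps -> 0 < tau ->
  (forall n, 0 < Delta mu psi (target M phi u) n) ->
  fine (P (visits M x0 eta eps (target M phi u n)
    (Num.truncn (tau / Delta mu psi (target M phi u) n)).+1 j)) @[n --> \oo] -->
  poisson_mass tau j.
Proof.
move=> TM ST BB DV tau0 D0.
have mass1 := noise_mass1 DV; have [C kernelC] := st_kernel_bounded ST.
have bh := bmeas_h TM ST kernelC; have h0 := st_h_ge0 ST.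
have Lh : {in dom M, transfer M h =1 h}.
  by move=> x /set_mem Dx; exact: (transfer_h ST Dx).
have h1 := Rint_h ST.
have Kop : bv_operator M (Defs.markov M) := (st_compact ST).1.
have [V [V0 kernelV]] : exists V : R, 0 <= V /\
    {ae lebesgue_measure, forall x, dom M x ->
      (total_variation (- Gamma M) 1 (Defs.kernel M x) <= V%:E)%E}.
  have := st_kernel_variation ST; set e := ess_sup _ _ => ey.
  have [V eV] : exists V : R, (e <= V%:E)%E.
    by case: e ey => [v _|//|_]; [exists v|exists 0; rewrite leNye].
  exists (Num.max V 0); split; first by rewrite le_max lexx orbT.
  have /ess_supP [N [mN N0 subN]] := eV; exists N; split=> // x xP; apply: subN => /= xV;
    apply: xP => Dx.
  move: xV; rewrite patchE mem_set// => /le_trans; apply.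
  by rewrite lee_fin le_max lexx.
have hbv : in_bv M (fun x => ((h x)%:C)%C).
  exact: le_lt_trans (bv_norm_h TM mass1 kernelC bh h0 h1 Lh V0 kernelV) (ltry _).
have [r [p0 [r01 mix]]] := mixing TM mass1 kernelC bh h1 Lh hbv Kop (st_gap ST).
have [m m0 mell] := Delta_ge TM ST BB kernelC.
have mB := measurable_target BB.
have mD : measurable (dom M : set (measurableTypeR R)) by exact: measurable_dom.
apply: (@poisson_limit R tau C (V + 1) m r p0 j (Delta mu psi (target M phi u))
  (fun n => \int[lebesgue_measure]_(x in dom M) hit_prob psi (target M phi u n) x)) => //.
- exact: (kernel_bound_ge0 TM kernelC).
- by rewrite addr_ge0.
- by move=> n; apply: Rintegral_ge0 => x _; have /andP[] := hit_prob01 psi (mB n) x.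
- exact: (Delta_cvg0 TM ST BB kernelC).
- exact: (hit_mass_cvg0 TM BB).
move=> n p pp; pose N := (Num.truncn (tau / Delta mu psi (target M phi u) n)).+1.
have law := visits_mass TM mass1 kernelC (mB n) (dv_independent DV) (dv_eta DV) (dv_eps DV)
  bh (law_x0 TM ST DV kernelC) N j.
rewrite -/N [X in X - _](congr1 fine law).
have bw := bmeas_hit_prob psi (mB n) (dom M); have w01 := hit_prob01 psi (mB n).
have ED := DeltaE TM ST BB kernelC n.
have V1 : 0 <= V + 1 by rewrite addr_ge0.
have C0 := kernel_bound_ge0 TM kernelC.
have r0 : 0 <= r by case/andP: r01.
have ell0 : 0 <= \int[lebesgue_measure]_(x in dom M) hit_prob psi (target M phi u n) x.
  by apply: Rintegral_ge0 => x _; have /andP[] := w01 x.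
have Dn := ltW (D0 n).
set Dl := Delta mu psi (target M phi u) n in ED Dn *.
set w := hit_prob psi (target M phi u n) in bw w01 ED ell0 *.
set ell := \int[lebesgue_measure]_(x in dom M) w x in ell0 *.
pose e := ell * (C * (p%:R * Dl)) + ell * (r ^+ p * (V + 1)) + Dl * (p%:R * Dl).
rewrite -/e.
pose a i l := \int[lebesgue_measure]_(x in dom M) visit_density M h w i l x.
pose b i l := \int[lebesgue_measure]_(x in dom M) (w x * visit_density M h w i l x).
suff cmp : forall i l, (l <= j)%N -> `|a i l - poisson_mass (i%:R * Dl) l| <=
    2 * p%:R * Dl + i%:R * (2 * e + j.+2%:R * Dl ^+ 2) 
  by exact: (cmp N j (leqnn j)).
apply: (@poisson_comparison R a b Dl e p j).
- by rewrite Dn /= ED (hit_rate_le1 TM bh h0 h1 bw w01).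
- by rewrite /e !addr_ge0 ?mulr_ge0 ?exprn_ge0 ?ler0n.
- rewrite /a => -[|i] /=; first exact: h1.
  by rewrite (Rintegral_cst _ mD) mul0r.
- move=> i l; rewrite /a /b (visit_mass_step TM mass1 kernelC bh bw).
  congr (_ + _); case: l => [|l] //=.
  under eq_Rintegral do rewrite mulr0.
  by rewrite (Rintegral_cst _ mD) mul0r.
- by move=> i l; exact: (visit_mass_bounds TM kernelC bh h0 h1 Lh bw w01).
- by move=> i l; rewrite ED; exact: (hit_bounds TM kernelC bh h0 Lh bw w01).
move=> i l pi; rewrite -(subnK pi) /e ED.
exact: (hit_estimate TM mass1 kernelC bh h0 h1 Lh bw w01 V0 kernelV mix).
Qed.

Theorem proposition6p1 (R : realType) (M : noisy_map R)
    (mu : probability (measurableTypeR R) R) (h : R -> R) (psi : probability (measurableTypeR R) R)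
    (phi : R -> \bar R) (u : nat -> R)
    (d : measure_display) (Omega : measurableType d) (P : probability Omega R)
    (x0 : {RV P >-> R}) (eta eps : nat -> {RV P >-> R}) (tau : R) :
  assumption_TM M ->
  stationary_setting M mu h ->
  assumption_EI M psi ->
  assumption_B M psi h phi u ->
  driving_variables M mu psi x0 eta eps ->
  0 < tau ->
  (forall n, 0 < Delta mu psi (target M phi u) n) ->
  (forall lam : R, expi lam != 1 ->
     [/\ forall k, cvgn (return_ratio M psi h (target M phi u) lam k),
         cvgn (series (q' M psi h (target M phi u) lam)) &
         ell M psi h (target M phi u) lam = 1]) /\
  exists S : nat -> {RV P >-> R},
    (forall n w, S n w =
       \sum_(0 <= i < (Num.truncn (tau / Delta mu psi (target M phi u) n)).+1)
          \1_(target M phi u n) (observed M x0 eta eps i w)) /\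
    forall (d' : measure_display) (Omega' : measurableType d')
        (Q : probability Omega' R) (W : {RV Q >-> R}),
      (forall k : nat, Q (W @^-1` [set k%:R]) =
         (tau ^+ k * expR (- tau) / k`!%:R)%:E) ->
      cvg_in_distribution S W.
Proof.
move=> TM ST _ BB DV tau0 D0; have mass1 := noise_mass1 DV.
have mB := measurable_target BB.
split=> [lam lam1|].
  have r0 k : return_ratio M psi h (target M phi u) lam k n @[n --> \oo] --> 0.
    exact: (return_ratio_cvg0 k TM mass1 ST BB D0 lam1).
  have q0 : q' M psi h (target M phi u) lam = fun=> 0.
    by apply/funext => k; apply: cvg_lim => //; exact: r0.
  have s0 : series (q' M psi h (target M phi u) lam) = fun=> 0.
    by apply/funext => n; rewrite q0 /series/= big1.
  have c0 : series (q' M psi h (target M phi u) lam) n @[n --> \oo] --> 0.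
    by rewrite s0; exact: cvg_cst.
  split; [by move=> k; apply/cvg_ex; exists 0; exact: r0|by apply/cvg_ex; exists 0|].
  by rewrite /ell (cvg_lim _ c0)// subr0.
exists (fun n => visit_sum x0 eta eps TM (mB n)
  (Num.truncn (tau / Delta mu psi (target M phi u) n)).+1).
split=> [//|d' Omega' Q W QW].
have mv n m j := measurable_visits TM x0 eta eps (mB n) m j.
apply: (@cvg_cdf_integer _ _ _ _ _ _ _ _ _
  (fun n j => fine (P (visits M x0 eta eps (target M phi u n)
    (Num.truncn (tau / Delta mu psi (target M phi u) n)).+1 j)))
  (poisson_mass tau)) => //.
- move=> n; rewrite (_ : [set w | _] = setT) ?probability_setT//.
  apply/seteqP; split=> // om _ /=; rewrite visit_sumE; eexists; reflexivity.
- exact: (poisson_support tau0).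
- by move=> n j; rewrite visit_sum_level fineK// fin_num_measure.
by move=> j; exact: (visit_probability_cvg TM ST BB DV tau0 D0).
Qed.
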